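(* Let $\mathbb{F}$ be a field with $\mathrm{char}(\mathbb{F})\neq2$. (1) Let $V$ be a vertex operator algebra over $\mathbb{F}$, and let $M=\bigoplus_{i\geq0}M(i)$ be an irreducible admissible $V$-module (graded so that $M(0)\neq0$). Then $\mathrm{End}_V(M)\cong\mathrm{End}_{A(V)}(M(0))$. (2) Let $V$ be a strongly finitely generated vertex operator algebra over $\mathbb{F}$. Then $A(V)$, with the level filtration $F_nA(V)=(V_0+\cdots+V_n+O(V))/O(V)$, is a filtered algebra such that the associated graded algebra $\mathrm{gr}A(V)$ is a finitely generated commutative algebra. (3) Let $A$ be a filtered algebra over $\mathbb{F}$ such that the associated graded algebra $\mathrm{gr}(A)$ is a finitely generated commutative algebra. Then for each simple $A$-module $S$, every element of $\mathrm{End}_A(S)$ is algebraic over $\mathbb{F}$. Moreover, $\mathrm{End}_A(S)$ is finite-dimensional over $\mathbb{F}$.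
   Context: $\mathbb{Z}_+$ denotes the set of non-negative integers. A vertex algebra over $\mathbb{F}$ is an $\mathbb{F}$-vector space $V$ with a linear map $Y(-,z):V\to(\mathrm{End}\,V)[[z,z^{-1}]]$, $v\mapsto Y(v,z)=\sum_{n\in\mathbb{Z}}v_nz^{-n-1}$, and a vector $\mathbf{1}\in V$ such that for all $u,v\in V$: $u_nv=0$ for $n$ sufficiently large; $Y(\mathbf{1},z)=\mathrm{Id}_V$; $Y(v,z)\mathbf{1}\in V[[z]]$ with $\lim_{z\to0}Y(v,z)\mathbf{1}=v$; and the Jacobi identity $$z_0^{-1}\delta\left(\tfrac{z_1-z_2}{z_0}\right)Y(u,z_1)Y(v,z_2)-z_0^{-1}\delta\left(\tfrac{z_2-z_1}{-z_0}\right)Y(v,z_2)Y(u,z_1)=z_2^{-1}\delta\left(\tfrac{z_1-z_0}{z_2}\right)Y(Y(u,z_0)v,z_2)$$ holds, where $\delta(z)=\sum_{n\in\mathbb{Z}}z^n$ and powers of binomials are expanded in non-negative powers of the second variable. A vertex operator algebra over $\mathbb{F}$ is a vertex algebra with a grading $V=\bigoplus_{n\in\mathbb{Z}_+}V_n$, $\dim V_n<\infty$, $\mathbf{1}\in V_0$, and a vector $\omega\in V_2$, such that $u_nv\in V_{s+t-n-1}$ for $u\in V_s$, $v\in V_t$, $n\in\mathbb{Z}$ (with $V_k=0$ for $k<0$), and, writing $L(m)=\omega_{m+1}$, $[L(m),L(n)]=(m-n)L(m+n)+\frac12\binom{m+1}{3}\delta_{m+n,0}c$ for some $c\in\mathbb{F}$,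 $\frac{d}{dz}Y(v,z)=Y(L(-1)v,z)$, and $L(0)|_{V_n}=n$. For $u\in V_n$ write $\mathrm{wt}\,u=n$ (an integer). $V$ is strongly finitely generated if there is a finite-dimensional subspace $U\subset V$ such that $V$ is spanned by the elements $u^1_{-n_1}\cdots u^r_{-n_r}\mathbf{1}$ with $r\geq0$, $u^i\in U$, $n_i\geq1$. A weak $V$-module is a vector space $M$ with a linear map $Y_M(-,z):V\to(\mathrm{End}\,M)[[z,z^{-1}]]$, $v\mapsto\sum_nv_nz^{-n-1}$, such that $u_lw=0$ for $l\gg0$ ($u\in V$, $w\in M$), $Y_M(\mathbf{1},z)=\mathrm{Id}_M$, and the Jacobi identity holds with $Y_M(u,z_1)$, $Y_M(v,z_2)$, $Y_M(Y(u,z_0)v,z_2)$ in place of the corresponding operators. An admissible $V$-module is a weak $V$-module with a grading $M=\bigoplus_{n\in\mathbb{Z}_+}M(n)$ such that $u_nM(t)\subset M(s+t-n-1)$ for $u\in V_s$, $n\in\mathbb{Z}$, $t\in\mathbb{Z}_+$ (with $M(k)=0$ for $k<0$). It is irreducible if it is nonzero and has no admissible (graded) submodules other than $0$ and itself. $\mathrm{End}_V(M)$ is the $\mathbb{F}$-algebra of linear maps $M\to M$ commuting with all $v_n$ ($v\in V$, $n\in\mathbb{Z}$). Zhu's algebra: $A(V)=V/O(V)$, where $O(V)$ is spanned by $\mathrm{Res}_zY(u,z)v\frac{(1+z)^{\mathrm{wt}\,u+s}}{z^{2+t}}$ for homogeneous $u\in V$, $v\in V$, $s,t\in\mathbb{Z}_+$,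 $t\geq s$, together with $L(-1)u+L(0)u$ for $u\in V$. It is an associative algebra with unit $\mathbf{1}+O(V)$ under the product induced by $u*v=\mathrm{Res}_zY(u,z)v\frac{(1+z)^{\mathrm{wt}\,u}}{z}$ ($u$ homogeneous, extended bilinearly). For an admissible $V$-module $M$, $M(0)$ is an $A(V)$-module with $[u]=u+O(V)$ acting as $o(u)=u_{\mathrm{wt}\,u-1}$ for homogeneous $u$. An associative unital $\mathbb{F}$-algebra $A$ is filtered if it has an increasing filtration $0=F_{-1}A\subset F_0A\subset F_1A\subset\cdots$ by $\mathbb{F}$-subspaces with $1_A\in F_0A$, $F_pA\cdot F_qA\subset F_{p+q}A$ for all $p,q\geq 0$, and $A=\bigcup_{p\geq 0}F_pA$; $\mathrm{gr}A=\bigoplus_{n\geq0}F_nA/F_{n-1}A$ with the induced multiplication. *)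

(* Defs.v *)
From HB Require Import structures.
From mathcomp Require Import all_boot all_algebra.
From mathcomp Require Import boolp classical_sets functions.

Set Implicit Arguments.
Unset Strict Implicit.
Unset Printing Implicit Defensive.

Import GRing.Theory.

Local Open Scope ring_scope.
Local Open Scope quotient_scope.

Section Span.
Variables (R : pzRingType) (X : lmodType R).

Definition lspan (P : X -> Prop) (x : X) : Prop :=
  exists s : seq (R * X),
    (forall p, p \in s -> P p.2) /\ x = \sum_(p <- s) p.1 *: p.2.

Definition span_sub (P : X -> Prop) : {pred X} := fun x => `[< lspan P x >].

Lemma span_submod_closed (P : X -> Prop) : subsemimod_closed (span_sub P).
Proof.
split; first split.
- by apply/asboolP; exists [::]; rewrite big_nil.
- move=> x y /asboolP[s [Ps ->]] /asboolP[t [Pt ->]]; apply/asboolP.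
  exists (s ++ t); split; last by rewrite big_cat.
  by move=> p; rewrite mem_cat => /orP[/Ps|/Pt].
- move=> a x /asboolP[s [Ps ->]]; apply/asboolP.
  exists [seq (a * p.1, p.2) | p <- s]; split.
    by move=> p /mapP[q /Ps Pq ->].
  by rewrite big_map scaler_sumr; apply: eq_bigr => p _; rewrite scalerA.
Qed.

HB.instance Definition _ (P : X -> Prop) :=
  GRing.isSubSemiModClosed.Build R X (span_sub P) (span_submod_closed P).

Definition findim_sub (W : submodClosed X) : Prop :=
  exists s : seq X, forall x, x \in W <-> lspan (fun y => y \in s) x.

Definition findim : Prop :=
  exists s : seq X, forall x, lspan (fun y => y \in s) x.

End Span.

Lemma rpredN_submod (R : pzRingType) (X : lmodType R) (W : submodClosed X) x :
  x \in W -> - x \in W.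
Proof. by move=> Wx; rewrite -scaleN1r rpredZ. Qed.

Section ZeroSub.
Variables (R : pzRingType) (X : lmodType R).
Definition zero_sub : {pred X} := fun x => x == 0.
Lemma zero_sub_closed : subsemimod_closed zero_sub.
Proof.
rewrite /zero_sub; split; first split; rewrite ?unfold_in //.
- by move=> x y; rewrite !unfold_in => /eqP-> /eqP->; rewrite addr0.
- by move=> a x; rewrite !unfold_in => /eqP->; rewrite scaler0.
Qed.
HB.instance Definition _ :=
  GRing.isSubSemiModClosed.Build R X zero_sub zero_sub_closed.
End ZeroSub.

(* [prev G n] is G (n - 1), with G (-1) = 0. *)
Definition prev (R : pzRingType) (X : lmodType R) (G : nat -> submodClosed X)
  (n : nat) : submodClosed X := if n is k.+1 then G k else @zero_sub R X.

(* [extz G] extends G by 0 to negative indices. *)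
Definition extz (R : pzRingType) (X : lmodType R) (G : nat -> submodClosed X)
  (k : int) : submodClosed X := if k is Posz n then G n else @zero_sub R X.

Section SubModule.
Variables (R : pzRingType) (X : lmodType R) (W : submodClosed X).
Record submodule := Submodule { subval : X; subvalP : subval \in W }.
HB.instance Definition _ := [isSub for subval].
HB.instance Definition _ := [Choice of submodule by <:].
Lemma submodule_closed : subsemimod_closed (fun x : X => x \in W).
Proof.
split; first split; first exact: rpred0.
- by move=> x y; apply: rpredD.
- by move=> a x; apply: rpredZ.
Qed.
HB.instance Definition _ :=
  GRing.SubChoice_isSubLmodule.Build R X _ submodule submodule_closed.
End SubModule.

Section QuotientModule.
Variables (R : pzRingType) (X : lmodType R) (W : submodClosed X).

Definition quot_pred : {pred X} := fun x => x \in W.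
Lemma quot_pred_closed : zmod_closed quot_pred.
Proof.
split; first exact: (rpred0 W).
by move=> x y Wx Wy; apply: (rpredD (S := W)) => //; apply: rpredN_submod.
Qed.
HB.instance Definition _ := GRing.isZmodClosed.Build X quot_pred quot_pred_closed.

Definition quotient : Type := Quotient.quot quot_pred.
HB.instance Definition _ := GRing.Zmodule.on quotient.
HB.instance Definition _ := Quotient.on quotient.

Definition proj (x : X) : quotient := \pi_(Quotient.quot quot_pred) x.

Lemma projP x y : proj x = proj y <-> x - y \in W.
Proof.
rewrite /proj; split=> [/eqP|Wxy]; first by rewrite -Quotient.idealrBE.
by apply/eqP; rewrite -Quotient.idealrBE.
Qed.

Definition qrepr (a : quotient) : X := repr (a : Quotient.quot quot_pred).

Lemma qreprK (a : quotient) : proj (qrepr a) = a.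
Proof. exact: reprK. Qed.

Lemma projD x y : proj (x + y) = proj x + proj y.
Proof. by rewrite /proj !piE. Qed.

Definition quot_scale (c : R) (a : quotient) : quotient :=
  proj (c *: qrepr a).

Lemma proj_scale c x : proj (c *: x) = quot_scale c (proj x).
Proof. by apply/projP; rewrite -scalerBr rpredZ //; apply/projP; rewrite qreprK. Qed.

Lemma quotient_ind (P : quotient -> Prop) : (forall x, P (proj x)) -> forall a, P a.
Proof. by move=> Pp a; rewrite -[a]qreprK; apply: Pp. Qed.

Lemma quot_scaleA a b x : quot_scale a (quot_scale b x) = quot_scale (a * b) x.
Proof. by elim/quotient_ind: x => x; rewrite -!proj_scale scalerA. Qed.
Lemma quot_scale1 : left_id 1 quot_scale.
Proof. by elim/quotient_ind=> x; rewrite -proj_scale scale1r. Qed.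
Lemma quot_scaleDr : right_distributive quot_scale +%R.
Proof.
move=> c; elim/quotient_ind=> x; elim/quotient_ind=> y.
by rewrite -projD -!proj_scale -projD scalerDr.
Qed.
Lemma quot_scaleDl x : {morph quot_scale^~ x : a b / a + b}.
Proof. by move=> a b; elim/quotient_ind: x => x; rewrite -!proj_scale -projD scalerDl. Qed.

HB.instance Definition _ := GRing.Zmodule_isLmodule.Build R quotient
  quot_scaleA quot_scale1 quot_scaleDr quot_scaleDl.

Lemma proj_is_linear : linear proj.
Proof. by move=> c x y; rewrite projD proj_scale. Qed.
HB.instance Definition _ := GRing.isLinear.Build R X quotient *:%R proj proj_is_linear.

End QuotientModule.

(* The library's [algType] requires 1 != 0; here the zero algebra is allowed,
   since A(V) = 0 for V = 0. *)
Record algebra (F : fieldType) := Algebra {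
  alg_space : lmodType F;
  alg_mul : alg_space -> alg_space -> alg_space;
  alg_one : alg_space;
  alg_mulA : associative alg_mul;
  alg_mul1l : left_id alg_one alg_mul;
  alg_mul1r : right_id alg_one alg_mul;
  alg_mul_linl : forall y, linear (fun x => alg_mul x y);
  alg_mul_linr : forall x, linear (alg_mul x)
}.

Section AlgebraStructure.
Variables (F : fieldType) (A : algebra F).

Definition alg_sort : Type := alg_space A.
HB.instance Definition _ := GRing.Lmodule.on alg_sort.

Lemma alg_mulDl : left_distributive (alg_mul (a := A) : alg_sort -> _) +%R.
Proof.
by move=> x y z; have := alg_mul_linl z 1 x y; rewrite !scale1r.
Qed.
Lemma alg_mulDr : right_distributive (alg_mul (a := A) : alg_sort -> _) +%R.
Proof.
by move=> x y z; have := alg_mul_linr x 1 y z; rewrite !scale1r.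
Qed.
HB.instance Definition _ := GRing.Zmodule_isPzRing.Build alg_sort
  (@alg_mulA F A) (@alg_mul1l F A) (@alg_mul1r F A) alg_mulDl alg_mulDr.

Lemma alg_scaleAl (c : F) (x y : alg_sort) : c *: (x * y) = (c *: x) * y.
Proof.
have := alg_mul_linl (y : alg_space A) c x 0.
by rewrite addr0 => /esym; rewrite -[alg_mul 0 y]/(0 * y) mul0r addr0.
Qed.
Lemma alg_scaleAr (c : F) (x y : alg_sort) : c *: (x * y) = x * (c *: y).
Proof.
have := alg_mul_linr (x : alg_space A) c y 0.
by rewrite addr0 => /esym; rewrite -[alg_mul x 0]/(x * 0) mulr0 addr0.
Qed.

Definition alg_lmodType : lmodType F := alg_sort.
Definition alg_pzRingType : pzRingType := alg_sort.
End AlgebraStructure.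

Coercion alg_sort : algebra >-> Sortclass.
Coercion alg_lmodType : algebra >-> GRing.Lmodule.type.
Coercion alg_pzRingType : algebra >-> GRing.PzRing.type.

Section AlgebraNotions.
Variable F : fieldType.

Definition alg_isomorphic (A B : algebra F) : Prop :=
  exists phi : A -> B, [/\ linear phi, monoid_morphism phi & bijective phi].

Definition commutative_alg (A : algebra F) : Prop := forall x y : A, x * y = y * x.

Definition fin_gen_alg (A : algebra F) : Prop :=
  exists s : seq A, forall B : submodClosed A,
    mulr_closed B -> {subset s <= B} -> forall x, x \in B.

Definition algebraic_elt (A : algebra F) (x : A) : Prop :=
  exists2 p : {poly F}, p != 0 & \sum_(i < size p) p`_i *: x ^+ i = 0.

Definition simple_module (A : algebra F) (S : lmodType A) : Prop :=
  (exists x : S, x != 0) /\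
  (forall W : submodClosed S, (forall x, x \in W -> x = 0) \/ forall x, x \in W).

End AlgebraNotions.

(* m is a bilinear product on X which induces an associative product on X / I
   with unit the class of e; [quotalg] is X / I with this product. *)
Record descends (F : fieldType) (X : lmodType F) (I : submodClosed X)
    (m : X -> X -> X) (e : X) : Prop := Descends {
  desc_linl : forall y, linear (fun x => m x y);
  desc_linr : forall x, linear (m x);
  desc_ideall : forall x y, x \in I -> m x y \in I;
  desc_idealr : forall x y, y \in I -> m x y \in I;
  desc_assoc : forall x y z, m x (m y z) - m (m x y) z \in I;
  desc_unitl : forall x, m e x - x \in I;
  desc_unitr : forall x, m x e - x \in I
}.

Section QuotientAlgebra.
Variables (F : fieldType) (X : lmodType F) (I : submodClosed X).
Variables (m : X -> X -> X) (e : X) (H : descends I m e).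

Definition quot_mul (a b : quotient I) : quotient I :=
  proj I (m (qrepr a) (qrepr b)).

Lemma projW x y : x - y \in I -> proj I x = proj I y.
Proof. by move/projP. Qed.

Lemma proj_mul x y : proj I (m x y) = quot_mul (proj I x) (proj I y).
Proof.
set x' := qrepr (proj I x).
set y' := qrepr (proj I y).
have Ix : x - x' \in I by apply/projP; rewrite qreprK.
have Iy : y - y' \in I by apply/projP; rewrite qreprK.
apply: projW.
have mB u v w : m (u - v) w = m u w - m v w.
  by rewrite addrC -scaleN1r (desc_linl H) scaleN1r addrC.
have mBr u v w : m w (u - v) = m w u - m w v.
  by rewrite addrC -scaleN1r (desc_linr H) scaleN1r addrC.
rewrite -(subrKA (m x' y)) -mB -mBr.
by apply: rpredD; [apply: (desc_ideall H)|apply: (desc_idealr H)].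
Qed.

Lemma quot_mulA : associative quot_mul.
Proof.
elim/quotient_ind=> x; elim/quotient_ind=> y; elim/quotient_ind=> z.
by rewrite -!proj_mul; apply/projW/(desc_assoc H).
Qed.
Lemma quot_mul1l : left_id (proj I e) quot_mul.
Proof. by elim/quotient_ind=> x; rewrite -proj_mul; apply/projW/(desc_unitl H). Qed.
Lemma quot_mul1r : right_id (proj I e) quot_mul.
Proof. by elim/quotient_ind=> x; rewrite -proj_mul; apply/projW/(desc_unitr H). Qed.
Lemma quot_mul_linl b : linear (fun a => quot_mul a b).
Proof.
move=> c x y /=; rewrite -[b]qreprK -[x]qreprK -[y]qreprK.
by rewrite -(proj_is_linear I) -!proj_mul (desc_linl H) proj_is_linear.
Qed.
Lemma quot_mul_linr a : linear (quot_mul a).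
Proof.
move=> c x y /=; rewrite -[a]qreprK -[x]qreprK -[y]qreprK.
by rewrite -(proj_is_linear I) -!proj_mul (desc_linr H) proj_is_linear.
Qed.

Definition quotalg : algebra F :=
  Algebra quot_mulA quot_mul1l quot_mul1r quot_mul_linl quot_mul_linr.

End QuotientAlgebra.

(* rho induces an action of the algebra X / I on T; [quotmod] is T as a module
   over it, the class of x acting as rho x. *)
Record action_descends (F : fieldType) (X : lmodType F) (I : submodClosed X)
    (m : X -> X -> X) (e : X) (T : lmodType F) (rho : X -> T -> T) : Prop :=
    ActionDescends {
  adesc_linl : forall w, linear (fun x => rho x w);
  adesc_linr : forall x, linear (rho x);
  adesc_ideal : forall x w, x \in I -> rho x w = 0;
  adesc_mul : forall x y w, rho (m x y) w = rho x (rho y w);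
  adesc_unit : forall w, rho e w = w
}.

Section QuotientAction.
Variables (F : fieldType) (X : lmodType F) (I : submodClosed X).
Variables (m : X -> X -> X) (e : X) (H : descends I m e).
Variables (T : lmodType F) (rho : X -> T -> T).
Variable HT : action_descends I m e rho.

Definition quotmod : Type := let _ := H in let _ := HT in T.
HB.instance Definition _ := GRing.Zmodule.on quotmod.

Definition quot_act (a : quotalg H) (w : quotmod) : quotmod :=
  rho (qrepr a) w.

Lemma proj_act x w : quot_act (proj I x) w = rho x w.
Proof.
set x' := qrepr (proj I x).
have Ix : x' - x \in I by apply/projP; rewrite qreprK.
have := adesc_ideal HT w Ix; rewrite addrC -scaleN1r (adesc_linl HT) scaleN1r.
by rewrite addrC => /eqP; rewrite subr_eq0 => /eqP.
Qed.

Lemma quot_actA (a b : quotalg H) w : quot_act a (quot_act b w) = quot_act (a * b) w.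
Proof.
rewrite -[a]qreprK -[b]qreprK.
have -> : (proj I (qrepr a) : quotalg H) * proj I (qrepr b) = proj I (m (qrepr a) (qrepr b)).
  by rewrite (proj_mul H).
by rewrite !proj_act (adesc_mul HT).
Qed.
Lemma quot_act1 : left_id 1 quot_act.
Proof. by move=> w; rewrite -[1]/(proj I e) proj_act (adesc_unit HT). Qed.
Lemma quot_actDr : right_distributive quot_act +%R.
Proof.
by move=> a w w'; have := adesc_linr HT (qrepr a) 1 w w'; rewrite !scale1r.
Qed.
Lemma quot_actDl w : {morph quot_act^~ w : a b / a + b}.
Proof.
move=> a b; rewrite -[a]qreprK -[b]qreprK -[_ + _]projD !proj_act.
by have := adesc_linl HT w 1 (qrepr a) (qrepr b); rewrite !scale1r.
Qed.
HB.instance Definition _ := GRing.Zmodule_isLmodule.Build (quotalg H) quotmod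
  quot_actA quot_act1 quot_actDr quot_actDl.
End QuotientAction.

Section Commutant.
Variables (F : fieldType) (X : lmodType F) (J : Type) (op : J -> {linear X -> X}).

Definition commutes (f : X -> X) : Prop :=
  linear f /\ forall j x, f (op j x) = op j (f x).
Definition commutes_pred : {pred X -> X} := fun f => `[< commutes f >].

Lemma commutes_closed : subsemimod_closed commutes_pred.
Proof.
split; first split.
- apply/asboolP; split=> [a x y|j x] /=; first by rewrite scaler0 addr0.
  by rewrite linear0.
- move=> f g /asboolP[lf cf] /asboolP[lg cg]; apply/asboolP.
  split=> [a x y|j x] /=.
    rewrite -[(f + g) _]/(f _ + g _) lf lg addrACA -scalerDr.
    by rewrite -[f y + g y]/((f + g) y).
  by rewrite -[(f + g) _]/(f _ + g _) cf cg -linearD.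
- move=> a f /asboolP[lf cf]; apply/asboolP.
  split=> [b x y|j x] /=.
    by rewrite -[(a *: f) _]/(a *: f _) lf scalerDr !scalerA mulrC.
  by rewrite -[(a *: f) _]/(a *: f _) cf -linearZ.
Qed.

Record commutant := Commutant { cfun :> X -> X; cfunP : cfun \in commutes_pred }.
HB.instance Definition _ := [isSub for cfun].
HB.instance Definition _ := [Choice of commutant by <:].
HB.instance Definition _ :=
  GRing.SubChoice_isSubLmodule.Build F (X -> X) _ commutant commutes_closed.

Lemma commutant_lin (f : commutant) : linear f.
Proof. by case/asboolP: (cfunP f). Qed.

Lemma commutant_ext (f g : commutant) : cfun f =1 cfun g -> f = g.
Proof. by move=> fg; apply/val_inj/funext. Qed.

Lemma cfunD (f g : commutant) x : (f + g) x = f x + g x.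
Proof. by []. Qed.
Lemma cfunZ a (f : commutant) x : (a *: f) x = a *: f x.
Proof. by []. Qed.

Lemma comm_one_subproof : id \in commutes_pred.
Proof. by apply/asboolP; split. Qed.
Definition comm_one := Commutant comm_one_subproof.

Lemma comm_mul_subproof (f g : commutant) : (cfun f \o cfun g) \in commutes_pred.
Proof.
case: f g => f /= /asboolP[lf cf] [g /= /asboolP[lg cg]]; apply/asboolP.
by split=> [a x y|j x] /=; rewrite ?lg ?lf ?cg ?cf.
Qed.
Definition comm_mul f g := Commutant (comm_mul_subproof f g).

Lemma comm_mulA : associative comm_mul.
Proof. by move=> f g h; apply: commutant_ext. Qed.
Lemma comm_mul1l : left_id comm_one comm_mul.
Proof. by move=> f; apply: commutant_ext. Qed.
Lemma comm_mul1r : right_id comm_one comm_mul.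
Proof. by move=> f; apply: commutant_ext. Qed.
Lemma comm_mul_linl g : linear (fun f => comm_mul f g).
Proof. by move=> c f f'; apply: commutant_ext. Qed.
Lemma comm_mul_linr f : linear (comm_mul f).
Proof. by move=> c g g'; apply: commutant_ext => x; apply: commutant_lin. Qed.

Definition commutant_alg : algebra F :=
  Algebra comm_mulA comm_mul1l comm_mul1r comm_mul_linl comm_mul_linr.
End Commutant.

(* An A-module is an F-vector space through F -> A, c |-> c *: 1. *)
Section EndA.
Variables (F : fieldType) (A : algebra F) (S : lmodType A).

Definition restr : Type := S.
HB.instance Definition _ := GRing.Zmodule.on restr.
Definition restr_scale (c : F) (x : restr) : restr := (c *: (1 : A)) *: (x : S).

Lemma restr_scaleA a b x : restr_scale a (restr_scale b x) = restr_scale (a * b) x.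
Proof. by rewrite /restr_scale scalerA -alg_scaleAl mul1r scalerA. Qed.
Lemma restr_scale1 : left_id 1 restr_scale.
Proof. by move=> x; rewrite /restr_scale !scale1r. Qed.
Lemma restr_scaleDr : right_distributive restr_scale +%R.
Proof. by move=> c x y; apply: scalerDr. Qed.
Lemma restr_scaleDl x : {morph restr_scale^~ x : a b / a + b}.
Proof. by move=> a b; rewrite /restr_scale !scalerDl. Qed.
HB.instance Definition _ := GRing.Zmodule_isLmodule.Build F restr
  restr_scaleA restr_scale1 restr_scaleDr restr_scaleDl.

Definition actA (a : A) (x : restr) : restr := a *: (x : S).
Lemma actA_linear a : linear (actA a).
Proof.
move=> c x y; rewrite /actA -[c *: x]/(restr_scale c x).
rewrite -[c *: (_ : restr)]/(restr_scale c _) /restr_scale scalerDr !scalerA.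
by rewrite -alg_scaleAr mulr1 -alg_scaleAl mul1r.
Qed.
HB.instance Definition _ a :=
  GRing.isLinear.Build F restr restr *:%R (actA a) (actA_linear a).

Definition EndA : algebra F :=
  commutant_alg (fun a : A => actA a : {linear restr -> restr}).
End EndA.

Record is_filtered (F : fieldType) (A : algebra F)
    (Fl : nat -> submodClosed A) : Prop := IsFiltered {
  filt_incr : forall n, {subset Fl n <= Fl n.+1};
  filt_one : 1 \in Fl 0;
  filt_mul : forall p q x y, x \in Fl p -> y \in Fl q -> x * y \in Fl (p + q)%N;
  filt_exhaust : forall x, exists n, x \in Fl n
}.

(* (+)_n F_n / F_(n-1) is represented as the quotient of (+)_n F_n, whose
   elements are finitely supported sequences, by (+)_n F_(n-1). The convolution
   product of sequences induces F_p/F_(p-1) x F_q/F_(q-1) -> F_(p+q)/F_(p+q-1). *)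
Section Graded.
Variables (F : fieldType) (A : algebra F) (Fl : nat -> submodClosed A).
Hypothesis HF : is_filtered Fl.

Definition fsum_cond (G : nat -> submodClosed A) (f : nat -> A) : Prop :=
  (forall n, f n \in G n) /\ exists N, forall n, (N <= n)%N -> f n = 0.
Definition fsum_pred G : {pred nat -> A} := fun f => `[< fsum_cond G f >].
Lemma fsum_closed G : subsemimod_closed (fsum_pred G).
Proof.
split; first split.
- by apply/asboolP; split=> [n|]; [apply: rpred0|exists 0%N].
- move=> f g /asboolP[Gf [N fN]] /asboolP[Gg [N' gN]]; apply/asboolP.
  split=> [n|]; first by apply: rpredD.
  exists (maxn N N') => n; rewrite geq_max => /andP[/fN fn /gN gn].
  by rewrite !fctE fn gn addr0.
- move=> a f /asboolP[Gf [N fN]]; apply/asboolP; split=> [n|].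
    by apply: rpredZ.
  by exists N => n /fN fn; rewrite !fctE fn scaler0.
Qed.
HB.instance Definition _ G :=
  GRing.isSubSemiModClosed.Build F (nat -> A) (fsum_pred G) (fsum_closed G).

(* (+)_n F_n *)
Definition rees : lmodType F := submodule (fsum_pred Fl).

(* (+)_n F_(n-1) *)
Definition rees_ideal : {pred rees} :=
  fun f => subval f \in fsum_pred (prev Fl).

Lemma rees_ideal_closed : subsemimod_closed rees_ideal.
Proof.
split; first split.
- exact: (rpred0 (fsum_pred (prev Fl))).
- by move=> f g If Ig; apply: (rpredD (S := fsum_pred (prev Fl))).
- by move=> a f If; apply: (rpredZ (s := fsum_pred (prev Fl))).
Qed.
HB.instance Definition _ :=
  GRing.isSubSemiModClosed.Build F rees rees_ideal rees_ideal_closed.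

Definition conv (f g : nat -> A) (n : nat) : A :=
  \sum_(i < n.+1) f i * g (n - i)%N.

Lemma conv_rev f g n : conv f g n = \sum_(i < n.+1) f (n - i)%N * g i.
Proof.
rewrite /conv (reindex_inj rev_ord_inj) /=.
by apply: eq_bigr => i _; rewrite (sub_ordK i).
Qed.

Lemma conv_linl a f f' g n :
  conv (fun i => a *: f i + f' i) g n = a *: conv f g n + conv f' g n.
Proof.
rewrite /conv scaler_sumr -big_split; apply: eq_bigr => i _ /=.
by rewrite mulrDl alg_scaleAl.
Qed.
Lemma conv_linr a f g g' n :
  conv f (fun i => a *: g i + g' i) n = a *: conv f g n + conv f g' n.
Proof.
rewrite /conv scaler_sumr -big_split; apply: eq_bigr => i _ /=.
by rewrite mulrDr alg_scaleAr.
Qed.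

Lemma convA f g h : conv f (conv g h) =1 conv (conv f g) h.
Proof.
move=> n; rewrite [RHS]conv_rev.
pose t j k := f j * (g (n - j - k)%N * h k).
transitivity (\sum_(j < n.+1) \sum_(k < n.+1 | (k <= n - j)%N) t j k).
  apply: eq_bigr => /= j _; rewrite conv_rev big_distrr /=.
  by rewrite (big_ord_narrow_leq (leq_subr _ _)).
rewrite (exchange_big_dep predT) //=; apply: eq_bigr => k _.
transitivity (\sum_(j < n.+1 | (j <= n - k)%N) t j k).
  apply: eq_bigl => j; rewrite -ltnS -(ltnS j) -!subSn ?leq_ord //.
  by rewrite -subn_gt0 -(subn_gt0 j) -!subnDA addnC.
rewrite (big_ord_narrow_leq (leq_subr _ _)) /conv big_distrl /=.
by apply: eq_bigr => j _; rewrite /t -!subnDA addnC mulrA.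
Qed.

Lemma conv_subproof (f g : rees) : conv (subval f) (subval g) \in fsum_pred Fl.
Proof.
case: f g => f /= /asboolP[Gf [N fN]] [g /= /asboolP[Gg [N' gN]]].
apply/asboolP; split=> [n|].
  apply: rpred_sum => i _; have := filt_mul HF (Gf i) (Gg (n - i)%N).
  by rewrite subnKC // -ltnS.
exists (N + N')%N => n le_n; rewrite /conv big1 // => i _.
have [/fN->|lt_iN] := leqP N i; first by rewrite mul0r.
rewrite gN ?mulr0 // leq_subRL; last by rewrite -ltnS.
by apply: leq_trans le_n; rewrite leq_add2r ltnW.
Qed.
Definition rees_mul (f g : rees) : rees := Submodule (conv_subproof f g).

Definition delta0 (n : nat) : A := if n is 0%N then 1 else 0.
Lemma delta0_subproof : delta0 \in fsum_pred Fl.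
Proof.
apply/asboolP; split=> [[|n]|]; last by exists 1%N => -[].
  exact: filt_one HF.
exact: rpred0.
Qed.
Definition rees_one : rees := Submodule delta0_subproof.

Lemma rees_ext (f g : rees) : subval f =1 subval g -> f = g.
Proof. by move=> fg; apply/val_inj/funext. Qed.

Lemma rees_descends :
  descends (rees_ideal : submodClosed rees) rees_mul rees_one.
Proof.
have sP (f : rees) : fsum_cond Fl (subval f) by apply/asboolP; exact: subvalP f.
have in0 (f : rees) : f = 0 -> f \in rees_ideal.
  by move=> ->; apply: (rpred0 (rees_ideal : submodClosed rees)).
have fin (f g : rees) : exists N, forall n, (N <= n)%N -> subval (rees_mul f g) n = 0.
  by case: (sP (rees_mul f g)).
split.
- move=> g a f f'; apply: rees_ext => n; exact: conv_linl.
- move=> f a g g'; apply: rees_ext => n; exact: conv_linr.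
- move=> f g /asboolP[If _]; apply/asboolP; split; last exact: fin.
  move=> n; apply: rpred_sum => i _; have [Gg _] := sP g.
  have := If i; rewrite /prev; case: i => -[|i] /= lt_in.
    by rewrite unfold_in => /eqP->; rewrite mul0r rpred0.
  case: n lt_in => // n lt_in Ii; have := filt_mul HF Ii (Gg (n - i)%N).
  by rewrite subnKC // -ltnS.
- move=> f g /asboolP[Ig _]; apply/asboolP; split; last exact: fin.
  move=> n; apply: rpred_sum => i _; have [Gf _] := sP f.
  have le_in : (i <= n)%N by rewrite -ltnS.
  move: (nat_of_ord i) le_in => {}i le_in; have := Ig (n - i)%N.
  case E : (n - i)%N => [|k] /=.
    by rewrite unfold_in => /eqP->; rewrite mulr0 rpred0.
  move=> Ik; have := filt_mul HF (Gf i) Ik.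
  have -> : n = (i + k).+1 by rewrite -addnS -E subnKC.
  by [].
- move=> f g h; apply/in0/eqP; rewrite subr_eq0; apply/eqP/rees_ext => n /=.
  exact: convA.
- move=> f; apply/in0/eqP; rewrite subr_eq0; apply/eqP/rees_ext => n /=.
  by rewrite /conv big_ord_recl big1 ?addr0 ?mul1r ?subn0 // => i _; rewrite mul0r.
- move=> f; apply/in0/eqP; rewrite subr_eq0; apply/eqP/rees_ext => n /=.
  rewrite /conv big_ord_recr big1 /= ?subnn ?mulr1 ?add0r // => i _.
  by case E : (n - i)%N => [|k] /=; [move: (ltn_ord i); rewrite -subn_gt0 E|rewrite mulr0].
Qed.

Definition gr : algebra F := quotalg rees_descends.

End Graded.

Section Grading.
Variables (R : pzRingType) (X : lmodType R) (G : nat -> submodClosed X).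

(* X is the internal direct sum of the G n. *)
Record is_grading : Prop := IsGrading {
  grading_span : forall x, exists p : nat * (nat -> X),
    (forall i, p.2 i \in G i) /\ x = \sum_(i < p.1) p.2 i;
  grading_indep : forall N (c : nat -> X),
    (forall i, c i \in G i) -> \sum_(i < N) c i = 0 ->
    forall i, (i < N)%N -> c i = 0
}.

(* The sum over i of phi i (x_i), where x_i is the component of x in G i: the
   additive extension of a map defined on homogeneous elements. *)
Definition homext (HG : is_grading) (Y : nmodType) (phi : nat -> X -> Y)
    (x : X) : Y :=
  let p := sval (cid (grading_span HG x)) in \sum_(i < p.1) phi i (p.2 i).

End Grading.

(* The coefficient of x^(k-i) y^i in (x + y)^k, for an arbitrary integer k;
   binom (-n-1) i = (-1)^i binom (n+i) i. *)
Definition binz (k : int) (i : nat) : int :=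
  match k with
  | Posz n => 'C(n, i)%:Z
  | Negz n => (-1) ^+ i * 'C(n + i, i)%:Z
  end.

Section Jacobi.
Variables (F : fieldType) (V M : lmodType F).
Variables (YV : V -> int -> V -> V) (YM : V -> int -> M -> M).

(* The coefficient of x^(k-i) y^i in (x - y)^k. *)
Definition bincoef (k : int) (i : nat) : F := ((-1) ^+ i * binz k i)%:~R.

(* The coefficient of z0^(-l-1) z1^(-m-1) z2^(-n-1) in the Jacobi identity,
   applied to w. By truncation only finitely many terms of the three series
   over i are nonzero, so that the identity is one between partial sums with
   sufficiently many terms. *)
Definition jacobi : Prop :=
  forall (u v : V) (w : M) (l m n : int), exists N0 : nat, forall N : nat,
    (N0 <= N)%N ->
    \sum_(i < N) bincoef l i *: YM u (m + l - i%:Z) (YM v (n + i%:Z) w)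
    - \sum_(i < N) ((-1) ^ l * bincoef l i) *:
        YM v (n + l - i%:Z) (YM u (m + i%:Z) w)
    = \sum_(i < N) bincoef (i%:Z - m - 1) i *:
        YM (YV u (l + i%:Z) v) (m + n - i%:Z) w.

End Jacobi.

(* [vmode u n v] is u_n v, where Y(u, z) = sum_n u_n z^(-n-1). *)
Record vertex_algebra (F : fieldType) := VertexAlgebra {
  va_space :> lmodType F;
  vmode : va_space -> int -> va_space -> va_space;
  vac : va_space;
  vmode_linl : forall n v, linear (fun u => vmode u n v);
  vmode_linr : forall u n, linear (vmode u n);
  vmode_trunc : forall u v, exists N : int, forall n, N <= n -> vmode u n v = 0;
  vmode_vac : forall n v, vmode vac n v = if n == -1 then v else 0;
  vmode_creation0 : forall v n, 0 <= n -> vmode v n vac = 0;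
  vmode_creation1 : forall v, vmode v (-1) vac = v;
  vmode_jacobi : jacobi vmode vmode
}.

Record voa (F : fieldType) := VOA {
  voa_va :> vertex_algebra F;
  wt_space : nat -> submodClosed voa_va;
  wt_grading : is_grading wt_space;
  wt_findim : forall n, findim_sub (wt_space n);
  wt_vac : vac voa_va \in wt_space 0;
  wt_mode : forall (s t : nat) (n : int) (u v : voa_va),
    u \in wt_space s -> v \in wt_space t ->
    vmode u n v \in extz wt_space (s%:Z + t%:Z - n - 1);
  omega : voa_va;
  wt_omega : omega \in wt_space 2;
  central_charge : F;
  virasoro : let L (m : int) := vmode omega (m + 1) in
    forall (m n : int) (v : voa_va),
    L m (L n v) - L n (L m v) = (m - n)%:~R *: L (m + n) v
      + (if m + n == 0 then 2%:R^-1 * (binz (m + 1) 3)%:~R * central_charge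
         else 0) *: v;
  (* the coefficient of z^(-n-1) in d/dz Y(v, z) = Y(L(-1) v, z) *)
  L_derivative : forall (v : voa_va) (n : int) (w : voa_va),
    (- n)%:~R *: vmode v (n - 1) w = vmode (vmode omega 0 v) n w;
  L_weight : forall (n : nat) (v : voa_va),
    v \in wt_space n -> vmode omega 1 v = n%:R *: v
}.

Definition strongly_fin_gen (F : fieldType) (V : voa F) : Prop :=
  exists2 U : submodClosed V, findim_sub U &
    forall v : V, lspan (fun x => exists2 s : seq (V * nat),
      (forall p, p \in s -> p.1 \in U /\ (1 <= p.2)%N) &
      x = foldr (fun p y => vmode p.1 (- p.2%:Z) y) (vac V) s) v.

Record weak_module (F : fieldType) (V : vertex_algebra F) := WeakModule {
  wm_space :> lmodType F;
  wmode : V -> int -> wm_space -> wm_space;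
  wmode_linl : forall n w, linear (fun u => wmode u n w);
  wmode_linr : forall u n, linear (wmode u n);
  wmode_trunc : forall u w, exists N : int, forall n, N <= n -> wmode u n w = 0;
  wmode_vac : forall n w, wmode (vac V) n w = if n == -1 then w else 0;
  wmode_jacobi : jacobi (@vmode F V) wmode
}.

Record admissible_module (F : fieldType) (V : voa F) := AdmissibleModule {
  adm_weak :> weak_module V;
  deg_space : nat -> submodClosed adm_weak;
  deg_grading : is_grading deg_space;
  deg_mode : forall (s t : nat) (n : int) (u : V) (w : adm_weak),
    u \in wt_space V s -> w \in deg_space t ->
    wmode u n w \in extz deg_space (s%:Z + t%:Z - n - 1)
}.

Record admissible_submodule (F : fieldType) (V : voa F)
    (M : admissible_module V) (N : submodClosed M) : Prop :=
    AdmissibleSubmodule {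
  subm_mode : forall (u : V) (n : int) (w : M), w \in N -> wmode u n w \in N;
  subm_graded : forall w, w \in N -> exists p : nat * (nat -> M),
    (forall i, p.2 i \in deg_space M i /\ p.2 i \in N) /\
    w = \sum_(i < p.1) p.2 i
}.

Definition irreducible (F : fieldType) (V : voa F) (M : admissible_module V)
    : Prop :=
  (exists w : M, w != 0) /\
  forall N : submodClosed M, admissible_submodule N ->
    (forall w, w \in N -> w = 0) \/ forall w, w \in N.

Section EndV.
Variables (F : fieldType) (V : vertex_algebra F) (M : weak_module V).

Definition mode_op (p : V * int) : M -> M := wmode p.1 p.2.
HB.instance Definition _ p :=
  GRing.isLinear.Build F M M *:%R (mode_op p) (wmode_linr p.1 p.2).

Definition EndV : algebra F :=
  commutant_alg (fun p : V * int => mode_op p : {linear M -> M}).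
End EndV.

Section Zhu.
Variables (F : fieldType) (V : voa F).

(* Res_z Y(u, z) v (1 + z)^N z^q *)
Definition resY (u v : V) (N : nat) (q : int) : V :=
  \sum_(i < N.+1) 'C(N, i)%:R *: vmode u (i%:Z + q) v.

Definition zhuO_gen (x : V) : Prop :=
  (exists (p s t : nat) (u v : V), [/\ u \in wt_space V p, (s <= t)%N &
     x = resY u v (p + s) (- t.+2%:Z)]) \/
  (exists u : V, x = vmode (omega V) 0 u + vmode (omega V) 1 u).

Definition zhuO : submodClosed V := span_sub zhuO_gen.

(* u * v = Res_z Y(u, z) v (1 + z)^p / z for u of weight p. *)
Definition zhu_mul (u v : V) : V :=
  homext (wt_grading V) (fun p up => resY up v p (-1)) u.

Definition zhu_welldef : Prop := descends zhuO zhu_mul (vac V).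

Definition zhu_algebra (H : zhu_welldef) : algebra F := quotalg H.

Section Level.
Variable H : zhu_welldef.

Definition level (n : nat) : {pred zhu_algebra H} := fun a =>
  `[< exists (x : nat -> V) (y : V), [/\ forall i, x i \in wt_space V i,
        y \in zhuO & a = proj zhuO (\sum_(i < n.+1) x i + y)] >].

Lemma level_closed n : subsemimod_closed (level n).
Proof.
split; first split.
- apply/asboolP; exists (fun=> 0), 0; split=> [i||]; rewrite ?rpred0 //.
  by rewrite big1 // addr0 linear0.
- move=> a b /asboolP[x [y [Wx Oy ->]]] /asboolP[x' [y' [Wx' Oy' ->]]].
  apply/asboolP; exists (fun i => x i + x' i), (y + y').
  split=> [i||]; rewrite ?rpredD //.
  by rewrite big_split addrACA; exact: esym (projD zhuO _ _).
- move=> c a /asboolP[x [y [Wx Oy ->]]].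
  apply/asboolP; exists (fun i => c *: x i), (c *: y).
  split=> [i||]; rewrite ?rpredZ //.
  by rewrite -scaler_sumr -scalerDr; exact: esym (proj_scale zhuO _ _).
Qed.
HB.instance Definition _ n := GRing.isSubSemiModClosed.Build F
  (zhu_algebra H : lmodType F) (level n) (level_closed n).

Definition level_filtration (n : nat) : submodClosed (zhu_algebra H) := level n.
End Level.

Section Top.
Variable M : admissible_module V.

Definition top_space : lmodType F := submodule (deg_space M 0).

(* o(u): the mode u_(p-1) for u of weight p. *)
Definition zero_mode (u : V) (w : M) : M :=
  homext (wt_grading V) (fun p up => wmode up (p%:Z - 1) w) u.

Lemma zero_mode_top u w :
  w \in deg_space M 0 -> zero_mode u w \in deg_space M 0.
Proof.
move=> Mw; rewrite /zero_mode /homext; case: cid => -[N c] /= [Wc _].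
apply: rpred_sum => i _; have := deg_mode ((nat_of_ord i)%:Z - 1) (Wc i) Mw.
by rewrite addr0 subKr subrr.
Qed.

Definition top_act (u : V) (w : top_space) : top_space :=
  Submodule (zero_mode_top u (subvalP w)).

Definition top_welldef : Prop :=
  action_descends zhuO zhu_mul (vac V) top_act.

Definition top_module (H : zhu_welldef) (HM : top_welldef)
    : lmodType (zhu_algebra H) := quotmod H HM.
End Top.
End Zhu.

(* Main.v *)
Require Import Defs.
From HB Require Import structures.
From mathcomp Require Import all_boot all_order all_algebra.
From mathcomp Require Import boolp classical_sets functions.
From mathcomp Require Import mpoly zify ring.

(* (1) In an irreducible M graded with M(0) <> 0, M(0) is exactly the space of
   vectors killed by the modes lowering the degree, so V-endomorphisms restrict to
   it, and M is spanned by single modes applied to M(0). Given g commuting with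
   A(V) on M(0), the submodule of M x M generated by the graph of g meets 0 x M in
   a graded submodule without degree 0 part, hence is the graph of an extension.

   (2) Modulo lower levels u * v = u_(-1) v = v_(-1) u, and u_(-n) v drops in level
   when n >= 2; so the symbols of homogeneous strong generators generate gr A(V).
   In A(V) only the modes against (1 + z)^(wt u) z^(-2-t), t >= 0, are killed, and
   all identities in A(V) come from the Jacobi identity integrated against
   polynomials in z1 and z2; no division is needed.

   (3) Let D = End_A(S) and S = A s. Order the monomials x^a in lifts of generators
   of gr A by weight, then lexicographically. For a division subring E of D, call
   x^a nonstandard when x^a s is an E-combination of smaller x^b s. By Dickson's
   lemma finitely many relations, with coefficients d_1, ..., d_r in E, reduce
   every vector to standard form, so S has coefficients in F[d_1, ..., d_r]; as
   standard forms are unique over E, E = F[d_1, ..., d_r] is finitely generated as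
   an algebra. For E = F(theta) this forces theta to be algebraic. A maximal
   commuting subset K of D is then finite dimensional, and an argument in the style
   of Artin shows that D has dimension at most dim K over its centralizer K. *)

Set Implicit Arguments.
Unset Strict Implicit.
Unset Printing Implicit Defensive.

Import Order.TTheory GRing.Theory.

Local Open Scope ring_scope.

(** * Dickson's lemma and weighted monomial orders *)

(** Beyond every index N the values of f have a minimum, attained at some k > N; iterating the
    passage from N to k selects values that never decrease. *)
Lemma nondecreasing_subseq (f : nat -> nat) :
  exists2 phi : nat -> nat, {homo phi : i j / (i < j)%N} &
    {homo f \o phi : i j / (i <= j)%N}.
Proof.
have step (N : nat) : exists2 k, (N < k)%N & forall j, (N < j)%N -> (f k <= f j)%N.
  have ex : exists v, `[< exists2 k, (N < k)%N & f k = v >].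
    by exists (f N.+1); apply/asboolP; exists N.+1.
  case: (ex_minnP ex) => v /asboolP[k Nk fk] vmin.
  by exists k => // j Nj; rewrite fk; apply: vmin; apply/asboolP; exists j.
have {step} /choice[g gP] : forall N, exists k, (N < k)%N /\
    forall j, (N < j)%N -> (f k <= f j)%N.
  by move=> N; have [k] := step N; exists k.
pose phi := fix phi i := if i is j.+1 then g (phi j) else g 0%N.
have phiS i : (phi i < phi i.+1)%N by case: (gP (phi i)).
have phi_lt : {homo phi : i j / (i < j)%N} by apply: homo_ltn => //; apply: ltn_trans.
exists phi => // i j; rewrite leq_eqVlt => /orP[/eqP-> //|lt_ij] /=.
have lt_phi := phi_lt _ _ lt_ij.
case: i lt_ij lt_phi => [|i] lt_ij lt_phi /=.
  by case: (gP 0%N) => lt0 -> //; apply: leq_trans lt0 (ltnW lt_phi).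
by case: (gP (phi i)) => lti -> //; apply: ltn_trans lti lt_phi.
Qed.

(** Coordinates are treated one after the other; passing to a further subsequence keeps the
    monotonicity already gained. *)
Lemma mnm_nondecreasing_subseq n (f : nat -> 'X_{1..n}) :
  exists2 phi : nat -> nat, {homo phi : i j / (i < j)%N} &
    forall i j, (i <= j)%N -> (f (phi i) <= f (phi j))%MM.
Proof.
suff: forall s : seq 'I_n, exists2 phi : nat -> nat, {homo phi : i j / (i < j)%N} &
    forall k, k \in s -> {homo (fun i => f (phi i) k) : i j / (i <= j)%N}.
  case/(_ (enum 'I_n)) => phi phi_lt mono; exists phi => // i j le_ij.
  by apply/mnm_lepP => k; apply: mono => //; rewrite mem_enum.
elim=> [|k s [phi phi_lt mono]]; first by exists id.
have [psi psi_lt psi_mono] := nondecreasing_subseq (fun i => f (phi i) k).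
exists (phi \o psi) => [i j lt_ij|l]; first by apply/phi_lt/psi_lt.
rewrite inE => /orP[/eqP-> //|ls] i j le_ij /=; apply: mono => //.
by move: le_ij; rewrite leq_eqVlt => /orP[/eqP->//|/psi_lt/ltnW].
Qed.

(** If no finite list worked, elements of P could be picked one by one, none of them above an
    earlier one; a nondecreasing subsequence contradicts this. *)
Lemma dickson n (P : 'X_{1..n} -> Prop) :
  exists2 l : seq 'X_{1..n}, (forall b, b \in l -> P b) &
    forall a, P a -> exists2 b, b \in l & (b <= a)%MM.
Proof.
apply: contrapT => noP.
have step (l : seq 'X_{1..n}) : exists a, (forall b, b \in l -> P b) ->
    P a /\ forall b, b \in l -> ~~ (b <= a)%MM.
  (* For a list not contained in P the claim is vacuous and 0 is a dummy. *)
  have [lP|] := pselect (forall b, b \in l -> P b); last by exists 0%MM.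
  apply: contrapT => /forallNP noa; apply: noP; exists l => // a Pa.
  apply: contrapT => nob; apply: (noa a) => _; split=> // b bl.
  by apply/negP => le_ba; apply: nob; exists b.
have {step} [g gP] := choice step.
pose L := fix L i := if i is j.+1 then g (L j) :: L j else [::].
have LP i b : b \in L i -> P b.
  by elim: i b => [|i IH] b //=; rewrite inE => /orP[/eqP->|/IH//]; case: (gP (L i)).
have [phi phi_lt mono] := mnm_nondecreasing_subseq (g \o L).
have inL i j : (i < j)%N -> g (L i) \in L j.
  elim: j => // j IH; rewrite ltnS leq_eqVlt /= inE => /orP[/eqP->|/IH->].
    by rewrite eqxx.
  by rewrite orbT.
have [_ /(_ _ (inL _ _ (phi_lt 0%N 1%N isT)))/negP] := gP _ (LP (phi 1%N)).
by apply; apply: mono.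
Qed.

Section WeightOrder.
Variables (n : nat) (wt : 'X_{1..n} -> nat).
Hypothesis wtD : forall a b, wt (a + b)%MM = (wt a + wt b)%N.

Definition mlt (a b : 'X_{1..n}) : bool :=
  (wt a < wt b)%N || (wt a == wt b) && (a < b)%O.

Lemma mlt_trans : transitive mlt.
Proof.
move=> b a c /orP[ab|/andP[/eqP ab ab']] /orP[bc|/andP[/eqP bc bc']]; apply/orP.
- by left; apply: ltn_trans bc.
- by left; rewrite -bc.
- by left; rewrite ab.
- by right; rewrite ab bc eqxx (lt_trans ab').
Qed.

Lemma mlt_total a b : a != b -> mlt a b || mlt b a.
Proof. by move=> ab; rewrite /mlt; case: ltngtP => //= _; rewrite -neq_lt. Qed.

Lemma mlt_addl a b c : mlt b c -> mlt (a + b)%MM (a + c)%MM.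
Proof.
rewrite /mlt !wtD ltn_add2l eqn_add2l => /orP[->//|/andP[-> bc]].
by rewrite (lemc_lt_add (lexx a) bc) orbT.
Qed.

Lemma mlt0 a : mlt a 0%MM = false.
Proof.
have wt0 : wt 0%MM = 0%N.
  by have /eqP := wtD 0%MM 0%MM; rewrite addm0 -{1}[wt _]addn0 eqn_add2l => /eqP.
rewrite /mlt wt0 ltn0 /=; apply/negbTE; rewrite negb_and -leNgt le0m orbT.
by [].
Qed.

(** Generators of weight 0 are allowed, so infinitely many monomials may share a weight: the
    induction on the weight contains one on the well-founded order that breaks ties. *)
Lemma mlt_ind (P : 'X_{1..n} -> Prop) :
  (forall a, (forall b, mlt b a -> P b) -> P a) -> forall a, P a.
Proof.
move=> IH a; have [k] := ubnP (wt a); elim: k => // k IHk in a *.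
elim/(@ltmwf n): a => a IHa lt_a; apply: IH => b /orP[lt_ba|/andP[/eqP eq_ba ltba]].
  by apply: IHk; apply: leq_trans lt_ba _; rewrite -ltnS.
by apply: IHa; rewrite ?eq_ba.
Qed.

Lemma mlt_max (l : seq 'X_{1..n}) : l != [::] ->
  exists2 a, a \in l & forall b, b \in l -> b != a -> mlt b a.
Proof.
elim: l => // a [|c l] IH _; first by exists a; rewrite ?mem_head // => b; rewrite inE => ->.
have [//|b bl bmax] := IH.
have [eq_ab|ne_ab] := eqVneq a b.
  exists b; first by rewrite inE bl orbT.
  by move=> d; rewrite inE eq_ab => /orP[->//|]; apply: bmax.
have /orP[lt_ab|lt_ba] := mlt_total ne_ab.
  exists b; first by rewrite inE bl orbT.
  by move=> d; rewrite inE => /orP[/eqP->//|]; apply: bmax.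
exists a; first by rewrite mem_head.
move=> d; rewrite inE => /orP[/eqP->|dl _]; first by rewrite eqxx.
by have [->//|/(bmax _ dl)] := eqVneq d b; move/mlt_trans; apply.
Qed.

End WeightOrder.

Definition fin_gen_over (F : fieldType) (D : algebra F) (E : submodClosed D) : Prop :=
  exists2 t : seq D, {subset t <= E} &
    forall B : submodClosed D, mulr_closed B -> {subset t <= B} -> {subset E <= B}.

Definition division_closed (F : fieldType) (D : algebra F) (E : submodClosed D) : Prop :=
  forall x, x \in E -> x != 0 -> exists2 y, y \in E & y * x = 1.

Section Span.
Variables (F : fieldType) (D : algebra F) (X : lmodType D) (I : eqType) (e : I -> X).

Definition combo (s : seq (D * I)) : X := \sum_(p <- s) p.1 *: e p.2.

(** B is a bare predicate, so that coefficients can be confined to a finite list as well as to a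
    subalgebra. *)
Definition coef_span (B : {pred D}) (P : I -> Prop) (x : X) : Prop :=
  exists2 s : seq (D * I), (forall p, p \in s -> p.1 \in B /\ P p.2) & x = combo s.

Section Closed.
Variables (B : submodClosed D) (BM : mulr_closed B) (P : I -> Prop).

Lemma coef_span_gen i : P i -> coef_span B P (e i).
Proof.
move=> Pi; exists [:: (1, i)]; last by rewrite /combo big_seq1 scale1r.
by move=> p; rewrite inE => /eqP->; split=> //; case: BM.
Qed.

Lemma coef_span0 : coef_span B P 0.
Proof. by exists [::]; rewrite /combo ?big_nil. Qed.

Lemma coef_spanD x y : coef_span B P x -> coef_span B P y -> coef_span B P (x + y).
Proof.
move=> [s Ps ->] [t Pt ->]; exists (s ++ t); last by rewrite /combo big_cat.
by move=> p; rewrite mem_cat => /orP[/Ps|/Pt].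
Qed.

Lemma coef_spanZ d x : d \in B -> coef_span B P x -> coef_span B P (d *: x).
Proof.
move=> Bd [s Ps ->]; exists [seq (d * p.1, p.2) | p <- s].
  move=> _ /mapP[p /Ps[Bp Pp] ->]; split=> //.
  by case: BM => _; apply.
by rewrite /combo big_map scaler_sumr; apply: eq_bigr => p _; rewrite scalerA.
Qed.

Lemma coef_span_sum (J : eqType) (s : seq J) (x : J -> X) :
  (forall j, j \in s -> coef_span B P (x j)) -> coef_span B P (\sum_(j <- s) x j).
Proof.
elim: s => [|j s IH] Ps; first by rewrite big_nil; exact: coef_span0.
rewrite big_cons; apply: coef_spanD; first by apply: Ps; rewrite mem_head.
by apply: IH => k ks; apply: Ps; rewrite inE ks orbT.
Qed.
End Closed.

Lemma coef_span_sub (B B' : {pred D}) (P Q : I -> Prop) x :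
  {subset B <= B'} -> (forall i, P i -> Q i) -> coef_span B P x -> coef_span B' Q x.
Proof. by move=> BB PQ [s Ps ->]; exists s => // p /Ps[/BB ? /PQ ?]. Qed.

Lemma coef_span_trans (B : submodClosed D) (BM : mulr_closed B) (P Q : I -> Prop) x :
  (forall i, P i -> coef_span B Q (e i)) -> coef_span B P x -> coef_span B Q x.
Proof.
move=> PQ [s Ps ->]; apply: coef_span_sum => p /Ps[Bp Pp].
by apply: coef_spanZ => //; apply: PQ.
Qed.

Lemma combo_collect (s : seq (D * I)) :
  combo s = \sum_(i <- undup (map snd s)) (\sum_(p <- s | p.2 == i) p.1) *: e i.
Proof.
under eq_bigr do rewrite scaler_suml big_mkcond.
rewrite exchange_big /=; apply: eq_big_seq => p ps.
rewrite (bigD1_seq p.2) ?undup_uniq ?mem_undup ?map_f //= eqxx big1 ?addr0 //.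
by move=> i; rewrite eq_sym => /negbTE->.
Qed.

End Span.

(** * Standard monomials over a division subring *)

Section StandardMonomials.
Variables (F : fieldType) (D : algebra F) (X : lmodType D).
Variables (n : nat) (wt : 'X_{1..n} -> nat).
Hypothesis wtD : forall a b, wt (a + b)%MM = (wt a + wt b)%N.
Local Notation "a <' b" := (mlt wt a b) (at level 70).
Variables (e : 'X_{1..n} -> X) (T : 'X_{1..n} -> {linear X -> X}).
Variable E : submodClosed D.
Hypotheses (EM : mulr_closed E) (EV : division_closed E).
(** [T a] stands for the action of x^a and [e b] for x^b s. Monomials multiply up to smaller ones,
    and the correction has coefficients in every subalgebra of D, since in the application they are
    scalars from F. *)
Hypothesis T_e : forall a b (B : submodClosed D), mulr_closed B ->
  coef_span e B (fun c => c <' (a + b)%MM) (T a (e b) - e (a + b)%MM).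
Hypothesis e_span : forall x (B : submodClosed D), mulr_closed B ->
  coef_span e B (fun=> True) x.
Hypothesis e0 : e 0%MM != 0.

Let nonstd a := coef_span e E (fun b => b <' a) (e a).

(** In a nontrivial relation, dividing by the coefficient of the largest monomial would exhibit that
    monomial as nonstandard. *)
Lemma standard_indep (l : seq 'X_{1..n}) (c : 'X_{1..n} -> D) :
  uniq l -> (forall a, a \in l -> ~ nonstd a) -> (forall a, a \in l -> c a \in E) ->
  \sum_(a <- l) c a *: e a = 0 -> forall a, a \in l -> c a = 0.
Proof.
move=> ul std cE eq0 a0 a0l; apply/eqP/negPn/negP => ca0.
pose l' := [seq a <- l | c a != 0].
have l'0 : l' != [::].
  by apply/eqP => l'0; have : a0 \in l'; [rewrite mem_filter ca0|rewrite l'0].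
have [a al' amax] := mlt_max wt l'0.
have := al'; rewrite mem_filter => /andP[ca al].
have [y yE yc] := EV (cE _ al) ca.
apply: (std a al); rewrite /nonstd.
have -> : e a = \sum_(b <- rem a l') - (y * c b) *: e b.
  have : \sum_(b <- l') c b *: e b = 0.
    rewrite big_filter -[RHS]eq0 [RHS](bigID (fun b => c b != 0)) /=.
    rewrite [X in _ + X]big1 ?addr0 // => b /negPn/eqP->.
    by rewrite scale0r.
  move/(congr1 ( *:%R y)); rewrite scaler0 scaler_sumr (big_rem a) //=.
  rewrite scalerA yc scale1r => /eqP; rewrite addr_eq0 => /eqP->.
  by rewrite -sumrN; apply: eq_bigr => b _; rewrite scalerA scaleNr.
apply: (coef_span_sum (B := E)) => b bl'.
have ul' : uniq l' by rewrite filter_uniq.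
move: bl'; rewrite mem_rem_uniq // => /andP[ba bl']; rewrite scaleNr -scalerN.
apply: coef_spanZ => //.
  by case: EM => _; apply=> //; apply: cE; move: bl'; rewrite mem_filter => /andP[].
rewrite -scaleN1r; apply: coef_spanZ => //.
  by rewrite rpredN_submod //; case: EM.
by apply: coef_span_gen => //; apply: amax.
Qed.

(** A nonstandard a is g + b with b in l. Applying the D-linear [T g] to the relation for b
    expresses [e a] by smaller monomials without leaving B, and induction on the order applies to
    these. *)
Lemma standard_reduction (B : submodClosed D) (BM : mulr_closed B)
    (l : seq 'X_{1..n}) :
  (forall a, nonstd a -> exists2 b, b \in l & (b <= a)%MM) ->
  (forall b, b \in l -> coef_span e B (fun c => c <' b) (e b)) ->
  forall a, coef_span e B (fun b => ~ nonstd b) (e a).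
Proof.
move=> ldom lB; apply: (@mlt_ind n wt) => a IH.
have [/ldom[b bl le_ba]|] := pselect (nonstd a); last first.
  by move=> std; apply: (coef_span_gen e BM (P := fun b => ~ nonstd b)).
pose g := (a - b)%MM; have ga : (g + b)%MM = a by rewrite submK.
apply: (coef_span_trans BM (P := fun c => c <' a)); first exact: IH.
have [s sP eb] := lB b bl.
rewrite -[e a](subrK (T g (e b))) -opprB -scaleN1r.
have := T_e g b BM; rewrite ga => Tgb.
apply: coef_spanD.
  by apply: coef_spanZ => //; rewrite rpredN_submod //; case: BM.
rewrite eb /combo linear_sum; apply: coef_span_sum => p /sP[Bp lt_pb].
rewrite linearZ; apply: coef_spanZ => //.
have lt_gp : (g + p.2)%MM <' a by rewrite -ga mlt_addl.
rewrite -[T g _](subrK (e (g + p.2)%MM)); apply: coef_spanD; last first.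
  exact: (coef_span_gen e BM).
apply: coef_span_sub (T_e g p.2 BM) => // c lt_c.
by apply: mlt_trans lt_c lt_gp.
Qed.

(* Reducing modulo a finite basis of relations writes every vector with
   coefficients in the algebra generated by the coefficients of that basis;
   uniqueness of standard forms over E then puts all of E in that algebra. *)
Lemma division_fin_gen : fin_gen_over E.
Proof.
have [l lstd ldom] := dickson nonstd.
have {lstd} [t tE tl] : exists2 t : seq D, {subset t <= E} &
    forall b, b \in l -> coef_span e [pred x | x \in t] (fun c => c <' b) (e b).
  elim: l lstd {ldom} => [|b l IH] lstd; first by exists [::].
  have [|t tE tl] := IH; first by move=> c cl; apply: lstd; rewrite inE cl orbT.
  have [s sP eb] := lstd b (mem_head _ _).
  exists (map fst s ++ t).
    move=> x; rewrite mem_cat => /orP[/mapP[p /sP[Ep _] ->] //|]; exact: tE.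
  move=> c; rewrite inE => /orP[/eqP->|/tl].
    exists s => // p ps; split; last by case: (sP p ps).
    by rewrite inE mem_cat map_f.
  apply: coef_span_sub => // x; rewrite !inE => xt.
  by rewrite mem_cat xt orbT.
exists t => // B BM tB d dE.
have Bred := standard_reduction BM ldom.
(* C is the intersection of B and E, written as a span to make it a [submodClosed]. *)
pose C := span_sub (fun x => x \in B /\ x \in E).
have CB x : x \in C <-> x \in B /\ x \in E.
  split=> [/asboolP[s [sP ->]]|xBE].
    by split; rewrite big_seq rpred_sum // => p /sP[]; move=> *; rewrite rpredZ.
  apply/asboolP; exists [:: (1, x)]; rewrite big_seq1 scale1r; split=> //.
  by move=> p; rewrite inE => /eqP->.
have CM : mulr_closed C.
  case: BM EM => B1 BM [E1 EM']; split; first exact/CB.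
  by move=> x y /CB[Bx Ex] /CB[By Ey]; apply/CB; split; [apply: BM|apply: EM'].
have {}Bred a : coef_span e C (fun b => ~ nonstd b) (e a).
  apply: (standard_reduction CM ldom) => b /tl; apply: coef_span_sub => // x xt.
  by apply/CB; split; [apply: tB|apply: tE].
have [s sP ds] : coef_span e C (fun b => ~ nonstd b) (d *: e 0%MM).
  by apply: (coef_span_trans CM (P := fun=> True)) => //; apply: e_span.
(* No monomial precedes 0, so a nonstandard 0 would force [e 0 = 0]. *)
have std0 : ~ nonstd 0%MM.
  case=> -[|p u] uP; first by rewrite /combo big_nil => /eqP; rewrite (negPf e0).
  by have [_] := uP p (mem_head _ _); rewrite (mlt0 wtD).
(* The coefficient d at the monomial 0 and the list s are two standard forms of the same vector.
   Their difference c vanishes at 0, so d is a sum of coefficients from C. *)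
pose l0 := undup (0%MM :: map snd s).
pose c a := (if a == 0%MM then d else 0) - \sum_(p <- s | p.2 == a) p.1.
have cs0 : c 0%MM = 0.
  apply: (@standard_indep l0 c); rewrite ?undup_uniq ?mem_undup ?mem_head //.
  - move=> a; rewrite mem_undup inE => /orP[/eqP-> //|/mapP[p ps ->]].
    by case: (sP p ps).
  - move=> a _; apply: rpredD.
      by case: ifP => _ //; rewrite rpred0.
    apply: rpredN_submod; rewrite big_seq_cond; apply: rpred_sum => p /andP[ps _].
    by case: (sP p ps) => /CB[].
  - under eq_bigr do rewrite scalerBl.
    rewrite sumrB (bigD1_seq 0%MM) ?mem_undup ?mem_head ?undup_uniq //= eqxx.
    rewrite [X in _ + X - _]big1 ?addr0 => [|a /negbTE->]; last by rewrite scale0r.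
    rewrite ds combo_collect; apply/eqP; rewrite subr_eq0; apply/eqP.
    rewrite /l0 /=; case: ifP => // ns.
    rewrite big_cons [X in X *: _]big1_seq ?scale0r ?add0r // => p /andP[/eqP p0 ps].
    by move: ns; rewrite -p0 map_f.
move/eqP: cs0; rewrite /c eqxx subr_eq0 => /eqP->.
rewrite big_seq_cond; apply: rpred_sum => p /andP[ps _].
by case: (sP p ps) => /CB[].
Qed.

End StandardMonomials.

(** * Division algebras *)

Lemma span_subP (R : pzRingType) (X : lmodType R) (P : X -> Prop) x :
  lspan P x <-> x \in span_sub P.
Proof. by split=> /asboolP. Qed.

Lemma span_sub_gen (R : pzRingType) (X : lmodType R) (P : X -> Prop) x :
  P x -> x \in span_sub P.
Proof.
move=> Px; apply/asboolP; exists [:: (1, x)]; split; last by rewrite big_seq1 scale1r.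
by move=> p; rewrite inE => /eqP->.
Qed.

Lemma span_sub_min (R : pzRingType) (X : lmodType R) (P : X -> Prop)
    (W : submodClosed X) :
  (forall x, P x -> x \in W) -> {subset span_sub P <= W}.
Proof.
move=> PW _ /asboolP[s [sP ->]]; rewrite big_seq.
by apply: rpred_sum => p /sP/PW Wp; rewrite rpredZ.
Qed.

Lemma count_lt (I : eqType) (a b : pred I) (s : seq I) :
  subpred a b -> (exists2 i, i \in s & b i && ~~ a i) -> (count a s < count b s)%N.
Proof.
move=> ab; elim: s => [|i s IH] [j] //=; rewrite inE => /orP[/eqP<-|js] /andP[bj aj].
  by rewrite bj (negbTE aj) add0n add1n ltnS sub_count.
rewrite -addnS leq_add ?IH //; last by exists j; rewrite ?bj.
by case: (a i) (ab i) => // ->.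
Qed.

Section DivisionAlgebra.
Variables (F : fieldType) (D : algebra F).
Hypothesis D1 : (1 : D) != 0.
Hypothesis DV : forall x : D, x != 0 -> exists y, y * x = 1.

(** A left inverse y of x has a left inverse z in turn, and z = z y x = x. *)
Lemma division_inv (x : D) : x != 0 -> exists2 y, y * x = 1 & x * y = 1.
Proof.
move=> x0; have [y yx] := DV x0; exists y => //.
have y0 : y != 0 by apply: contraNneq D1 => y0; rewrite -yx y0 mul0r.
have [z zy] := DV y0.
by rewrite -[x in LHS]mul1r -zy -!mulrA [y * _]mulrA yx mul1r.
Qed.

Lemma division_mulf_neq0 (x y : D) : x != 0 -> y != 0 -> x * y != 0.
Proof.
move=> /division_inv[z zx _] y0; apply: contraNneq y0 => xy0.
by rewrite -[y]mul1r -zx -mulrA xy0 mulr0.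
Qed.

Lemma division_mulIf (x y z : D) : z != 0 -> x * z = y * z -> x = y.
Proof.
by move=> /division_inv[t _ zt] xz; rewrite -[x]mulr1 -[y]mulr1 -zt !mulrA xz.
Qed.

(** Gaussian elimination with the unknowns on the right: a pivot [v j0 n] removes the unknown [c j0]
    together with the last equation. *)
Lemma linear_dependence n (I : eqType) (J : seq I) (v : I -> nat -> D) :
  uniq J -> (n < size J)%N ->
  exists2 c : I -> D, (exists2 j, j \in J & c j != 0) &
    forall i, (i < n)%N -> \sum_(j <- J) v j i * c j = 0.
Proof.
elim: n J v => [|n IH] J v uJ ltJ.
  case: J uJ ltJ => // j J _ _; exists (fun=> 1) => //.
  by exists j; rewrite ?mem_head.
have [v0|] := pselect (forall j, j \in J -> v j n = 0).
  have [c c0 cv] := IH J v uJ (ltnW ltJ); exists c => // i.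
  rewrite ltnS leq_eqVlt => /orP[/eqP->|/cv//].
  by rewrite big1_seq // => j /andP[_ /v0->]; rewrite mul0r.
move/existsNP=> [j0 /not_implyP[j0J /eqP v0]].
have [y _ vy] := division_inv v0.
pose v' j i := v j i - v j0 i * y * v j n.
have [||c [j1 j1J c1] cv] := IH (rem j0 J) v'; first exact: rem_uniq.
  by rewrite size_rem // -ltnS prednK //; apply: leq_trans ltJ.
have ne j : j \in rem j0 J -> (j == j0) = false.
  by rewrite mem_rem_uniq // inE => /andP[/negbTE].
pose s := \sum_(j <- rem j0 J) v j n * c j.
exists (fun j => if j == j0 then - (y * s) else c j).
  by exists j1; rewrite ?ne // (mem_rem j1J).
move=> i lt_in; rewrite (big_rem j0) //= eqxx.
rewrite (eq_big_seq (fun j => v j i * c j)) => [|j /ne->//].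
rewrite mulrN mulrA; move: lt_in; rewrite ltnS leq_eqVlt => /orP[/eqP->|/cv {}cv].
  by rewrite vy mul1r addNr.
by rewrite -[RHS]cv addrC /s mulr_sumr -sumrB; apply: eq_bigr => j _; rewrite mulrBl !mulrA.
Qed.

Section Centralizer.
Variables (K : submodClosed D) (k : seq D).
(** K is its own centralizer; hence it is commutative and closed under inverses. *)
Hypothesis Kcomm : forall x, x \in K <-> forall y, y \in K -> x * y = y * x.
Hypothesis Kspan : forall x, x \in K <-> lspan (fun y => y \in k) x.

Let K1 : 1 \in K.
Proof. by apply/Kcomm => y _; rewrite mulr1 mul1r. Qed.

Let KM x y : x \in K -> y \in K -> x * y \in K.
Proof.
move=> Kx Ky; apply/Kcomm => z Kz; rewrite -mulrA [y * z](proj1 (Kcomm y) _) //.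
by rewrite mulrA [x * z](proj1 (Kcomm x) _) // mulrA.
Qed.

Let KV x y : x \in K -> x * y = 1 -> y * x = 1 -> y \in K.
Proof.
move=> Kx xy yx; apply/Kcomm => z Kz.
by rewrite -[z in LHS]mulr1 -xy [z * _]mulrA -[z * x](proj1 (Kcomm x) _) // !mulrA yx mul1r.
Qed.

(* Among the relations [sum_j x_j a c_j = 0], valid for all a in K, one of
   minimal support normalized by [c_j1 = 1] has all c_j commuting with K:
   [b c_j - c_j b] is a relation of smaller support. *)
Lemma right_dependent (I : eqType) (J : seq I) (x : I -> D) :
  uniq J -> (size k < size J)%N ->
  exists2 c : I -> D, (forall j, c j \in K) &
    (exists2 j, j \in J & c j != 0) /\ \sum_(j <- J) x j * c j = 0.
Proof.
move=> uJ ltJ.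
pose rel (c : I -> D) := forall a, a \in K -> \sum_(j <- J) x j * a * c j = 0.
pose nz (c : I -> D) := exists2 j, j \in J & c j != 0.
have ex : exists m, `[< exists2 c, rel c /\ nz c & count (fun j => c j != 0) J = m >].
  (* Since k spans K over F, a relation valid for all a in K amounts to [size k] equations, fewer
     than the unknowns. *)
  have [c c0 ck] := linear_dependence (fun j i => x j * k`_i) uJ ltJ.
  exists (count (fun j => c j != 0) J); apply/asboolP; exists c => //; split=> //.
  move=> a /Kspan[s [sk ->]].
  under eq_bigr do rewrite mulr_sumr mulr_suml.
  rewrite exchange_big big1_seq //= => p /sk pk.
  under eq_bigr do rewrite -alg_scaleAr -alg_scaleAl.
  by rewrite -scaler_sumr -(nth_index 0 pk) ck ?index_mem // scaler0.
case: (ex_minnP ex) => m /asboolP[c [crel [j1 j1J c1]] cm] mmin.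
have [y yc cy] := division_inv c1.
pose d j := c j * y.
have y0 : y != 0 by apply: contraNneq D1 => y0; rewrite -yc y0 mul0r.
have d0 j : (d j != 0) = (c j != 0).
  apply/idP/idP => [|cj]; last exact: division_mulf_neq0.
  by apply: contraNneq => cj; rewrite /d cj mul0r.
have drel : rel d.
  by move=> a Ka; under eq_bigr do rewrite mulrA; rewrite -mulr_suml crel ?mul0r.
have dcomm j : j \in J -> d j \in K.
  move=> jJ; apply/Kcomm => b Kb; apply/eqP; rewrite eq_sym -subr_eq0.
  apply/negPn/negP => nzj.
  pose d' j := b * d j - d j * b.
  have : (m <= count (fun j => d' j != 0%R) J)%N.
    apply: mmin; apply/asboolP; exists d' => //; split; last by exists j.
    move=> a Ka.
    rewrite (eq_bigr (fun i => x i * (a * b) * d i - x i * a * d i * b)) => [|i _].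
      by rewrite sumrB -[X in _ - X]mulr_suml !drel ?mul0r ?subr0 //; apply: KM.
    by rewrite mulrBr !mulrA.
  apply/negP; rewrite -ltnNge -cm -(eq_count d0); apply: count_lt.
    by move=> i; apply: contraNneq => di0; rewrite /d' di0 mulr0 mul0r subrr.
  exists j1 => //; rewrite d0 c1 /= negbK /d' /d.
  by rewrite cy mulr1 mul1r subrr.
exists (fun j => if j \in J then d j else 0).
  by move=> j; case: ifP => [/dcomm//|_]; apply: rpred0.
split; first by exists j1; rewrite ?j1J ?d0.
rewrite -[RHS](drel 1 K1); apply: eq_big_seq => j jJ.
by rewrite jJ mulr1.
Qed.

(** As a right K-space D has dimension at most [size k]. Putting any d in front of a maximal
    independent family x gives a relation in which d has an invertible coefficient, so the products
    of the [x j] with the elements of k span D over F. *)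
Lemma findim_of_centralizer : findim D.
Proof.
pose indep r := `[< exists x : nat -> D, forall c : nat -> D,
  (forall j, c j \in K) -> \sum_(j < r) x j * c j = 0 ->
  forall j, (j < r)%N -> c j = 0 >].
have ex0 : exists r, indep r by exists 0%N; apply/asboolP; exists (fun=> 0).
have bound r : indep r -> (r <= size k)%N.
  move=> /asboolP[x xP]; rewrite leqNgt; apply/negP => lt_r.
  have [|c cK [[j jr c0] eq0]] := right_dependent (J := iota 0 r) x (iota_uniq 0 r).
    by rewrite size_iota.
  move: jr; rewrite mem_iota add0n => /andP[_ jr].
  case/eqP: c0; apply: (xP c) => //.
  by rewrite -[RHS]eq0 -(big_mkord predT (fun j => x j * c j)) /index_iota subn0.
case: (ex_maxnP ex0 bound) => r /asboolP[x xP] rmax.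
exists [seq x j * a | j <- iota 0 r, a <- k] => d.
have : ~ indep r.+1 by move/rmax; rewrite ltnn.
move/negP/asboolPn/forallNP => /(_ (fun j => if j is i.+1 then x i else d)).
move/existsNP=> [c /not_implyP[cK /not_implyP[eq0 /existsNP[j /not_implyP[jr cj]]]]].
rewrite big_ord_recl /= in eq0.
have c0 : c 0%N != 0.
  apply/eqP => c0; rewrite c0 mulr0 add0r in eq0.
  have {}eq0 := xP (fun j => c j.+1) (fun j => cK _) eq0.
  by case: j jr cj => // j jr; case; apply: eq0.
have [y yc cy] := division_inv c0.
have Ky : y \in K by apply: KV cy yc.
have -> : d = \sum_(j < r) x j * (- c j.+1 * y).
  move/eqP: eq0; rewrite addr_eq0 => /eqP eq0.
  rewrite -[d]mulr1 -cy mulrA eq0 -sumrN mulr_suml; apply: eq_bigr => i _.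
  by rewrite mulrA mulrN.
apply/span_subP; apply: rpred_sum => i _.
have : - c i.+1 * y \in K by apply: KM => //; apply: rpredN_submod.
move=> /Kspan[s [sk ->]]; rewrite mulr_sumr big_seq; apply: rpred_sum => p /sk pk.
rewrite -alg_scaleAr; apply: rpredZ; apply: span_sub_gen.
by apply: allpairs_f => //; rewrite mem_iota add0n ltn_ord.
Qed.

End Centralizer.
End DivisionAlgebra.

Section NonzeroAlgebra.
Variables (F : fieldType) (D : algebra F) (D1 : (1 : D) != 0).
(** D with the proof of 1 != 0 attached, so that polynomials can be evaluated in it by
    [horner_alg]. *)
Definition nzalg : Type := let _ := D1 in D.
HB.instance Definition _ := GRing.PzRing.on nzalg.
HB.instance Definition _ := GRing.Lmodule.on nzalg.
HB.instance Definition _ := GRing.PzSemiRing_isNonZero.Build nzalg D1.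
HB.instance Definition _ := GRing.Lmodule_isLalgebra.Build F nzalg (@alg_scaleAl F D).
HB.instance Definition _ := GRing.Lalgebra_isAlgebra.Build F nzalg (@alg_scaleAr F D).
End NonzeroAlgebra.

(** * Algebraicity and finite dimension from finite generation of division subalgebras *)

Section Algebraic.
Variables (F : fieldType) (D : algebra F).
Hypothesis D1 : (1 : D) != 0.
Hypothesis DV : forall x : D, x != 0 -> exists y, y * x = 1.
Hypothesis FG : forall E : submodClosed D,
  mulr_closed E -> division_closed E -> fin_gen_over E.

Section Evaluation.
Variable x : D.
Let ev (p : {poly F}) : D := horner_alg (x : nzalg D1) p.

Lemma horner_alg_sum p : ev p = \sum_(i < size p) p`_i *: x ^+ i.
Proof.
rewrite /ev /horner_alg /horner_morph horner_coef size_map_poly.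
by apply: eq_bigr => i _; rewrite coef_map /= -[LHS](alg_scaleAl (A := D)) mul1r.
Qed.

Let evM p q : ev (p * q) = ev p * ev q.
Proof. exact: (rmorphM (horner_alg (x : nzalg D1)) p q). Qed.
Let evD p q : ev (p + q) = ev p + ev q.
Proof. exact: (rmorphD (horner_alg (x : nzalg D1)) p q). Qed.
Let evZ c p : ev (c *: p) = c *: ev p.
Proof. by rewrite -mul_polyC evM {1}/ev horner_algC -[LHS](alg_scaleAl (A := D)) mul1r. Qed.
Let ev1 : ev 1 = 1. Proof. exact: (rmorph1 (horner_alg (x : nzalg D1))). Qed.
Let ev0 : ev 0 = 0. Proof. exact: (rmorph0 (horner_alg (x : nzalg D1))). Qed.
Let evC p q : ev p * ev q = ev q * ev p. Proof. by rewrite -!evM mulrC. Qed.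

(* If x is transcendental, the finitely many generators of F(x) have a common
   denominator h(x), and (1 + x h(x))^-1 is not a polynomial in x over a power of h(x). *)
Lemma division_algebraic : algebraic_elt x.
Proof.
apply: contrapT => trx.
have ev_eq0 p : ev p = 0 -> p = 0.
  by move=> evp; apply/eqP/negPn/negP => p0; apply: trx; exists p; rewrite -?horner_alg_sum.
have ev_inj p q : ev p = ev q -> p = q.
  move=> evpq; apply/eqP; rewrite -subr_eq0; apply/eqP/ev_eq0.
  by rewrite evD -scaleN1r evZ scaleN1r evpq subrr.
have ev_neq0 p : p != 0 -> ev p != 0 by apply: contraNneq => /ev_eq0->.
(* The fractions in x whose denominator lies in S: for multiplicative S they form a subalgebra,
   because polynomials in x commute. *)
pose frac (S : {poly F} -> Prop) : D -> Prop := fun y =>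
  exists2 q, S q & exists p, y * ev q = ev p.
have fracP (S : {poly F} -> Prop) : S 1 -> (forall p q, S p -> S q -> S (p * q)) ->
    exists2 W : submodClosed D, mulr_closed W & forall y, y \in W <-> frac S y.
  move=> S1 SM.
  have frac0 c : frac S (ev c) by exists 1 => //; exists c; rewrite ev1 mulr1.
  have fracM y z : frac S y -> frac S z -> frac S (y * z).
    move=> [q Sq [p yq]] [q' Sq' [p' yq']].
    exists (q' * q); first exact: SM.
    by exists (p * p'); rewrite !evM mulrA -[y * z * _]mulrA yq' -mulrA evC mulrA yq.
  have WP y : y \in span_sub (frac S) <-> frac S y.
    split; last exact: span_sub_gen.
    case/span_subP=> s [sP ->]; elim: s sP => [|p s IH] sP.
      by rewrite big_nil -ev0.
    rewrite big_cons.
    have [q Sq [r yq]] := sP p (mem_head _ _).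
    have [|q' Sq' [r' yq']] := IH; first by move=> t ts; apply: sP; rewrite inE ts orbT.
    exists (q * q'); first exact: SM.
    exists ((p.1 *: r) * q' + r' * q).
    rewrite evD !evM mulrDl mulrA -!alg_scaleAl yq evZ -alg_scaleAl.
    by rewrite [ev q * _]evC mulrA yq'.
  exists (span_sub (frac S) : submodClosed D) => //; split; first by rewrite -ev1; apply/WP.
  by move=> y z /WP Wy /WP Wz; apply/WP/fracM.
(* E is the field F(x), to which finite generation applies. *)
have [E EM EP] := fracP (fun q => q != 0) (oner_neq0 _) (@mulf_neq0 _).
have EV : division_closed E.
  move=> y /EP[q q0 [p yq]] y0.
  have p0 : ev p != 0 by rewrite -yq division_mulf_neq0 ?ev_neq0.
  have [z zp _] := division_inv D1 DV p0.
  exists (ev q * z).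
    apply/EP; exists p; last by exists q; rewrite -mulrA zp mulr1.
    by apply: contraNneq p0 => ->; rewrite ev0.
  apply: (division_mulIf D1 DV (ev_neq0 q q0)).
  by rewrite -mulrA yq -mulrA zp mulr1 mul1r.
have [t tE tgen] := FG EM EV.
have [h h0 th] : exists2 h, h != 0 & forall y, y \in t -> exists p, y * ev h = ev p.
  elim: t tE {tgen} => [|y t IH] tE; first by exists 1; rewrite ?oner_neq0.
  have [|h h0 th] := IH; first by move=> z zt; apply: tE; rewrite inE zt orbT.
  have /EP[q q0 [p yq]] := tE y (mem_head _ _).
  exists (q * h); first exact: mulf_neq0.
  move=> z; rewrite inE evM => /orP[/eqP->|/th[r zr]].
    by exists (p * h); rewrite mulrA yq evM.
  by exists (r * q); rewrite [ev q * _]evC mulrA zr evM.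
(* B is F[x, 1/h(x)]; it contains the generators t, hence all of E. *)
have [|p q [k ->] [l ->]|B BM BP] := fracP (fun q => exists k, q = h ^+ k).
- by exists 0%N.
- by exists (k + l)%N; rewrite exprD.
(* g is nonconstant and coprime to h; an inverse of g(x) in B would make g divide a power of h. *)
pose g := 'X * h + 1.
have sg : (1 < size g)%N.
  by rewrite /g size_polyDl ?size_poly1 mulrC size_mulX // ltnS lt0n size_poly_eq0.
have g0 : g != 0 by rewrite -size_poly_eq0 -lt0n ltnW.
have [y yg gy] := division_inv D1 DV (ev_neq0 g g0).
have /BP[_ [k ->] [p yp]] : y \in B.
  apply: (tgen B BM); last by apply/EP; exists g => //; exists 1; rewrite yg ev1.
  by move=> z /th[p zp]; apply/BP; exists h; [exists 1%N|exists p].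
have hk : h ^+ k = g * p by apply: ev_inj; rewrite evM -yp mulrA gy mul1r.
have : coprimep g (h ^+ k).
  apply/coprimep_expr/Bezout_coprimepP; exists (1, - 'X) => /=.
  by rewrite /g mul1r mulNr addrAC subrr add0r eqpxx.
rewrite hk coprimepMr coprimepp => /andP[/eqP sg1 _].
by rewrite sg1 in sg.
Qed.
End Evaluation.

Lemma span_mul (P Q : D -> Prop) (W : submodClosed D) :
  (forall x y, P x -> Q y -> x * y \in W) ->
  forall x y, x \in span_sub P -> y \in span_sub Q -> x * y \in W.
Proof.
move=> PQW x y /span_subP[s [sP ->]] /span_subP[t [tQ ->]].
rewrite mulr_suml big_seq; apply: rpred_sum => p /sP Pp.
rewrite mulr_sumr big_seq; apply: rpred_sum => q /tQ Qq.
by rewrite -alg_scaleAl -alg_scaleAr !rpredZ // PQW.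
Qed.

Lemma span_comm (P : D -> Prop) y :
  (forall x, P x -> y * x = x * y) -> forall x, x \in span_sub P -> y * x = x * y.
Proof.
move=> Py x /span_subP[s [sP ->]]; rewrite mulr_sumr mulr_suml.
by apply: eq_big_seq => p /sP Pp; rewrite -alg_scaleAl -alg_scaleAr Py.
Qed.

(** A nonzero polynomial of degree d that kills x rewrites x^d by lower powers, and multiplication
    by x propagates this. *)
Lemma powers_span (x : D) : exists d, forall k,
  x ^+ k \in span_sub (fun y => exists2 i, (i < d)%N & y = x ^+ i).
Proof.
have [p p0 px] := division_algebraic x.
exists (size p).-1; set W := span_sub _.
have xd : x ^+ (size p).-1 \in W.
  have lp : lead_coef p != 0 by rewrite lead_coef_eq0.
  rewrite -[x ^+ _]scale1r -(mulVf lp) -scalerA; apply: rpredZ.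
  move: px; rewrite -(big_mkord predT (fun i => p`_i *: x ^+ i)).
  rewrite -{1}(@prednK (size p)) ?size_poly_gt0 // big_nat_recr //= big_mkord addrC.
  move=> /eqP; rewrite addr_eq0 => /eqP ->; apply: rpredN_submod.
  apply: rpred_sum => i _; apply: rpredZ; apply: span_sub_gen.
  by exists i.
elim=> [|k IH]; first last.
  rewrite exprS; apply: (span_mul (P := eq x) _ (span_sub_gen (erefl x)) IH).
  move=> _ _ <- [i lt_i ->]; rewrite -exprS.
  have [lt_i1|] := ltnP i.+1 (size p).-1; first by apply: span_sub_gen; exists i.+1.
  by move=> le_i; have -> : i.+1 = (size p).-1 by apply/anti_leq; rewrite lt_i.
(* If d = 0, then [xd] is already the claim for x^0. *)
case E : (size p).-1 => [|d]; first by rewrite -E.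
by apply: span_sub_gen; exists 0%N; rewrite ?E.
Qed.

(** Commuting algebraic elements: monomials with bounded exponents span the algebra they generate.
    The last clause lets the next generator commute with the spanning set built so far. *)
Lemma commuting_span (t : seq D) :
  (forall x y, x \in t -> y \in t -> x * y = y * x) ->
  exists s : seq D, let W := span_sub (fun y => y \in s) in
  [/\ mulr_closed W, {subset t <= W} &
    forall y, (forall x, x \in t -> y * x = x * y) -> forall z, z \in s -> y * z = z * y].
Proof.
elim: t => [|x t IH] tC.
  exists [:: 1]; split=> //; last by move=> y _ z; rewrite inE => /eqP->; rewrite mulr1 mul1r.
  split; first by apply: span_sub_gen; rewrite inE.
  apply: span_mul => y z; rewrite !mem_seq1 => /eqP-> /eqP->; rewrite mulr1.
  by apply: span_sub_gen; rewrite inE.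
have [|s [[s1 sM] ts sC]] := IH.
  by move=> y z yt zt; apply: tC; rewrite inE ?yt ?zt orbT.
have [d dP] := powers_span x.
have xs : forall z, z \in span_sub (fun y => y \in s) -> x * z = z * x.
  by apply: span_comm => z zs; apply: sC => // y yt; apply: tC; rewrite inE ?eqxx ?yt ?orbT.
have xks k z : z \in span_sub (fun y => y \in s) -> x ^+ k * z = z * x ^+ k.
  by move=> zs; apply/esym/commrX/esym/xs.
exists [seq x ^+ i * b | i <- iota 0 d, b <- s]; set W := span_sub _.
have WP k z : z \in span_sub (fun y => y \in s) -> x ^+ k * z \in W.
  move=> zs; apply: (span_mul _ (dP k) zs) => _ b [i lt_id ->] bs.
  by apply: span_sub_gen; apply: allpairs_f; rewrite // mem_iota add0n.
split; first split.
- by rewrite -[1]mulr1 -[X in X * _](expr0 x); apply: WP.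
- apply: span_mul => _ _ /allpairsP[[i b] [_ /= bs ->]] /allpairsP[[j c] [_ /= cs ->]].
  have {}bs := span_sub_gen (P := fun y => y \in s) bs.
  have {}cs := span_sub_gen (P := fun y => y \in s) cs.
  rewrite mulrA -[_ * b * _]mulrA -xks // mulrA -exprD -mulrA.
  by apply: WP; apply: sM.
- move=> y; rewrite inE => /orP[/eqP->|/ts ys].
    by rewrite -[x]mulr1 -[X in X * _]expr1; apply: WP.
  by rewrite -[y]mul1r -[X in X * _](expr0 x); apply: WP.
- move=> y yC _ /allpairsP[[i b] [_ /= bs ->]].
  have yx : y * x = x * y by apply: yC; rewrite mem_head.
  have yb : y * b = b * y by apply: sC => // z zt; apply: yC; rewrite inE zt orbT.
  by rewrite mulrA (commrX i yx) -mulrA yb mulrA.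
Qed.

(** A maximal commuting set, given by Zorn's lemma, is its own centralizer and thus a division
    subalgebra; being finitely generated by commuting algebraic elements, it is finite dimensional,
    and [findim_of_centralizer] applies. *)
Lemma division_findim : findim D.
Proof.
pose P : set (set D) := fun A => forall x y, A x -> A y -> x * y = y * x.
have [|A [AC Amax]] := @Zorn_bigcup D P.
  move=> G GP Gtot x y [X GX Xx] [Y GY Yy].
  by have [XY|YX] := Gtot X Y GX GY; [apply: (GP Y)|apply: (GP X)] => //; [apply: XY|apply: YX].
have AP x : (forall y, A y -> x * y = y * x) -> A x.
  move=> xA; apply: contrapT => nAx.
  apply: (Amax (fun y => A y \/ y = x)).
    split; first by move=> y; left.
    by move=> /(_ x (or_intror erefl)).
  move=> y z [Ay|->] [Az|->] //; [exact: AC|exact/esym/xA|exact: xA].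
pose K : submodClosed D := span_sub A.
have KA x : x \in K <-> A x.
  split; last exact: span_sub_gen.
  by move=> Kx; apply: AP => y Ay; apply/esym; apply: span_comm Kx => z Az; apply: AC.
have Kcomm x : x \in K <-> forall y, y \in K -> x * y = y * x.
  split=> [/KA Ax y /KA Ay|xK]; first exact: AC.
  by apply/KA/AP => y /KA/xK.
have KM : mulr_closed K.
  split; first by apply/Kcomm => y _; rewrite mulr1 mul1r.
  move=> x y /Kcomm Kx /Kcomm Ky; apply/Kcomm => z Kz.
  by rewrite -mulrA Ky // mulrA Kx // mulrA.
have KV : division_closed K.
  move=> x /Kcomm Kx x0; have [y yx xy] := division_inv D1 DV x0.
  exists y => //; apply/Kcomm => z Kz.
  by rewrite -[z in LHS]mulr1 -xy [z * _]mulrA -[z * x]Kx // !mulrA yx mul1r.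
have [t tK tgen] := FG KM KV.
have [|s [sM ts sC]] := @commuting_span t.
  by move=> x y /tK/Kcomm Kx /tK; apply: Kx.
apply: (@findim_of_centralizer F D D1 DV K s) => // x; split.
  by move=> Kx; apply/span_subP; apply: (tgen (span_sub (fun y => y \in s))).
move/span_subP; apply: span_sub_min => y ys; apply/Kcomm => z Kz; apply/esym.
by apply: sC ys => w /tK/Kcomm; move=> /(_ z Kz).
Qed.

End Algebraic.

(** * Filtered algebras and simple modules *)

Lemma span_family (R : pzRingType) (X : lmodType R) (I : Type) (e : I -> X) x :
  x \in span_sub (fun y => exists i, y = e i) ->
  exists s : seq (R * I), x = \sum_(p <- s) p.1 *: e p.2.
Proof.
move=> /span_subP[s [sP ->]]; elim: s sP => [|p s IH] sP.
  by exists [::]; rewrite !big_nil.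
have [i pi] := sP p (mem_head _ _).
have [|t st] := IH; first by move=> q qs; apply: sP; rewrite inE qs orbT.
by exists ((p.1, i) :: t); rewrite !big_cons st pi.
Qed.

Section CommutativeAlgebra.
Variables (F : fieldType) (A : algebra F) (cA : commutative_alg A).
(** A with the proof of commutativity attached, so that products may be reordered by the lemmas on
    commutative rings. *)
Definition comalg : Type := let _ := cA in A.
HB.instance Definition _ := GRing.PzRing.on comalg.
HB.instance Definition _ := GRing.Lmodule.on comalg.
HB.instance Definition _ := GRing.PzRing_hasCommutativeMul.Build comalg cA.
End CommutativeAlgebra.

(** * Symbols in the associated graded algebra *)

Section Symbols.
Variables (F : fieldType) (A : algebra F) (Fl : nat -> submodClosed A).
Hypothesis HF : is_filtered Fl.

Definition single_seq (n : nat) (a : A) (i : nat) : A := if i == n then a else 0.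

Lemma single_seq_fsum (G : nat -> submodClosed A) n a :
  (single_seq n a \in fsum_pred G) = (a \in G n).
Proof.
apply/asboolP/idP => [[+ _]|Ga]; first by move=> /(_ n); rewrite /single_seq eqxx.
split=> [i|]; first by rewrite /single_seq; case: eqP => [->//|_]; apply: rpred0.
by exists n.+1 => i lt_ni; rewrite /single_seq gtn_eqF.
Qed.

(** The default 0, taken when a is not in [Fl n], makes the symbol map total. *)
Definition single n a : rees Fl := insubd 0 (single_seq n a).

Lemma singleE n a : a \in Fl n -> subval (single n a) = single_seq n a.
Proof.
by move=> Fa; rewrite -[subval _]/(val _) val_insubd single_seq_fsum Fa.
Qed.

Definition symb n a : gr HF := proj _ (single n a).

Lemma symb_proj (f g : rees Fl) :
  (forall n, subval f n - subval g n \in Defs.prev Fl n) ->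
  proj (rees_ideal (Fl := Fl)) f = proj _ g.
Proof.
move=> fg; apply/projP/asboolP; split; first exact: fg.
by have /asboolP[_ [N fN]] := subvalP (f - g); exists N.
Qed.

Lemma symb1 : symb 0 1 = 1.
Proof.
apply: symb_proj => n; rewrite singleE; last exact: filt_one HF.
by rewrite /single_seq /=; case: n => [|n]; rewrite subrr rpred0.
Qed.

Lemma symbM p q a b : a \in Fl p -> b \in Fl q ->
  symb p a * symb q b = symb (p + q) (a * b).
Proof.
move=> Fa Fb; rewrite -[LHS](proj_mul (rees_descends HF)); apply: symb_proj => n /=.
rewrite !singleE //; last exact: filt_mul HF _ _ _ _ Fa Fb.
suff -> : conv (single_seq p a) (single_seq q b) n = single_seq (p + q) (a * b) n.
  by rewrite subrr rpred0.
rewrite /conv /single_seq; have [lt_np|le_pn] := ltnP n p.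
  rewrite ltn_eqF ?(leq_trans lt_np) ?leq_addr // big1 // => i _.
  by rewrite ltn_eqF ?mul0r // (leq_ltn_trans _ lt_np) // -ltnS.
rewrite (bigD1 (inord p)) //= inordK // eqxx big1 ?addr0 => [|i].
  by rewrite -(eqn_add2l p (n - p)) subnKC //; case: ifP; rewrite ?mulr0.
move=> ne_ip; case: ifP; rewrite ?mul0r // => /eqP ip.
by case/eqP: ne_ip; apply: val_inj; rewrite /= inordK.
Qed.

Lemma gr_symb_sum (x : gr HF) : exists2 f : nat -> A, (forall n, f n \in Fl n) &
  exists N, x = \sum_(n < N) symb n (f n).
Proof.
rewrite -[x]qreprK; move: (qrepr x) => f.
have /asboolP[Ff [N fN]] := subvalP f.
exists (subval f) => //; exists N; rewrite -(raddf_sum (proj _)).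
congr (proj _ _); apply: rees_ext => n.
have -> : subval (\sum_(i < N) single i (subval f i)) n =
    \sum_(i < N) single_seq i (subval f i) n.
  elim/big_rec2: _ => // i y z _ <-.
  by rewrite -[subval (_ + _)]/(subval _ + subval _) fctE singleE.
rewrite /single_seq; have [lt_nN|le_Nn] := ltnP n N.
  rewrite (bigD1 (Ordinal lt_nN)) //= eqxx big1 ?addr0 // => i.
  by move=> /eqP ne_i; case: eqP => // ni; case: ne_i; apply: val_inj.
rewrite fN // big1 // => i _; case: eqP => // ni.
by move: (ltn_ord i); rewrite -ni ltnNge le_Nn.
Qed.

(** Equality in gr A is compared in degree n, where only the terms with [d i = n] contribute. *)
Lemma symb_sum_component (I : eqType) (s : seq (F * I)) (d : I -> nat) (b : I -> A) n a :
  a \in Fl n -> (forall i, b i \in Fl (d i)) ->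
  symb n a = \sum_(p <- s) p.1 *: symb (d p.2) (b p.2) ->
  a - \sum_(p <- s | d p.2 == n) p.1 *: b p.2 \in Defs.prev Fl n.
Proof.
move=> Fa Fb; rewrite /symb.
under eq_bigr do rewrite -linearZ.
rewrite -(raddf_sum (proj _)) => /projP/asboolP[/(_ n) + _].
rewrite -[subval (_ - _)]/(subval _ - subval _) fctE singleE // {1}/single_seq eqxx.
suff <- : subval (\sum_(p <- s) p.1 *: single (d p.2) (b p.2)) n =
    \sum_(p <- s | d p.2 == n) p.1 *: b p.2 by [].
rewrite [RHS]big_mkcond; elim/big_rec2: _ => // p y z _ <-.
rewrite -[subval (_ + _)]/(subval _ + subval _) fctE.
rewrite -[subval (_ *: _)]/(_ *: subval _) fctE singleE // /single_seq eq_sym.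
by case: ifP; rewrite ?scaler0.
Qed.

Lemma symb_eq_prev n a b : a \in Fl n -> b \in Fl n ->
  symb n a = symb n b -> a - b \in Defs.prev Fl n.
Proof.
move=> Fa Fb ab.
have := @symb_sum_component _ [:: (1, tt)] (fun=> n) (fun=> b) n a Fa (fun=> Fb).
by rewrite big_seq1 big_cons big_nil eqxx !scale1r addr0; apply.
Qed.

(** The homogeneous components of a finite generating set generate as well, and each of them is a
    symbol. *)
Lemma symb_gens : fin_gen_alg (gr HF) -> exists2 g : seq (nat * A),
  (forall p, p \in g -> p.2 \in Fl p.1) &
  forall B : submodClosed (gr HF), mulr_closed B ->
    (forall p, p \in g -> symb p.1 p.2 \in B) -> forall x, x \in B.
Proof.
move=> [s sgen].
suff [g gF gs] : exists2 g : seq (nat * A), (forall p, p \in g -> p.2 \in Fl p.1) &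
    forall B : submodClosed (gr HF), (forall p, p \in g -> symb p.1 p.2 \in B) ->
    {subset s <= B}.
  by exists g => // B BM gB; apply: sgen => //; apply: gs.
elim: s {sgen} => [|x s [g gF gs]]; first by exists [::].
have [f Ff [N ->]] := gr_symb_sum x.
exists ([seq (i, f i) | i <- iota 0 N] ++ g).
  by move=> p; rewrite mem_cat => /orP[/mapP[i _ ->]|/gF //]; apply: Ff.
move=> B gB y; rewrite inE => /orP[/eqP->|ys].
  apply: rpred_sum => i _; apply: (gB (val i, f i)).
  by rewrite mem_cat map_f // mem_iota add0n ltn_ord.
by apply: gs ys => p pg; apply: gB; rewrite mem_cat pg orbT.
Qed.

End Symbols.

Section Monomials.
Variables (F : fieldType) (A : algebra F) (Fl : nat -> submodClosed A).
Hypothesis HF : is_filtered Fl.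
Variables (g : seq (nat * A)).
Hypothesis gF : forall p, p \in g -> p.2 \in Fl p.1.
Local Notation m := (size g).
Local Notation mon := 'X_{1..m}.
Local Notation gen j := (nth (0%N, 0%R) g j).

Definition mon_wt (al : mon) : nat := \sum_(j < m) (gen j).1 * al j.
(** The factors stand in the order of the generators, as A may be noncommutative. *)
Definition mon_val (al : mon) : A := \prod_(j < m) (gen j).2 ^+ al j.

Lemma mon_wtD al be : mon_wt (al + be)%MM = (mon_wt al + mon_wt be)%N.
Proof. by rewrite -big_split; apply: eq_bigr => j _; rewrite mnmDE mulnDr. Qed.

Lemma mon_valP al : mon_val al \in Fl (mon_wt al) /\
  symb HF (mon_wt al) (mon_val al) =
  \prod_(j < m) symb HF (gen j).1 (gen j).2 ^+ al j.
Proof.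
rewrite /mon_val /mon_wt.
elim/big_rec3: _ => [|j x a n _ [Fx sx]].
  by split; [exact: filt_one HF|exact: symb1].
have gj : gen j \in g by rewrite mem_nth.
set p := nth _ _ _ in gj *.
have [Fp sp] : p.2 ^+ al j \in Fl (p.1 * al j)%N /\
    symb HF (p.1 * al j) (p.2 ^+ al j) = symb HF p.1 p.2 ^+ al j.
  elim: (al j) => [|k [Fk sk]].
    by rewrite muln0 !expr0; split; [exact: filt_one HF|exact: symb1].
  rewrite mulnS !exprS -sk symbM ?gF //; split=> //.
  exact: filt_mul HF _ _ _ _ (gF gj) Fk.
split; first exact: filt_mul HF _ _ _ _ Fp Fx.
by rewrite -symbM // sp sx.
Qed.

Hypothesis cA : commutative_alg (gr HF).
Hypothesis ggen : forall B : submodClosed (gr HF), mulr_closed B ->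
    (forall p, p \in g -> symb HF p.1 p.2 \in B) -> forall x, x \in B.

Let xi (al : mon) : comalg cA :=
  \prod_(j < m) (symb HF (gen j).1 (gen j).2 : comalg cA) ^+ al j.

Let xiM al be : xi al * xi be = xi (al + be)%MM.
Proof. by rewrite -big_split; apply: eq_bigr => j _; rewrite mnmDE exprD. Qed.

(** Both terms have the same symbol, because gr A is commutative. *)
Lemma mon_valM al be :
  mon_val al * mon_val be - mon_val (al + be)%MM \in Defs.prev Fl (mon_wt (al + be)%MM).
Proof.
have [Fa sa] := mon_valP al; have [Fb sb] := mon_valP be.
have [Fab sab] := mon_valP (al + be)%MM.
apply: symb_eq_prev => //; first by rewrite mon_wtD; apply: filt_mul HF _ _ _ _ Fa Fb.
by rewrite mon_wtD -(symbM HF Fa Fb) -mon_wtD sa sb sab; apply: xiM.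
Qed.

(** The span of the symbols of monomials is a subalgebra containing the generators. *)
Lemma gr_mon_span (x : gr HF) :
  x \in span_sub (fun y => exists al, y = symb HF (mon_wt al) (mon_val al)).
Proof.
apply: (ggen (B := span_sub (fun y : gr HF =>
  exists al, y = symb HF (mon_wt al) (mon_val al)))).
  split.
    apply: span_sub_gen; exists 0%MM; rewrite (proj2 (mon_valP _)) big1 // => j _.
    by rewrite mnm0E expr0.
  apply: (@span_mul _ (gr HF)) => _ _ [al ->] [be ->].
  apply: span_sub_gen; exists (al + be)%MM.
  by rewrite !(proj2 (mon_valP _)); apply: xiM.
move=> p pg; apply: span_sub_gen.
have pm : (index p g < m)%N by rewrite index_mem.
exists U_(Ordinal pm)%MM; rewrite (proj2 (mon_valP _)) -[RHS]/(xi _) /xi.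
rewrite (bigD1 (Ordinal pm)) //=.
rewrite mnm1E eqxx expr1 nth_index // big1 ?mulr1 // => j.
by rewrite mnm1E eq_sym => /negbTE->.
Qed.

(** An expression of the symbol of a by symbols of monomials lifts to a up to an error one level
    lower; induction on n absorbs the error. *)
Lemma mon_val_span n a : a \in Fl n ->
  a \in span_sub (fun y => exists2 al, (mon_wt al <= n)%N & y = mon_val al).
Proof.
have decomp k x : x \in Fl k -> exists2 b,
    b \in span_sub (fun y => exists2 al, (mon_wt al <= k)%N & y = mon_val al) &
    x - b \in Defs.prev Fl k.
  move=> Fx; have [s sx] := span_family (gr_mon_span (symb HF k x)).
  exists (\sum_(p <- s | mon_wt p.2 == k) p.1 *: mon_val p.2).
    apply: rpred_sum => p /eqP wtp; apply: rpredZ; apply: span_sub_gen.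
    by exists p.2; rewrite ?wtp.
  exact: symb_sum_component Fx (fun al => proj1 (mon_valP al)) sx.
elim: n a => [|n IH] a /decomp[b Wb ab].
  by move: ab; rewrite unfold_in subr_eq0 => /eqP->.
rewrite -[a](subrK b); apply: rpredD => //.
move/IH: ab; apply: span_sub_min => _ [al le_al ->].
by apply: span_sub_gen; exists al => //; apply: leqW.
Qed.

Lemma mon_val_span_prev n a : a \in Defs.prev Fl n ->
  a \in span_sub (fun y => exists2 al, (mon_wt al < n)%N & y = mon_val al).
Proof.
case: n => [|n]; last exact: mon_val_span.
by rewrite unfold_in => /eqP->; rewrite rpred0.
Qed.

End Monomials.

Section ClosedPredicate.
Variables (R : pzRingType) (X : lmodType R) (P : {pred X}).
Hypothesis PC : subsemimod_closed P.
(** Attaches the closure proof to P, so that a predicate defined inside a proof becomes a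
    [submodClosed]. *)
Definition closed_pred : {pred X} := let _ := PC in P.
HB.instance Definition _ := GRing.isSubSemiModClosed.Build R X closed_pred PC.
End ClosedPredicate.

Section EndomorphismAction.
Variables (F : fieldType) (A : algebra F) (S : lmodType A).
Let D := EndA S.
Let op (a : A) : {linear restr S -> restr S} := actA a.

Definition endfun (f : D) : S -> S := cfun (f : commutant op).

Lemma endfun_comm f (a : A) x : endfun f (a *: x) = a *: endfun f x.
Proof. by case/asboolP: (cfunP (f : commutant op)) => _; apply. Qed.

Lemma endfunD f x y : endfun f (x + y) = endfun f x + endfun f y.
Proof.
have := commutant_lin (f : commutant op) 1 (x : restr S) y.
by rewrite !scale1r.
Qed.

Lemma endfun_ext f g : endfun f =1 endfun g -> f = g.
Proof. exact: (@commutant_ext _ _ _ op). Qed.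

Definition endmod : Type := S.
HB.instance Definition _ := GRing.Zmodule.on endmod.
Definition end_scale (f : D) (x : endmod) : endmod := endfun f x.

Lemma end_scaleA f g x : end_scale f (end_scale g x) = end_scale (f * g) x.
Proof. by []. Qed.
Lemma end_scale1 : left_id 1 end_scale.
Proof. by []. Qed.
Lemma end_scaleDr : right_distributive end_scale +%R.
Proof. by move=> f x y; apply: endfunD. Qed.
Lemma end_scaleDl x : {morph end_scale^~ x : f g / f + g}.
Proof. by []. Qed.
HB.instance Definition _ := GRing.Zmodule_isLmodule.Build D endmod
  end_scaleA end_scale1 end_scaleDr end_scaleDl.

Definition act_end (a : A) (x : endmod) : endmod := a *: (x : S).
Lemma act_end_linear a : linear (act_end a).
Proof.
move=> f x y; rewrite /act_end scalerDr; congr (_ + _).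
exact/esym/endfun_comm.
Qed.
HB.instance Definition _ a :=
  GRing.isLinear.Build D endmod endmod *:%R (act_end a) (act_end_linear a).

(** F acts on S in the same way through D and through A, so coefficients from F count as
    coefficients in any subalgebra of D. *)
Lemma end_scale_const (c : F) (x : endmod) :
  (c *: (1 : D)) *: x = (c *: (1 : A)) *: (x : S).
Proof. by []. Qed.

Hypothesis simpS : simple_module S.

(** Kernel and image of f are A-submodules, so f is bijective; its inverse map commutes with A
    because f does. *)
Lemma schur (f : D) : f != 0 -> exists g, g * f = 1.
Proof.
case: simpS => [[s0 s00] simp] f0.
have fN x : endfun f (- x) = - endfun f x.
  by rewrite -scaleN1r endfun_comm scaleN1r.
have f00 : endfun f 0 = 0 by have := endfun_comm f 0 0; rewrite !scale0r.
pose kerP : {pred S} := fun x => endfun f x == 0.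
have kerC : subsemimod_closed kerP.
  split; first split.
  - by rewrite unfold_in; apply/eqP.
  - by move=> x y; rewrite !unfold_in endfunD => /eqP-> /eqP->; rewrite addr0.
  - by move=> a x; rewrite !unfold_in endfun_comm => /eqP->; rewrite scaler0.
pose ker : submodClosed S := closed_pred kerC.
have inj x : endfun f x = 0 -> x = 0.
  move=> fx; case: (simp ker) => [k0|kT]; first by apply: k0; rewrite unfold_in fx.
  case/eqP: f0; apply: endfun_ext => y; apply/eqP.
  by have := kT y; rewrite unfold_in.
pose imP : {pred S} := fun y => `[< exists x, y = endfun f x >].
have imC : subsemimod_closed imP.
  split; first split.
  - by apply/asboolP; exists 0.
  - move=> _ _ /asboolP[x ->] /asboolP[y ->]; apply/asboolP; exists (x + y).
    by rewrite endfunD.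
  - by move=> a _ /asboolP[x ->]; apply/asboolP; exists (a *: x); rewrite endfun_comm.
pose im : submodClosed S := closed_pred imC.
have {im} /choice[g gP] : forall y, exists x, y = endfun f x.
  case: (simp im) => [i0|iT y]; last by have /asboolP := iT y.
  case/eqP: s00; apply: inj; apply: i0; apply/asboolP; by exists s0.
have finj x y : endfun f x = endfun f y -> x = y.
  move=> fxy; apply/eqP; rewrite -subr_eq0; apply/eqP/inj.
  by rewrite endfunD fN fxy subrr.
have gC : (g : restr S -> restr S) \in commutes_pred op.
  have gA (a : A) x : g (a *: x) = a *: g x.
    by apply: finj; rewrite -gP endfun_comm -gP.
  apply/asboolP; split=> [c x y|a x]; last exact: gA.
  apply: finj; rewrite -[LHS]gP.
  rewrite -[X in _ = endfun f X]/((c *: (1 : A)) *: (g x : S) + (g y : S)).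
  by rewrite endfunD endfun_comm -!gP.
exists (Commutant gC : D); apply: endfun_ext => x.
by apply: finj; rewrite -[LHS]gP.
Qed.

End EndomorphismAction.

Section Quillen.
Variables (F : fieldType) (A : algebra F) (Fl : nat -> submodClosed A).
Hypothesis HF : is_filtered Fl.
Hypotheses (cA : commutative_alg (gr HF)) (fgA : fin_gen_alg (gr HF)).
Variable S : lmodType A.
Hypothesis simpS : simple_module S.

Lemma simple_cyclic (s x : S) : s != 0 -> exists a : A, x = a *: s.
Proof.
move=> s0; have [_ simp] := simpS.
pose P : {pred S} := fun y => `[< exists a : A, y = a *: s >].
have PC : subsemimod_closed P.
  split; first split.
  - by apply/asboolP; exists 0; rewrite scale0r.
  - move=> _ _ /asboolP[a ->] /asboolP[b ->]; apply/asboolP; exists (a + b).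
    by rewrite scalerDl.
  - by move=> c _ /asboolP[a ->]; apply/asboolP; exists (c * a); rewrite scalerA.
pose W : submodClosed S := closed_pred PC.
case: (simp W) => [W0|WT]; last exact/asboolP/WT.
by case/eqP: s0; apply: W0; apply/asboolP; exists 1; rewrite scale1r.
Qed.

(** [division_fin_gen] is applied to the vectors x^al s, for a nonzero s in S and the ordered
    monomials x^al in lifts of generators of gr A. *)
Lemma EndA_fin_gen (E : submodClosed (EndA S)) :
  mulr_closed E -> division_closed E -> fin_gen_over E.
Proof.
move=> EM EV; have [[s s0] _] := simpS.
have [g gF ggen] := symb_gens fgA.
have span n a (Fa : a \in Fl n) := mon_val_span gF cA ggen Fa.
pose e (al : 'X_{1..size g}) : endmod S := act_end (mon_val al : A) (s : endmod S).
have coefs (B : submodClosed (EndA S)) (P : 'X_{1..size g} -> Prop) a :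
    mulr_closed B -> a \in span_sub (fun y => exists2 al, P al & y = mon_val al) ->
    coef_span e B P (act_end a (s : endmod S)).
  move=> [B1 _] /span_subP[t [tP ->]]; elim: t tP => [|p t IH] tP.
    by rewrite big_nil /act_end scale0r; apply: coef_span0.
  rewrite big_cons /act_end scalerDl; apply: coef_spanD; last first.
    by apply: IH => q qt; apply: tP; rewrite inE qt orbT.
  have [al Pal ->] := tP p (mem_head _ _).
  exists [:: (p.1 *: (1 : EndA S) : EndA S, al)].
    by move=> q; rewrite inE => /eqP->; split=> //; apply: rpredZ.
  by rewrite /combo big_seq1 end_scale_const /e /act_end scalerA -alg_scaleAl mul1r.
apply: (@division_fin_gen _ _ (endmod S) _ (@mon_wt _ _ g) (@mon_wtD _ _ g) e
  (fun al => act_end (mon_val al))) => //.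
- move=> al be B BM; rewrite /e.
  have -> : act_end (mon_val al) (act_end (mon_val be) (s : endmod S)) -
      act_end (mon_val (al + be)%MM) (s : endmod S) =
      act_end (mon_val al * mon_val be - mon_val (al + be)%MM) (s : endmod S).
    by rewrite /act_end scalerBl scalerA.
  have := mon_val_span_prev gF cA ggen (mon_valM gF cA al be).
  move/(coefs B (fun c => (mon_wt c < mon_wt (al + be)%MM)%N) _ BM).
  (* The product of two monomials is corrected in a lower filtration level, that is, by monomials of
     smaller weight. *)
  by apply: coef_span_sub => // c lt_c; rewrite /mlt lt_c.
- move=> x B BM; have [a ->] := simple_cyclic (x : S) s0.
  have [n Fa] := filt_exhaust HF a.
  by have := coefs B _ _ BM (span n a Fa); apply: coef_span_sub.
- rewrite /e /act_end /mon_val big1 ?scale1r // => j _.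
  by rewrite mnm0E expr0.
Qed.

Theorem EndA_simple_findim :
  (forall f : EndA S, algebraic_elt f) /\ findim (EndA S).
Proof.
have D1 : (1 : EndA S) != 0.
  have [[s s0] _] := simpS; apply: contraNneq s0 => /(congr1 (fun f => endfun f s)) eq1.
  exact/eqP.
have DV := schur simpS.
split; first exact: division_algebraic D1 DV EndA_fin_gen.
exact: division_findim D1 DV EndA_fin_gen.
Qed.

End Quillen.

(** * Residues and Zhu's algebra *)

Section Bincoef.
Variable F : fieldType.

Lemma bincoef0 l : bincoef F l 0 = 1.
Proof. by case: l => n; rewrite /bincoef /binz ?addn0 bin0 ?expr0 !mul1r. Qed.

Lemma bincoef_0S i : bincoef F 0 i.+1 = 0.
Proof. by rewrite -[0]/(Posz 0) /bincoef /binz bin0n mulr0. Qed.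

(** For i <= m the upper index is negative and the two signs cancel; for i > m both sides vanish.
    The right side of the Jacobi identity thus involves the divided derivatives of z^m. *)
Lemma bincoef_nat (m i : nat) : bincoef F (i%:Z - m%:Z - 1) i = 'C(m, i)%:R.
Proof.
rewrite /bincoef; have [le_im|lt_mi] := leqP i m.
  have -> : i%:Z - m%:Z - 1 = Negz (m - i) by lia.
  by rewrite /binz subnK // mulrA -exprD addnn -muln2 mulnC exprM sqrrN expr1n mul1r.
have -> : i%:Z - m%:Z - 1 = Posz (i - m.+1) by lia.
by rewrite /binz !bin_small ?mulr0 //; lia.
Qed.

Lemma bincoef_diag (i : nat) : bincoef F i%:Z i = (-1) ^+ i.
Proof. by rewrite /bincoef /binz binn mulr1 rmorphXn /= rmorphN1. Qed.

End Bincoef.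

Section Residues.
Variables (F : fieldType) (V : vertex_algebra F) (M : weak_module V).
Implicit Types (u v : V) (w : M) (P Q : {poly F}) (l m n q : int).

Lemma wmodeD u u' n w : wmode (u + u') n w = wmode u n w + wmode u' n w.
Proof. by have := wmode_linl n w 1 u u'; rewrite !scale1r. Qed.
Lemma wmode0 n w : wmode 0 n w = 0.
Proof. by apply: (addrI (wmode 0 n w)); rewrite -wmodeD !addr0. Qed.
Lemma wmodeZ c u n w : wmode (c *: u) n w = c *: wmode u n w.
Proof. by have := wmode_linl n w c u 0; rewrite wmode0 !addr0. Qed.
Lemma wmode_suml (I : Type) (r : seq I) (K : pred I) (f : I -> V) n w :
  wmode (\sum_(i <- r | K i) f i) n w = \sum_(i <- r | K i) wmode (f i) n w.
Proof.
apply: (big_morph (fun u => wmode u n w)); last exact: wmode0.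
by move=> u u'; apply: wmodeD.
Qed.

Lemma wmode_rD u n w w' : wmode u n (w + w') = wmode u n w + wmode u n w'.
Proof. exact: (raddfD (mode_op (u, n))). Qed.
Lemma wmode_r0 u n : wmode u n (0 : M) = 0.
Proof. exact: (raddf0 (mode_op (u, n))). Qed.
Lemma wmode_rZ c u n w : wmode u n (c *: w) = c *: wmode u n w.
Proof. by have := wmode_linr u n c w 0; rewrite wmode_r0 !addr0. Qed.
Lemma wmode_sumr (I : Type) (r : seq I) (K : pred I) (f : I -> M) u n :
  wmode u n (\sum_(i <- r | K i) f i) = \sum_(i <- r | K i) wmode u n (f i).
Proof. exact: (raddf_sum (mode_op (u, n))). Qed.

(* Res_z Y(u, z) w P(z) z^q *)
Definition res u P q w : M := \sum_(i < size P) P`_i *: wmode u (q + i%:Z) w.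

Lemma res_widen k u P q w : (size P <= k)%N ->
  res u P q w = \sum_(i < k) P`_i *: wmode u (q + i%:Z) w.
Proof.
move=> le_k; rewrite /res (big_ord_widen _ (fun i => P`_i *: wmode u (q + i%:Z) w) le_k).
rewrite big_mkcond; apply: eq_bigr => i _; case: ltnP => // le_i.
by rewrite nth_default ?scale0r.
Qed.

Lemma resD u P Q q w : res u (P + Q) q w = res u P q w + res u Q q w.
Proof.
pose k := maxn (size P) (size Q).
rewrite !(@res_widen k) ?leq_maxl ?leq_maxr ?size_polyD //.
by rewrite -big_split; apply: eq_bigr => i _; rewrite coefD scalerDl.
Qed.

Lemma resZ c u P q w : res u (c *: P) q w = c *: res u P q w.
Proof.
rewrite (@res_widen (size P)) ?size_scale_leq // scaler_sumr.
by apply: eq_bigr => i _; rewrite coefZ scalerA.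
Qed.

Lemma res_sum (I : Type) (r : seq I) (K : pred I) (f : I -> {poly F}) u q w :
  res u (\sum_(i <- r | K i) f i) q w = \sum_(i <- r | K i) res u (f i) q w.
Proof.
apply: (big_morph (fun P => res u P q w)) => [P Q|]; first exact: resD.
by rewrite /res size_poly0 big_ord0.
Qed.

Lemma resXn u k q w : res u 'X^k q w = wmode u (q + k%:Z) w.
Proof.
rewrite /res size_polyXn (bigD1 ord_max) //= coefXn eqxx scale1r big1 ?addr0 // => i.
by move=> ne_i; rewrite coefXn -[k in _ == k]/(val (ord_max : 'I_k.+1)) val_eqE (negbTE ne_i) scale0r.
Qed.

Lemma resMXn u P k q w : res u (P * 'X^k) q w = res u P (q + k%:Z) w.
Proof.
rewrite -[P in LHS]coefK poly_def mulr_suml res_sum; apply: eq_bigr => i _.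
rewrite -scalerAl resZ -exprD resXn; congr (_ *: wmode _ _ _).
by rewrite -addrA -PoszD addnC.
Qed.

Lemma res_linl c u u' P q w : res (c *: u + u') P q w = c *: res u P q w + res u' P q w.
Proof.
rewrite /res scaler_sumr -big_split; apply: eq_bigr => i _.
by rewrite wmodeD wmodeZ scalerDr !scalerA mulrC.
Qed.

Lemma res_linr c u P q w w' : res u P q (c *: w + w') = c *: res u P q w + res u P q w'.
Proof.
rewrite /res scaler_sumr -big_split; apply: eq_bigr => i _.
by rewrite wmode_rD wmode_rZ scalerDr !scalerA mulrC.
Qed.

Lemma res_res u P k v Q n w :
  res u P k (res v Q n w) =
  \sum_(r < size P) \sum_(s < size Q) (P`_r * Q`_s) *:
     wmode u (k + r%:Z) (wmode v (n + s%:Z) w).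
Proof.
rewrite /res; apply: eq_bigr => r _; rewrite wmode_sumr scaler_sumr.
by apply: eq_bigr => s _; rewrite wmode_rZ scalerA.
Qed.

(* The Jacobi identity integrated against P(z1) z1^m Q(z2) z2^n (z1 - z2)^l. *)
Lemma jacobi_res u v w l m n P Q : exists N0 : nat, forall N, (N0 <= N)%N ->
  \sum_(i < N) bincoef F l i *: res u P (m + l - i%:Z) (res v Q (n + i%:Z) w)
  - \sum_(i < N) ((-1) ^ l * bincoef F l i) *:
      res v Q (n + l - i%:Z) (res u P (m + i%:Z) w)
  = \sum_(i < N) \sum_(r < size P) (P`_r * bincoef F (i%:Z - (m + r%:Z) - 1) i) *:
      res (vmode u (l + i%:Z) v) Q (m + n + r%:Z - i%:Z) w.
Proof.
have [f fP] := choice (fun rs : nat * nat =>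
  @wmode_jacobi F V M u v w l (m + rs.1%:Z) (n + rs.2%:Z)).
(* Each pair of monomials of P and Q has its own truncation bound; the largest one serves them
   all. *)
exists (\max_(r < size P) \max_(s < size Q) f (r : nat, s : nat)) => N leN.
have {leN} fN (r : 'I_(size P)) (s : 'I_(size Q)) : (f (r : nat, s : nat) <= N)%N.
  apply: leq_trans leN; rewrite (bigD1 r) //= (bigD1 s) //=.
  by rewrite leq_max leq_max leqnn.
transitivity (\sum_(r < size P) \sum_(s < size Q) (P`_r * Q`_s) *:
    \sum_(i < N) bincoef F (i%:Z - (m + r%:Z) - 1) i *:
    wmode (vmode u (l + i%:Z) v) (m + r%:Z + (n + s%:Z) - i%:Z) w); last first.
  rewrite [RHS]exchange_big; apply: eq_bigr => r _ /=.
  under eq_bigr do rewrite scaler_sumr.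
  rewrite exchange_big; apply: eq_bigr => i _ /=; rewrite /res scaler_sumr.
  apply: eq_bigr => s _; rewrite !scalerA; congr (_ *: wmode _ _ _); first by ring.
  by ring.
under [RHS]eq_bigr => r _ do under eq_bigr => s _ do rewrite -(fP (_, _) _ (fN r s)) scalerBr.
under [RHS]eq_bigr do rewrite sumrB.
rewrite [RHS]sumrB; congr (_ - _).
  under [RHS]eq_bigr do under eq_bigr do rewrite scaler_sumr.
  under [RHS]eq_bigr do rewrite exchange_big.
  rewrite [RHS]exchange_big; apply: eq_bigr => i _ /=.
  rewrite res_res scaler_sumr; apply: eq_bigr => r _; rewrite scaler_sumr.
  apply: eq_bigr => s _; rewrite !scalerA mulrC; congr (_ *: wmode _ _ (wmode _ _ _)).
    by ring.
  by ring.
under [RHS]eq_bigr do under eq_bigr do rewrite scaler_sumr.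
under [RHS]eq_bigr do rewrite exchange_big.
rewrite [RHS]exchange_big; apply: eq_bigr => i _ /=.
rewrite res_res exchange_big scaler_sumr; apply: eq_bigr => r _; rewrite scaler_sumr.
apply: eq_bigr => s _; rewrite !scalerA; congr (_ *: wmode _ _ (wmode _ _ _)); by ring.
Qed.

Lemma nderivn_res u P Q i n w :
  res u (P^`N(i) * Q) n w =
  \sum_(r < size P) (P`_r * 'C(r, i)%:R) *: res u Q (n + r%:Z - i%:Z) w.
Proof.
rewrite -{1}[P]coefK poly_def linear_sum /= mulr_suml res_sum; apply: eq_bigr => r _.
rewrite linearZ /= -scalerAl resZ -scalerA; congr (_ *: _).
rewrite nderivnXn mulrnAl -scaler_nat resZ.
have [le_ir|lt_ri] := leqP i r; last by rewrite bin_small ?scale0r.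
by rewrite mulrC resMXn; congr (_ *: res _ _ _ _); rewrite -subzn // addrA.
Qed.

(** The case m = 0: Taylor expansion of P(z1) at z1 = z2 + z0 produces the divided derivatives. *)
Lemma jacobi_nderivn u v w l n P Q : exists N0 : nat, forall N, (N0 <= N)%N ->
  \sum_(i < N) bincoef F l i *: res u P (l - i%:Z) (res v Q (n + i%:Z) w)
  - \sum_(i < N) ((-1) ^ l * bincoef F l i) *: res v Q (n + l - i%:Z) (res u P i%:Z w)
  = \sum_(i < N) res (vmode u (l + i%:Z) v) (P^`N(i) * Q) n w.
Proof.
have [N0 N0P] := jacobi_res u v w l 0 n P Q; exists N0 => N /N0P.
under eq_bigr do rewrite add0r.
under [X in _ - X = _]eq_bigr do rewrite add0r.
move=> ->; apply: eq_bigr => i _; rewrite nderivn_res; apply: eq_bigr => r _.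
by rewrite !add0r bincoef_nat.
Qed.

End Residues.

(** * Additive maps defined on homogeneous elements *)

Section HomogeneousExtension.
Variables (R : pzRingType) (X : lmodType R) (G : nat -> submodClosed X).
Hypothesis HG : is_grading G.

Lemma homogeneous_ind (P : X -> Prop) :
  P 0 -> (forall x y, P x -> P y -> P (x + y)) ->
  (forall n x, x \in G n -> P x) -> forall x, P x.
Proof.
move=> P0 PD PG x; have [[N c] /= [Gc ->]] := grading_span HG x.
by apply: big_ind => // i _; apply: (PG i).
Qed.

Variables (Y : zmodType) (phi : nat -> X -> Y).
Hypothesis phiD : forall n x y, phi n (x + y) = phi n x + phi n y.

Let phi0 n : phi n 0 = 0.
Proof. by apply: (addrI (phi n 0)); rewrite -phiD !addr0. Qed.

(** Padding with zeros brings two decompositions to a common length. *)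
Let cut N (c : nat -> X) i := if (i < N)%N then c i else 0.

Let sum_cut (Z : zmodType) (f : nat -> X -> Z) N K (c : nat -> X) : (forall i, f i 0 = 0) -> (N <= K)%N ->
  \sum_(i < N) f i (c i) = \sum_(i < K) f i (cut N c i).
Proof.
move=> f0 le_NK; rewrite (big_ord_widen _ (fun i => f i (c i)) le_NK) big_mkcond.
by apply: eq_bigr => i _; rewrite /cut; case: ifP.
Qed.

(** Independence of the homogeneous parts makes the decomposition chosen by [homext] agree with
    c. *)
Lemma homext_sum N (c : nat -> X) : (forall i, c i \in G i) ->
  homext HG phi (\sum_(i < N) c i) = \sum_(i < N) phi i (c i).
Proof.
move=> Gc; rewrite /homext; case: cid => -[K d] /= [Gd].
pose L := maxn N K.
have leN : (N <= L)%N := leq_maxl _ _; have leK : (K <= L)%N := leq_maxr _ _.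
rewrite (sum_cut (f := fun=> id) c _ leN) // (sum_cut (f := fun=> id) d _ leK) // => /eqP.
rewrite -subr_eq0 -sumrB => /eqP eq0.
have Gcut M e i : (forall i, e i \in G i) -> cut M e i \in G i.
  by move=> Ge; rewrite /cut; case: ifP => // _; apply: rpred0.
rewrite (sum_cut c phi0 leN) (sum_cut d phi0 leK); apply: eq_bigr => i _; congr (phi _ _).
apply/eqP; rewrite eq_sym -subr_eq0; apply/eqP.
apply: (grading_indep HG (c := fun i => cut N c i - cut K d i) _ eq0) => // j.
by rewrite rpredD ?rpredN_submod ?Gcut.
Qed.

Lemma homextE n x : x \in G n -> homext HG phi x = phi n x.
Proof.
move=> Gx; pose c i := if i == n then x else 0.
have xE : x = \sum_(i < n.+1) c i.
  rewrite (bigD1 ord_max) //= /c eqxx big1 ?addr0 // => i.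
  by rewrite -val_eqE /= => /negbTE->.
rewrite [in LHS]xE homext_sum.
  rewrite (bigD1 ord_max) //= /c eqxx big1 ?addr0 // => i.
  by rewrite -val_eqE /= => /negbTE->.
by move=> i; rewrite /c; case: eqP => [->|_] //; apply: rpred0.
Qed.

Lemma homextD x y : homext HG phi (x + y) = homext HG phi x + homext HG phi y.
Proof.
have [[N c] /= [Gc ->]] := grading_span HG x.
have [[K d] /= [Gd ->]] := grading_span HG y.
pose L := maxn N K.
have leN : (N <= L)%N := leq_maxl _ _; have leK : (K <= L)%N := leq_maxr _ _.
have Gcut M e i : (forall i, e i \in G i) -> cut M e i \in G i.
  by move=> Ge; rewrite /cut; case: ifP => // _; apply: rpred0.
rewrite (sum_cut (f := fun=> id) c _ leN) // (sum_cut (f := fun=> id) d _ leK) //.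
rewrite -big_split !(homext_sum, @homext_sum _ (fun i => cut N c i + cut K d i)) => [|i|i|i].
- by rewrite -big_split; apply: eq_bigr => i _; rewrite phiD.
- exact: Gcut.
- exact: Gcut.
- by rewrite rpredD ?Gcut.
Qed.

Lemma homext0 : homext HG phi 0 = 0.
Proof. by rewrite (homextE (n := 0%N)) ?rpred0. Qed.

End HomogeneousExtension.

Section HomogeneousExtensionLinear.
Variables (R : pzRingType) (X : lmodType R) (G : nat -> submodClosed X).
Hypothesis HG : is_grading G.
Variables (Y : lmodType R) (phi : nat -> X -> Y).
Hypothesis phi_lin : forall n, linear (phi n).

Let phiD n x y : phi n (x + y) = phi n x + phi n y.
Proof. by have := phi_lin n 1 x y; rewrite !scale1r. Qed.

Lemma homext_linear : linear (homext HG phi).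
Proof.
move=> a x y; rewrite homextD //; congr (_ + _).
elim/(homogeneous_ind HG): x => [|x x' IHx IHx'|n x Gx].
- by rewrite scaler0 homext0 // scaler0.
- by rewrite scalerDr !homextD // IHx IHx' scalerDr.
rewrite !(homextE HG phiD (n := n)) ?rpredZ //.
have phi0 : phi n 0 = 0 by apply: (addrI (phi n 0)); rewrite -phiD !addr0.
by have := phi_lin n a x 0; rewrite phi0 !addr0.
Qed.
End HomogeneousExtensionLinear.

Definition adjoint (F : fieldType) (V : vertex_algebra F) : weak_module V :=
  WeakModule (@vmode_linl F V) (@vmode_linr F V) (@vmode_trunc F V) (@vmode_vac F V)
    (@vmode_jacobi F V).

Section Binomials.
Variable F : fieldType.

Definition gm (p : nat) : {poly F} := ('X + 1) ^+ p.

Lemma gmE p : gm p = \poly_(i < p.+1) 'C(p, i)%:R.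
Proof.
rewrite /gm exprD1n poly_def; apply: eq_bigr => i _.
by rewrite -scaler_nat.
Qed.

Lemma gmD p q : gm (p + q) = gm p * gm q. Proof. exact: exprD. Qed.

Lemma coef_gm p i : (gm p)`_i = 'C(p, i)%:R.
Proof. by rewrite gmE coef_poly ltnS; case: leqP => // /bin_small->. Qed.

Lemma bin_mul_bin n i k : ('C(n, i + k) * 'C(i + k, i) = 'C(n, i) * 'C(n - i, k))%N.
Proof.
have [le_n|lt_n] := leqP (i + k) n; last first.
  rewrite bin_small // mul0n.
  have [le_i|lt_i] := leqP i n; last by rewrite bin_small.
  by rewrite ['C(n - i, k)]bin_small ?muln0 //; lia.
have e1 := bin_fact le_n.
have e2 := bin_fact (leq_addr k i).
have le_in : (i <= n)%N by lia.
have e3 := bin_fact le_in.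
have le_k : (k <= n - i)%N by lia.
have e4 := bin_fact le_k.
have ei : (i + k - i = k)%N by lia.
have en : (n - i - k = n - (i + k))%N by lia.
rewrite ei in e2; rewrite en in e4.
have pos : (0 < i`! * k`! * (n - (i + k))`!)%N by rewrite !muln_gt0 !fact_gt0.
apply/eqP; rewrite -(eqn_pmul2r pos); apply/eqP.
transitivity (n`!).
  by rewrite -e1 -e2; ring.
by rewrite -e3 -e4; ring.
Qed.

Lemma nderivn_gm p i : (gm p)^`N(i) = 'C(p, i)%:R *: gm (p - i).
Proof.
apply/polyP => k; rewrite coef_nderivn coefZ !coef_gm -[LHS]mulr_natr -!natrM.
by rewrite bin_mul_bin.
Qed.

End Binomials.

Section Zhu.
Variables (F : fieldType) (V : voa F).
Implicit Types (a b c u v x y : V).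
Local Notation wts := (wt_space V).
Local Notation O := (zhuO V).
Local Notation rs := (res (M := adjoint V)).

Lemma resYE a b N q : resY a b N q = rs a (gm F N) q b.
Proof.
rewrite gmE (@res_widen _ _ (adjoint V) N.+1) ?size_poly //.
apply: eq_bigr => i _; rewrite coef_poly ltn_ord; congr (_ *: vmode _ _ _).
exact: addrC.
Qed.

Lemma wt_modeE s t (n : int) k u v : u \in wts s -> v \in wts t ->
  s%:Z + t%:Z - n - 1 = k%:Z -> vmode u n v \in wts k.
Proof. by move=> us vt e; have := wt_mode n us vt; rewrite e. Qed.

Lemma wt_mode_lt0 s t (n : int) u v : u \in wts s -> v \in wts t ->
  s%:Z + t%:Z - n - 1 < 0 -> vmode u n v = 0.
Proof.
move=> us vt; have := wt_mode n us vt; case: (_ - 1) => //= k.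
by rewrite unfold_in => /eqP.
Qed.

(** These are the generators with s = N - p and t = -q - 2; the bound on q says s <= t. *)
Lemma zhuO_res p u v N (q : int) : u \in wts p -> (p <= N)%N ->
  q + N%:Z - p%:Z <= -2 -> rs u (gm F N) q v \in O.
Proof.
move=> up le_pN le_q; apply: span_sub_gen; left.
exists p; exists (N - p)%N; exists (absz (q + 2)); exists u; exists v; split=> //; first by lia.
by rewrite resYE subnKC //; congr (rs _ _ _ _); lia.
Qed.

Lemma zhu_mul_linl v : linear (fun u => zhu_mul u v).
Proof.
apply: homext_linear => n c u u' /=; rewrite !resYE; exact: (@res_linl _ _ (adjoint V)).
Qed.

Lemma zhu_mulE p u v : u \in wts p -> zhu_mul u v = rs u (gm F p) (-1) v.
Proof.
move=> up; rewrite /zhu_mul (homextE _ _ up) ?resYE // => n x y.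
by rewrite !resYE; have := @res_linl _ _ (adjoint V) 1 x y (gm F n) (-1) v; rewrite !scale1r.
Qed.

Lemma zhu_mul_Dl u u' v : zhu_mul (u + u') v = zhu_mul u v + zhu_mul u' v.
Proof. by have := zhu_mul_linl v 1 u u'; rewrite !scale1r. Qed.
Lemma zhu_mul_0l v : zhu_mul 0 v = 0.
Proof. by apply: (addrI (zhu_mul 0 v)); rewrite -zhu_mul_Dl !addr0. Qed.
Lemma zhu_mul_Zl k u v : zhu_mul (k *: u) v = k *: zhu_mul u v.
Proof. by have := zhu_mul_linl v k u 0; rewrite zhu_mul_0l !addr0. Qed.

Lemma zhu_mul_linr u : linear (zhu_mul u).
Proof.
move=> k v v'; elim/(homogeneous_ind (wt_grading V)): u => [|x y IHx IHy|n x Gx].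
- by rewrite !zhu_mul_0l scaler0 addr0.
- by rewrite !zhu_mul_Dl IHx IHy scalerDr addrACA.
by rewrite !(zhu_mulE _ Gx); exact: (@res_linr _ _ (adjoint V)).
Qed.

Lemma zhu_mul_Dr u v v' : zhu_mul u (v + v') = zhu_mul u v + zhu_mul u v'.
Proof. by have := zhu_mul_linr u 1 v v'; rewrite !scale1r. Qed.
Lemma zhu_mul_0r u : zhu_mul u 0 = 0.
Proof. by apply: (addrI (zhu_mul u 0)); rewrite -zhu_mul_Dr !addr0. Qed.
Lemma zhu_mul_Zr k u v : zhu_mul u (k *: v) = k *: zhu_mul u v.
Proof. by have := zhu_mul_linr u k v 0; rewrite zhu_mul_0r !addr0. Qed.

(** The i-th mode in the residue has weight (p - i) + (q + t), which is the exponent of 1 + z in the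
    i-th divided derivative of (1 + z)^p times (1 + z)^(q + t). *)
Lemma zhu_mul_iterate p q t a b c N : a \in wts p -> b \in wts q -> (p < N)%N ->
  zhu_mul (rs a (gm F p) (- (t.+1)%:Z) b) c =
  \sum_(i < N) rs (vmode a (- (t.+1)%:Z + i%:Z) b)
    ((gm F p)^`N(i) * gm F (q + t)) (-1) c.
Proof.
move=> ap bq lt_pN; rewrite (@res_widen _ _ _ N); last first.
  by rewrite gmE; apply: leq_trans (size_poly _ _) lt_pN.
transitivity (\sum_(i < N) zhu_mul ((gm F p)`_i *: (vmode a (- (t.+1)%:Z + i%:Z) b)) c).
  exact: (big_morph (fun x => zhu_mul x c) (fun x y => zhu_mul_Dl x y c) (zhu_mul_0l c)).
apply: eq_bigr => i _; rewrite zhu_mul_Zl nderivn_gm coef_gm -scalerAl resZ.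
have [le_ip|lt_pi] := leqP i p; last by rewrite bin_small ?scale0r.
rewrite -gmD (zhu_mulE (p := (p - i + (q + t))%N)) //.
by apply: wt_modeE ap bq _; lia.
Qed.

(** In the Jacobi identity with l = -t-1 every term on the left lies in O(V), except the one with i
    = 0 when t = 0, which is a * (b * c). The case t = 0 gives associativity and t > 0 the ideal
    property on one side. *)
Lemma zhu_mul_iterate_mod p q t a b c : a \in wts p -> b \in wts q ->
  zhu_mul (rs a (gm F p) (- (t.+1)%:Z) b) c
   - (if t is 0%N then zhu_mul a (zhu_mul b c) else 0) \in O.
Proof.
move=> ap bq.
have [N0 /(_ (maxn N0 p.+1) (leq_maxl _ _))] := @jacobi_nderivn _ _ (adjoint V) a b c
  (- (t.+1)%:Z) (-1) (gm F p) (gm F (q + t)).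
set N := maxn _ _; have lt_pN : (p < N)%N := leq_maxr _ _.
rewrite -(zhu_mul_iterate t c ap bq lt_pN) => <-.
rewrite addrAC; apply: rpredD; last first.
  apply: rpredN_submod; apply: rpred_sum => i _; apply: rpredZ.
  by apply: zhuO_res bq _ _; lia.
case: N lt_pN => // N _; rewrite big_ord_recl /= addrAC; apply: rpredD.
  rewrite bincoef0 scale1r subr0 addr0; case: t => [|t].
    by rewrite addn0 (zhu_mulE _ ap) (zhu_mulE _ bq) subrr rpred0.
  by rewrite subr0; apply: zhuO_res ap _ _; lia.
apply: rpred_sum => i _; apply: rpredZ; apply: zhuO_res ap _ _ => //.
by rewrite /bump /=; lia.
Qed.

End Zhu.

Lemma span_ind (R : pzRingType) (X : lmodType R) (P Q : X -> Prop) :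
  Q 0 -> (forall x y, Q x -> Q y -> Q (x + y)) -> (forall a x, Q x -> Q (a *: x)) ->
  (forall x, P x -> Q x) -> forall x, x \in span_sub P -> Q x.
Proof.
move=> Q0 QD QZ PQ x /span_subP[s [sP ->]]; rewrite big_seq.
by apply: big_ind => // p /sP/PQ; apply: QZ.
Qed.

Section ZhuAlgebra.
Variables (F : fieldType) (V : voa F).
Implicit Types (a b c u v x y : V).
Local Notation wts := (wt_space V).
Local Notation O := (zhuO V).
Local Notation rs := (res (M := adjoint V)).

Let adjD u x y n : vmode u n (x + y) = vmode u n x + vmode u n y.
Proof. exact: (@wmode_rD _ _ (adjoint V)). Qed.

Let adj0 u n : vmode u n (0 : V) = 0.
Proof. exact: (@wmode_r0 _ _ (adjoint V)). Qed.

Lemma L_translation u : vmode (omega V) 0 u = vmode u (-2) (vac V).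
Proof.
by rewrite -(vmode_creation1 (vmode (omega V) 0 u)) -L_derivative opprK scale1r.
Qed.

Lemma res_vac p u (n : nat) : u \in wts p ->
  rs u (gm F p) (- (n.+1)%:Z) (vac V) =
  \sum_(i < n.+1) 'C(p, i)%:R *: vmode u (- (n.+1)%:Z + i%:Z) (vac V).
Proof.
move=> up; rewrite (@res_widen _ _ (adjoint V) (maxn p.+1 n.+1)); last first.
  by rewrite gmE (leq_trans (size_poly _ _)) ?leq_maxl.
rewrite [RHS](big_ord_widen _ (fun i => 'C(p, i)%:R *: vmode u (- (n.+1)%:Z + i%:Z) (vac V))
  (leq_maxr p.+1 n.+1)).
rewrite [RHS]big_mkcond; apply: eq_bigr => i _; rewrite coef_gm; case: ltnP => // le_ni.
by rewrite [wmode _ _ _]vmode_creation0 ?scaler0 //; lia.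
Qed.

(** Expanding (1 + z)^s reduces a generator to those with s = 0 and t replaced by t - i, i <= s; and
    L(-1)u + L(0)u is the generator with v the vacuum and s = t = 0. *)
Lemma zhuO_ind (P : V -> Prop) :
  P 0 -> (forall x y, P x -> P y -> P (x + y)) -> (forall k x, P x -> P (k *: x)) ->
  (forall p q t a b, a \in wts p -> b \in wts q -> P (rs a (gm F p) (- (t.+2)%:Z) b)) ->
  forall x, x \in O -> P x.
Proof.
move=> P0 PD PZ Pgen.
have gen p t a b : a \in wts p -> P (rs a (gm F p) (- (t.+2)%:Z) b).
  move=> ap; elim/(homogeneous_ind (wt_grading V)): b => [|x y Px Py|n x Gx].
  - by rewrite /res big1 // => i _; rewrite wmode_r0 scaler0.
  - by have := @res_linr _ _ (adjoint V) 1 a (gm F p) (- (t.+2)%:Z) x y;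
      rewrite !scale1r => ->; apply: PD.
  exact: Pgen ap Gx.
apply: span_ind => // x [[p [s [t [u [v [up le_st ->]]]]]]|[u ->]].
  rewrite resYE gmD mulrC [gm F s]gmE poly_def mulr_suml (@res_sum _ _ (adjoint V)).
  apply: big_ind => // i _; rewrite -scalerAl (@resZ _ _ (adjoint V)); apply: PZ.
  rewrite mulrC (@resMXn _ _ (adjoint V)).
  have -> : - (t.+2)%:Z + i%:Z = - ((t - i).+2)%:Z by have := ltn_ord i; lia.
  exact: gen.
elim/(homogeneous_ind (wt_grading V)): u => [|u u' Pu Pu'|n u un].
- by rewrite !adj0 addr0.
- by rewrite !adjD addrACA; apply: PD.
have := gen n 0%N u (vac V) un; rewrite (res_vac _ un) !big_ord_recl big_ord0 /=.
have -> : - 2%:Z + (bump 0 0)%:Z = -1 by [].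
by rewrite bin0 bin1 !addr0 scale1r vmode_creation1 -L_weight // -L_translation.
Qed.

Lemma zhuO_mulr x c : x \in O -> zhu_mul x c \in O.
Proof.
move: x; apply: zhuO_ind => [|x y Ox Oy|k x Ox|p q t a b ap bq].
- by rewrite zhu_mul_0l rpred0.
- by rewrite zhu_mul_Dl rpredD.
- by rewrite zhu_mul_Zl rpredZ.
by have := zhu_mul_iterate_mod t.+1 c ap bq; rewrite subr0.
Qed.

(** Pascal's rule for the upper index r - 1; at r = 0 it says that the alternating signs of 1/z
    cancel. *)
Lemma bincoef_pascal (r i : nat) :
  bincoef F (i.+1%:Z - (-1 + r%:Z) - 1) i.+1 + bincoef F (i%:Z - (-1 + r%:Z) - 1) i
  = 'C(r, i.+1)%:R.
Proof.
case: r => [|r].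
  have e k : k%:Z - (-1 + 0%:Z) - 1 = k%:Z :> int by lia.
  by rewrite !e !bincoef_diag exprS mulN1r addNr bin0n.
have e k : k%:Z - (-1 + r.+1%:Z) - 1 = k%:Z - r%:Z - 1 :> int by lia.
by rewrite !e !bincoef_nat binS natrD.
Qed.

(* With f(z) = (1 + z)^p / z, the sum is the residue of Y(x, z) c against
   (1 + z)^q z^n times the i-th divided derivative of f; these obey
   z f^(i+1) + f^(i) = ((1 + z)^p)^(i+1). *)
Lemma zhuO_derivative p q k x c (i : nat) (n : int) : x \in wts k ->
  (k + i <= p + q)%N -> n - 1 + (p + q)%:Z - i%:Z - k%:Z <= -2 ->
  \sum_(r < size (gm F p)) ((gm F p)`_r * bincoef F (i%:Z - (-1 + r%:Z) - 1) i) *: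
    rs x (gm F q) (-1 + n + r%:Z - i%:Z) c \in O.
Proof.
move=> xk.
have gen j (n' : int) : (k + j <= p + q)%N -> n' + (p + q)%:Z - j%:Z - k%:Z <= -2 ->
    rs x ((gm F p)^`N(j) * gm F q) n' c \in O.
  move=> le_k le_n; rewrite nderivn_gm -scalerAl (@resZ _ _ (adjoint V)).
  have [le_jp|lt_pj] := leqP j p; last by rewrite bin_small ?scale0r ?rpred0.
  by rewrite -gmD; apply: rpredZ; apply: zhuO_res xk _ _; lia.
elim: i n => [|i IH] n le_k le_n.
  have := gen 0%N (-1 + n) le_k; rewrite (@nderivn_res _ _ (adjoint V)).
  move=> H; rewrite (eq_bigr (fun r : 'I_ _ => ((gm F p)`_r * 'C(r, 0)%:R) *:
    rs x (gm F q) (-1 + n + r%:Z - 0%:Z) c)); first by apply: H; lia.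
  by move=> r _; rewrite bincoef0 bin0.
have := IH (n - 1); set T := \sum_(_ < _) _ => TO.
have := gen i.+1 (-1 + n) le_k; rewrite (@nderivn_res _ _ (adjoint V)).
set U := \sum_(_ < _) _ => UO.
suff -> : \sum_(r < size (gm F p)) ((gm F p)`_r *
    bincoef F (i.+1%:Z - (-1 + r%:Z) - 1) i.+1) *:
    rs x (gm F q) (-1 + n + r%:Z - i.+1%:Z) c = U - T.
  by apply: rpredD; [apply: UO; lia|apply: rpredN_submod; apply: TO; lia].
apply/eqP; rewrite eq_sym subr_eq -big_split; apply/eqP; apply: eq_bigr => r _.
rewrite -bincoef_pascal mulrDr scalerDl; congr (_ + _ *: rs _ _ _ _).
by lia.
Qed.

(** The Jacobi identity with l = 0 moves a past the residue of b. What remains is a residue of b, in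
    O(V), and residues of the modes a_i b, of weight p + q - i - 1, handled by [zhuO_derivative]. *)
Lemma zhuO_mull a y : y \in O -> zhu_mul a y \in O.
Proof.
elim/(homogeneous_ind (wt_grading V)): a => [|x x' IHx IHx' Oy|p a ap].
- by rewrite zhu_mul_0l rpred0.
- by rewrite zhu_mul_Dl rpredD ?IHx ?IHx'.
move: y; apply: zhuO_ind => [|x y Ox Oy|k x Ox|q q' t b c bq cq].
- by rewrite zhu_mul_0r rpred0.
- by rewrite zhu_mul_Dr rpredD.
- by rewrite zhu_mul_Zr rpredZ.
have [N0 /(_ N0.+1 (leqnSn _))] := @jacobi_res _ _ (adjoint V) a b c
  0 (-1) (- (t.+2)%:Z) (gm F p) (gm F q).
rewrite !(big_ord_recl N0) /=.
rewrite [X in _ + X - _]big1 => [|i _]; last by rewrite bincoef_0S scale0r.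
rewrite [X in _ - (_ + X)]big1 => [|i _]; last by rewrite bincoef_0S mulr0 scale0r.
have e0 (z : int) : z + 0%:Z = z by rewrite addr0.
have e1 (z : int) : z - 0%:Z = z by rewrite subr0.
rewrite ?e1 ?e0 bincoef0 expr0z mulr1 !scale1r !addr0.
rewrite -(zhu_mulE _ ap) => /eqP; rewrite subr_eq => /eqP->.
have RO i : \sum_(r < size (gm F p)) ((gm F p)`_r * bincoef F (i%:Z - (-1 + r%:Z) - 1) i) *:
    rs (vmode a (0 + i%:Z) b) (gm F q) (-1 - (t.+2)%:Z + r%:Z - i%:Z) c \in O.
  have [lt_i|le_i] := ltnP i (p + q).
    apply: (zhuO_derivative (k := (p + q - i.+1)%N)); [|lia|lia].
    by apply: wt_modeE ap bq _; lia.
  rewrite big1 ?rpred0 // => r _; rewrite (wt_mode_lt0 ap bq); last by lia.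
  by rewrite /res big1 ?scaler0 // => j _; rewrite wmode0 scaler0.
apply: rpredD; last by apply: zhuO_res bq _ _; lia.
by apply: rpredD; [exact: RO 0%N|apply: rpred_sum => i _; apply: (RO (bump 0 i))].
Qed.

Lemma zhu_welldefP : zhu_welldef V.
Proof.
split.
- exact: zhu_mul_linl.
- exact: zhu_mul_linr.
- by move=> x y; apply: zhuO_mulr.
- by move=> x y; apply: zhuO_mull.
- move=> x y z; elim/(homogeneous_ind (wt_grading V)): x => [|x x' IHx IHx'|p a ap].
  + by rewrite !zhu_mul_0l subr0 rpred0.
  + by rewrite !zhu_mul_Dl opprD addrACA rpredD.
  elim/(homogeneous_ind (wt_grading V)): y => [|y y' IHy IHy'|q b bq].
  + by rewrite !(zhu_mul_0l, zhu_mul_0r) subr0 rpred0.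
  + by rewrite !(zhu_mul_Dl, zhu_mul_Dr) opprD addrACA rpredD.
  have := zhu_mul_iterate_mod 0 z ap bq; rewrite -(zhu_mulE _ ap).
  by move/(rpredN_submod (W := O)); rewrite opprB.
- move=> x; rewrite (zhu_mulE _ (wt_vac V)) -[gm F 0]/('X^0 : {poly F}).
  by rewrite (@resXn _ _ (adjoint V)) [wmode _ _ _]vmode_vac subrr rpred0.
- move=> x; elim/(homogeneous_ind (wt_grading V)): x => [|x x' IHx IHx'|p a ap].
  + by rewrite zhu_mul_0l subr0 rpred0.
  + by rewrite zhu_mul_Dl opprD addrACA rpredD.
  rewrite (zhu_mulE _ ap) (res_vac 0 ap) big_ord_recl big_ord0 addr0 bin0 scale1r.
  by rewrite addr0 vmode_creation1 subrr rpred0.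
Qed.

End ZhuAlgebra.

(** * The level filtration *)

Section SymbolLinear.
Variables (F : fieldType) (A : algebra F) (Fl : nat -> submodClosed A).
Hypothesis HF : is_filtered Fl.

Lemma symb_linear n k a b : a \in Fl n -> b \in Fl n ->
  symb HF n (k *: a + b) = k *: symb HF n a + symb HF n b.
Proof.
move=> Fa Fb; rewrite -linearP; congr (proj _ _); apply: rees_ext => i.
rewrite -[subval (_ + _)]/(subval _ + subval _) fctE.
rewrite -[subval (_ *: _)]/(_ *: subval _) fctE !singleE ?rpredD ?rpredZ //.
by rewrite /single_seq; case: ifP; rewrite ?scaler0 ?addr0.
Qed.

Lemma symb_congr n a b : a \in Fl n -> b \in Fl n -> a - b \in Defs.prev Fl n ->
  symb HF n a = symb HF n b.
Proof.
move=> Fa Fb ab; apply: symb_proj => i; rewrite !singleE // /single_seq.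
by case: eqP => [->//|_]; rewrite subrr rpred0.
Qed.

Lemma gr_commutative :
  (forall p q a b, a \in Fl p -> b \in Fl q -> a * b - b * a \in Defs.prev Fl (p + q)) ->
  commutative_alg (gr HF).
Proof.
move=> comm x y; rewrite -[x]qreprK -[y]qreprK.
rewrite -[LHS](proj_mul (rees_descends HF)) -[RHS](proj_mul (rees_descends HF)).
move: (qrepr x) (qrepr y) => f g; apply: symb_proj => n /=.
(* Reversing the second convolution pairs f_i g_(n-i) with g_(n-i) f_i. *)
rewrite [X in _ - X]conv_rev -sumrB; apply: rpred_sum => i _.
have /asboolP[Ff _] := subvalP f; have /asboolP[Fg _] := subvalP g.
have := comm i (n - i)%N _ _ (Ff i) (Fg (n - i)%N).
by rewrite subnKC // -ltnS.
Qed.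
End SymbolLinear.

Section Level.
Variables (F : fieldType) (V : voa F) (H : zhu_welldef V).
Implicit Types (a b c u v x y : V).
Local Notation wts := (wt_space V).
Local Notation O := (zhuO V).
Local Notation rs := (res (M := adjoint V)).
Local Notation A := (zhu_algebra H).
Local Notation Fl := (level_filtration H).

Definition zcl v : A := proj O v.

Lemma zclD x y : zcl (x + y) = zcl x + zcl y. Proof. exact: projD. Qed.
Lemma zclZ k x : zcl (k *: x) = k *: zcl x. Proof. exact: proj_scale. Qed.
Lemma zcl0 : zcl 0 = 0. Proof. exact: (raddf0 (proj O)). Qed.
Lemma zclN x : zcl (- x) = - zcl x. Proof. exact: (raddfN (proj O)). Qed.
Lemma zcl_sum (I : Type) (r : seq I) (P : pred I) (f : I -> V) :
  zcl (\sum_(i <- r | P i) f i) = \sum_(i <- r | P i) zcl (f i).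
Proof. exact: (raddf_sum (proj O)). Qed.
Lemma zclM x y : zcl x * zcl y = zcl (zhu_mul x y).
Proof. exact/esym/(proj_mul H). Qed.
Lemma zclO x : x \in O -> zcl x = 0.
Proof. by move=> Ox; rewrite -zcl0; apply: projW; rewrite subr0. Qed.

Lemma zcl_level k n x : x \in wts k -> (k <= n)%N -> zcl x \in Fl n.
Proof.
move=> xk le_kn; apply/asboolP; exists (fun i => if i == k then x else 0), 0.
split=> [i||]; rewrite ?rpred0 //.
  by case: eqP => [->//|_]; apply: rpred0.
have lt_kn : (k < n.+1)%N by [].
rewrite addr0 (bigD1 (Ordinal lt_kn)) //= eqxx big1 ?addr0 // => i.
by rewrite -val_eqE /= => /negbTE->.
Qed.

Lemma zcl_prev k n x : x \in wts k -> (k < n)%N -> zcl x \in Defs.prev Fl n.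
Proof. by case: n => // n xk lt_kn; exact: (zcl_level (n := n) xk lt_kn). Qed.

Lemma levelE n (a : A) : a \in Fl n ->
  exists2 x : nat -> V, (forall i, x i \in wts i) & a = \sum_(i < n.+1) zcl (x i).
Proof.
move=> /asboolP[x [y [xP Oy ->]]]; exists x => //.
by rewrite -[LHS]/(zcl _) zclD (zclO Oy) addr0 zcl_sum.
Qed.

Lemma prev_incr m n (a : A) : (m <= n)%N -> a \in Defs.prev Fl m -> a \in Defs.prev Fl n.
Proof.
case: m => [|m] le_mn; first last.
  case: n le_mn => // n le_mn /levelE[x xP ->]; apply: rpred_sum => i _.
  by apply: (zcl_level (n := n) (xP i)); have := ltn_ord i; lia.
by move=> a0; suff -> : a = 0; [exact: rpred0|apply/eqP].
Qed.

Lemma zcl_mulE p u v : u \in wts p ->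
  zcl u * zcl v = \sum_(i < p.+1) 'C(p, i)%:R *: zcl (vmode u (-1 + i%:Z) v).
Proof.
move=> up; rewrite zclM (zhu_mulE _ up) (@res_widen _ _ (adjoint V) p.+1).
  by rewrite zcl_sum; apply: eq_bigr => i _; rewrite zclZ coef_gm.
by rewrite gmE size_poly.
Qed.

(** The remaining terms of the product are modes u_i v with i >= 0, of weight p + q - i - 1. *)
Lemma zcl_mul_lead p q u v : u \in wts p -> v \in wts q ->
  zcl u * zcl v - zcl (vmode u (-1) v) \in Defs.prev Fl (p + q).
Proof.
move=> up vq; rewrite (zcl_mulE _ up) big_ord_recl bin0 scale1r [- 1 + _]addr0.
rewrite [X in X - _]addrC addrK; apply: rpred_sum => i _; apply: rpredZ.
apply: (@zcl_prev (p + q - i.+1)).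
  by apply: wt_modeE up vq _; rewrite lift0; have := ltn_ord i; lia.
by have := ltn_ord i; lia.
Qed.

(** The residue against (1 + z)^p z^(-m-2) lies in O(V), which trades the mode for higher modes, of
    smaller weight. *)
Lemma zcl_mode_prev p q (m : nat) u v : u \in wts p -> v \in wts q ->
  zcl (vmode u (- (m.+2)%:Z) v) \in Defs.prev Fl (p + q + m.+1).
Proof.
move=> up vq.
have : rs u (gm F p) (- (m.+2)%:Z) v \in O by apply: zhuO_res up _ _ => //; lia.
move/zclO; rewrite (@res_widen _ _ (adjoint V) p.+1); last by rewrite gmE size_poly.
rewrite zcl_sum big_ord_recl coef_gm bin0 scale1r [- _ + _]addr0.
move/eqP; rewrite addr_eq0 => /eqP->; apply: rpredN_submod; apply: rpred_sum => i _.
rewrite zclZ; apply: rpredZ; apply: (@zcl_prev (p + q + m.+1 - i.+1)).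
  by apply: wt_modeE up vq _; rewrite lift0; have := ltn_ord i; lia.
by have := ltn_ord i; lia.
Qed.

(** Modulo O(V) the vector x_(-t-1) 1 is a combination of such vectors with smaller t, down to
    x_(-1) 1 = x: the weight grows with t, the level does not. *)
Lemma zcl_translate k (t : nat) x : x \in wts k ->
  zcl (vmode x (- (t.+1)%:Z) (vac V)) \in Fl k.
Proof.
move=> xk; have [n] := ubnP t; elim: n => // n IH in t *; rewrite ltnS => le_tn.
case: t le_tn => [|t] le_tn; first by rewrite vmode_creation1; apply: zcl_level xk _.
have : rs x (gm F k) (- (t.+2)%:Z) (vac V) \in O by apply: zhuO_res xk _ _ => //; lia.
move/zclO; rewrite (res_vac _ xk) zcl_sum big_ord_recl bin0 scale1r [- _ + _]addr0.
move/eqP; rewrite addr_eq0 => /eqP->; apply: rpredN_submod; apply: rpred_sum => i _.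
rewrite zclZ; apply: rpredZ.
have -> : - (t.+2)%:Z + (lift ord0 i)%:Z = - ((t - i).+1)%:Z.
  by rewrite lift0; have := ltn_ord i; lia.
by apply: IH; apply: leq_ltn_trans le_tn; rewrite leq_subr.
Qed.

(** The Jacobi identity on the vacuum, with l = 0 and m = n = -1, writes the difference through the
    vectors (u_i v)_(-i-2) 1, whose level is at most p + q - i - 1. *)
Lemma zcl_skew p q u v : u \in wts p -> v \in wts q ->
  zcl (vmode u (-1) v) - zcl (vmode v (-1) u) \in Defs.prev Fl (p + q).
Proof.
move=> up vq.
have [N0 /(_ N0.+1 (leqnSn _))] := @vmode_jacobi _ V u v (vac V) 0 (-1) (-1).
rewrite !(big_ord_recl N0) /=.
rewrite [X in _ + X - _]big1 => [|i _]; last by rewrite bincoef_0S scale0r.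
rewrite [X in _ - (_ + X)]big1 => [|i _]; last by rewrite bincoef_0S mulr0 scale0r.
rewrite -(big_ord_recl N0 (fun i : 'I_N0.+1 => bincoef F (i%:Z - -1 - 1) i *:
  vmode (vmode u (0 + i%:Z) v) (-1 + -1 - i%:Z) (vac V))).
have e0 (z : int) : z + 0%:Z = z by rewrite addr0.
have e1 (z : int) : z - 0%:Z = z by rewrite subr0.
rewrite ?e1 ?e0 bincoef0 expr0z mulr1 !scale1r !addr0 !vmode_creation1 -zclN -zclD => ->.
rewrite zcl_sum; apply: rpred_sum => i _; rewrite zclZ; apply: rpredZ.
have -> : -1 + -1 - i%:Z = - (i.+2)%:Z by lia.
have [lt_i|le_i] := ltnP i (p + q).
  have uv : vmode u (0 + i%:Z) v \in wts (p + q - i.+1) by apply: wt_modeE up vq _; lia.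
  have := zcl_translate i.+1 uv; move/levelE=> [x xP ->]; apply: rpred_sum => j _.
  by apply: (zcl_prev (xP j)); have := ltn_ord j; lia.
rewrite (wt_mode_lt0 up vq); last by lia.
by have -> : vmode (0 : V) (- (i.+2)%:Z) (vac V) = 0; rewrite ?zcl0 ?rpred0 //;
  exact: (@wmode0 _ _ (adjoint V)).
Qed.

Lemma level_comm p q (a b : A) : a \in Fl p -> b \in Fl q ->
  a * b - b * a \in Defs.prev Fl (p + q).
Proof.
move=> /levelE[x xP ->] /levelE[y yP ->].
rewrite mulr_suml [X in _ - X]mulr_sumr -sumrB; apply: rpred_sum => i _.
rewrite mulr_sumr mulr_suml -sumrB; apply: rpred_sum => j _.
apply: (@prev_incr (i + j)); first by have := ltn_ord i; have := ltn_ord j; lia.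
have h1 := zcl_mul_lead (xP i) (yP j); have h2 := zcl_mul_lead (yP j) (xP i).
have h3 := zcl_skew (xP i) (yP j); rewrite addnC in h2.
have := rpredD (rpredD h1 h3) (rpredN_submod h2).
by rewrite opprB subrKA subrKA.
Qed.

Lemma level_filtered : is_filtered Fl.
Proof.
split.
- move=> n a /levelE[x xP ->]; apply: rpred_sum => i _.
  by apply: (zcl_level (xP i)); apply: ltnW.
- exact: zcl_level (wt_vac V) _.
- move=> p q a b /levelE[x xP ->] /levelE[y yP ->].
  rewrite mulr_suml; apply: rpred_sum => i _; rewrite mulr_sumr; apply: rpred_sum => j _.
  rewrite (zcl_mulE _ (xP i)); apply: rpred_sum => k _; apply: rpredZ.
  apply: (@zcl_level (i + j - k)); last by have := ltn_ord i; have := ltn_ord j; lia.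
  by apply: wt_modeE (xP i) (yP j) _; have := ltn_ord k; lia.
- move=> a; rewrite -[a]qreprK -[proj _ _]/(zcl _); move: (qrepr a) => x.
  have [[N c] /= [cP ->]] := grading_span (wt_grading V) x.
  exists N; rewrite zcl_sum; apply: rpred_sum => i _.
  by apply: (zcl_level (cP i)); apply: ltnW.
Qed.

End Level.

Lemma homogeneous_span (R : pzRingType) (X : lmodType R) (G : nat -> submodClosed X)
    (s : seq X) : is_grading G ->
  exists2 g : seq (nat * X), (forall p, p \in g -> p.2 \in G p.1) &
    forall x, x \in s -> x \in span_sub (fun y => exists2 p, p \in g & y = p.2).
Proof.
move=> HG; elim: s => [|x s [g gG sg]]; first by exists [::].
have [[N c] /= [cG ->]] := grading_span HG x.
exists ([seq (i, c i) | i <- iota 0 N] ++ g).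
  by move=> p; rewrite mem_cat => /orP[/mapP[i _ ->]|/gG //]; apply: cG.
move=> y; rewrite inE => /orP[/eqP->|/sg].
  apply: rpred_sum => i _; apply: span_sub_gen; exists (val i, c i) => //.
  by rewrite mem_cat map_f // mem_iota add0n ltn_ord.
apply: span_sub_min => _ [p pg ->]; apply: span_sub_gen; exists p => //.
by rewrite mem_cat pg orbT.
Qed.

Section Generation.
Variables (F : fieldType) (V : voa F) (H : zhu_welldef V).
Implicit Types (a b c u v x y : V).
Local Notation wts := (wt_space V).
Local Notation Fl := (level_filtration H).
Local Notation HF := (level_filtered H).
Local Notation cl := (zcl H).

Section Subalgebra.
Variables (B : submodClosed (gr HF)) (BM : mulr_closed B).
Variable g : seq (nat * V).
Hypothesis gV : forall p, p \in g -> p.2 \in wts p.1.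
Hypothesis gB : forall p, p \in g -> symb HF p.1 (cl p.2) \in B.

Definition good n v : Prop := v \in wts n /\ symb HF n (cl v) \in B.

Lemma goodZD n k u v : good n u -> good n v -> good n (k *: u + v).
Proof.
move=> [un Bu] [vn Bv]; split; first by rewrite rpredD ?rpredZ.
by rewrite zclD zclZ symb_linear ?(zcl_level _ un) ?(zcl_level _ vn) // rpredD ?rpredZ.
Qed.

Lemma good_prev n v : v \in wts n -> cl v \in Defs.prev Fl n -> good n v.
Proof.
move=> vn pv; split=> //.
have -> : symb HF n (cl v) = symb HF n 0.
  by apply: symb_congr; rewrite ?subr0 ?rpred0 ?(zcl_level _ vn).
have -> : symb HF n 0 = 0; last exact: rpred0.
have := symb_linear HF 1 (rpred0 (Fl n)) (rpred0 (Fl n)).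
by rewrite !scale1r !addr0 => e; apply: (addrI (symb HF n 0)); rewrite -e addr0.
Qed.

(** For m = 1 the symbol is the product of the two symbols; for m >= 2 the class drops in level and
    its symbol is zero. *)
Lemma good_mode p k (m : nat) u v : (1 <= m)%N -> (p, u) \in g -> good k v ->
  good (p + k + m.-1) (vmode u (- m%:Z) v).
Proof.
move=> m1 ug [vk Bv]; have up : u \in wts p := gV ug.
have uvw : vmode u (- m%:Z) v \in wts (p + k + m.-1) by apply: wt_modeE up vk _; lia.
case: m m1 uvw => // -[|m] _ uvw; last by apply: good_prev => //; apply: zcl_mode_prev up vk.
split=> //; rewrite addn0.
have <- : symb HF p (cl u) * symb HF k (cl v) = symb HF (p + k) (cl (vmode u (- 1%:Z) v)).
  rewrite symbM ?(zcl_level _ up) ?(zcl_level _ vk) //.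
  apply: symb_congr; last exact: zcl_mul_lead up vk.
    by apply: (filt_mul HF); [apply: zcl_level up _|apply: zcl_level vk _].
  by apply: zcl_level uvw _; rewrite addn0.
by case: BM => _; apply=> //; apply: gB (p, u) ug.
Qed.

(** The projection onto weight n fixes v and sends each good vector to itself or to 0. *)
Lemma good_homogeneous n v : v \in wts n ->
  v \in span_sub (fun y => exists k, good k y) -> good n v.
Proof.
pose pi (k : nat) x := if k == n then x else 0.
have pi_lin k : linear (pi k).
  by move=> a x y; rewrite /pi; case: eqP => // _; rewrite scaler0 addr0.
have piD k x y : pi k (x + y) = pi k x + pi k y.
  by have := pi_lin k 1 x y; rewrite !scale1r.
have good0 : good n 0 by apply: good_prev; rewrite ?zcl0 rpred0.
move=> vn vS; have -> : v = homext (wt_grading V) pi v by rewrite (homextE _ piD vn) /pi eqxx.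
elim/span_ind: v / vS {vn} => [|x y gx gy|a x gx|x [k gx]].
- by rewrite homext0.
- by rewrite homextD // -[X in X + _]scale1r; apply: goodZD.
- have := homext_linear (wt_grading V) pi_lin a x 0; rewrite addr0 => ->.
  by rewrite homext0 //; apply: goodZD.
rewrite (homextE _ piD (proj1 gx)) /pi.
by case: eqP => [<-|].
Qed.

Lemma symb_in_subalgebra :
  (forall v, v \in span_sub (fun y => exists k, good k y)) -> forall z : gr HF, z \in B.
Proof.
move=> all_good z; have [f Ff [N ->]] := gr_symb_sum z.
apply: rpred_sum => n _; have [c cP fE] := levelE (Ff n).
have [cn Bn] := good_homogeneous (cP n) (all_good (c n)).
(* An element of level n has the same symbol as its part of weight n. *)
rewrite (symb_congr HF (Ff n) (zcl_level H (cP n) (leqnn n))) //.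
rewrite fE big_ord_recr addrK; apply: rpred_sum => i _.
exact: zcl_prev (cP i) (ltn_ord i).
Qed.

End Subalgebra.

(** The strong generators are replaced by their homogeneous components; induction on the length of a
    word of modes shows that it is a combination of good vectors. *)
Lemma gr_zhu_fin_gen : strongly_fin_gen V -> fin_gen_alg (gr HF).
Proof.
move=> [U [s sU] Vgen].
have [g gV sg] := homogeneous_span s (wt_grading V).
exists [seq symb HF p.1 (cl p.2) | p <- g] => B BM gB.
have {}gB p : p \in g -> symb HF p.1 (cl p.2) \in B by move=> pg; apply/gB/map_f.
apply: symb_in_subalgebra => v.
set W := span_sub _.
have /span_subP := Vgen v; apply: span_sub_min => _ [t tU ->].
elim: t tU => [|[u m] t IH] tU /=.
  apply: span_sub_gen; exists 0%N; split; first exact: wt_vac.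
  have -> : cl (vac V) = 1 by [].
  by rewrite symb1; case: BM.
have [/= uU m1] := tU (u, m) (mem_head _ _).
have {}IH : foldr (fun p y => vmode p.1 (- p.2%:Z) y) (vac V) t \in W.
  by apply: IH => p pt; apply: tU; rewrite inE pt orbT.
move: (foldr _ _ _) IH => y yW.
have : u \in span_sub (fun y => exists2 p, p \in g & y = p.2).
  have /sU/span_subP := uU; apply: span_sub_min => x; exact: sg.
elim/span_ind: u / {tU uU} => [|u u' Wu Wu'|k u Wu|_ [[p u] pg ->]].
- by rewrite [vmode _ _ _](@wmode0 _ _ (adjoint V)) rpred0.
- by rewrite [vmode _ _ _](@wmodeD _ _ (adjoint V)) rpredD.
- by rewrite [vmode _ _ _](@wmodeZ _ _ (adjoint V)) rpredZ.
elim/span_ind: y / yW => [|x x' Wx Wx'|k x Wx|x [k gx]].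
- by rewrite [vmode _ _ _](@wmode_r0 _ _ (adjoint V)) rpred0.
- by rewrite [vmode _ _ _](@wmode_rD _ _ (adjoint V)) rpredD.
- by rewrite [vmode _ _ _](@wmode_rZ _ _ (adjoint V)) rpredZ.
apply: span_sub_gen; exists (p + k + m.-1)%N.
exact: (good_mode BM gV gB m1 pg gx).
Qed.

End Generation.

(** * Irreducible admissible modules *)

Section Component.
Variables (R : pzRingType) (X : lmodType R) (G : nat -> submodClosed X).
Hypothesis HG : is_grading G.

Definition component (j : nat) : X -> X := homext HG (fun (k : nat) x => if k == j then x else 0).

Let proj_lin (j k : nat) : linear (fun x : X => if k == j then x else 0).
Proof. by move=> a x y /=; case: eqP => // _; rewrite scaler0 addr0. Qed.

Lemma component_linear j : linear (component j).
Proof. exact: (homext_linear HG (proj_lin j)). Qed.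

Lemma componentE j k x : x \in G k -> component j x = if k == j then x else 0.
Proof.
move=> xk; rewrite /component (homextE HG _ xk) // => n y z.
by case: eqP => // _; rewrite addr0.
Qed.

Lemma componentD j x y : component j (x + y) = component j x + component j y.
Proof. by have := component_linear j 1 x y; rewrite !scale1r. Qed.

Lemma component0 j : component j 0 = 0.
Proof. by apply: (addrI (component j 0)); rewrite -componentD !addr0. Qed.

Lemma componentZ j a x : component j (a *: x) = a *: component j x.
Proof. by have := component_linear j a x 0; rewrite component0 !addr0. Qed.

Lemma component_in j x : component j x \in G j.
Proof.
elim/(homogeneous_ind HG): x => [|x y Gx Gy|k x Gx].
- by rewrite component0 rpred0.
- by rewrite componentD rpredD.
by rewrite (componentE _ Gx); case: eqP => [<-|_] //; apply: rpred0.
Qed.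

Lemma component_sum x : exists N, x = \sum_(i < N) component i x.
Proof.
have [[N c] /= [cG xE]] := grading_span HG x; exists N.
rewrite {1}xE; apply: eq_bigr => i _; rewrite xE /component homext_sum //.
  rewrite (bigD1 i) //= eqxx big1 ?addr0 // => j.
  by rewrite -val_eqE => /negbTE->.
by move=> n y z; case: eqP => // _; rewrite addr0.
Qed.
End Component.

Section ModeSpan.
Variables (F : fieldType) (V : vertex_algebra F) (M : weak_module V).
Implicit Types (u v : V) (w : M).

Definition mode_span (T : M -> Prop) : submodClosed M :=
  span_sub (fun y => exists u n w, T w /\ y = wmode u n w).

Lemma mode_span_gen (T : M -> Prop) u n w : T w -> wmode u n w \in mode_span T.
Proof. by move=> Tw; apply: span_sub_gen; exists u, n, w. Qed.

Lemma mode_span_sub (T : M -> Prop) w : T w -> w \in mode_span T.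
Proof.
by move=> Tw; have := mode_span_gen (vac V) (-1) Tw; rewrite wmode_vac.
Qed.

(* The terms with u_(m+i) w in the Jacobi identity drop out for large m, and
   v_q w = 0 for large q starts a downward induction on q. *)
Lemma mode_span_closed (T : M -> Prop) u (p : int) w :
  w \in mode_span T -> wmode u p w \in mode_span T.
Proof.
move: w; apply: span_ind => [|x y Wx Wy|a x Wx|_ [v [q [w [Tw ->]]]]].
- by rewrite wmode_r0 rpred0.
- by rewrite wmode_rD rpredD.
- by rewrite wmode_rZ rpredZ.
have [m um] := wmode_trunc u w; have [K vK] := wmode_trunc v w.
suff H (d : nat) : forall p q : int, K - d%:Z <= q -> wmode u p (wmode v q w) \in mode_span T.
  by apply: (H (absz (K - q))); lia.
elim: d => [|d IH] {}p {}q le_q; first by rewrite vK ?wmode_r0 ?rpred0 //; lia.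
have [N0 /(_ N0.+1 (leqnSn _))] := @wmode_jacobi _ V M u v w (p - m) m q.
rewrite [X in X - _](big_ord_recl N0) [X in _ - X]big1 => [|i _]; last first.
  by rewrite um ?wmode_r0 ?scaler0 //; lia.
rewrite subr0 bincoef0 scale1r.
have -> : m + (p - m) - (@ord0 N0)%:Z = p by rewrite subr0; ring.
have -> : q + (@ord0 N0)%:Z = q by rewrite addr0.
move/(canRL (addrK _)) ->.
apply: rpredD.
  by apply: rpred_sum => i _; apply: rpredZ; apply: mode_span_gen.
apply: rpredN_submod; apply: rpred_sum => i _; apply: rpredZ; apply: IH.
by rewrite lift0; lia.
Qed.

End ModeSpan.

Section PairModule.
Variables (F : fieldType) (V : vertex_algebra F) (M : weak_module V).

Definition pair_mode (u : V) (n : int) (w : M * M) : M * M :=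
  (wmode u n w.1, wmode u n w.2).

Lemma pair_mode_linl n w : linear (fun u => pair_mode u n w).
Proof. by move=> a u u'; rewrite /pair_mode !wmode_linl. Qed.
Lemma pair_mode_linr u n : linear (pair_mode u n).
Proof. by move=> a w w'; rewrite /pair_mode !wmode_linr. Qed.
Lemma pair_mode_trunc u w : exists N : int, forall n, N <= n -> pair_mode u n w = 0.
Proof.
have [N1 t1] := wmode_trunc u w.1; have [N2 t2] := wmode_trunc u w.2.
exists (Num.max N1 N2) => n; rewrite ge_max => /andP[le1 le2].
by rewrite /pair_mode t1 ?t2.
Qed.
Lemma pair_mode_vac n w : pair_mode (vac V) n w = if n == -1 then w else 0.
Proof. by rewrite /pair_mode !wmode_vac; case: eqP; case: w. Qed.
Lemma pair_mode_jacobi : jacobi (@vmode F V) pair_mode.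
Proof.
move=> u v w l m n.
have [N1 j1] := @wmode_jacobi _ V M u v w.1 l m n.
have [N2 j2] := @wmode_jacobi _ V M u v w.2 l m n.
exists (maxn N1 N2) => N; rewrite geq_max => /andP[/j1 {}j1 /j2 {}j2].
rewrite [LHS]surjective_pairing [RHS]surjective_pairing.
congr (_, _).
  by rewrite /= !(raddf_sum (@fst M M)) /= -j1.
by rewrite /= !(raddf_sum (@snd M M)) /= -j2.
Qed.

Definition pair_module : weak_module V :=
  @WeakModule F V (M * M)%type pair_mode pair_mode_linl pair_mode_linr pair_mode_trunc
    pair_mode_vac pair_mode_jacobi.
End PairModule.

Section Admissible.
Variables (F : fieldType) (V : voa F) (M : admissible_module V).
Implicit Types (u v : V) (w x y : M).
Local Notation wts := (wt_space V).
Local Notation deg := (deg_space M).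
Local Notation comp := (component (deg_grading M)).

Lemma deg_modeE s t (n : int) k u w : u \in wts s -> w \in deg t ->
  s%:Z + t%:Z - n - 1 = k%:Z -> wmode u n w \in deg k.
Proof. by move=> us wt e; have := deg_mode n us wt; rewrite e. Qed.

Lemma deg_mode_lt0 s t (n : int) u w : u \in wts s -> w \in deg t ->
  s%:Z + t%:Z - n - 1 < 0 -> wmode u n w = 0.
Proof.
move=> us wt; have := deg_mode n us wt; case: (_ - 1) => //= k.
by rewrite unfold_in => /eqP.
Qed.

Lemma component_mode s (n : int) i j u w : u \in wts s ->
  s%:Z + i%:Z - n - 1 = j%:Z -> comp j (wmode u n w) = wmode u n (comp i w).
Proof.
move=> us e; elim/(homogeneous_ind (deg_grading M)): w => [|x y IHx IHy|k x xk].
- by rewrite !(wmode_r0, component0).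
- by rewrite !(wmode_rD, componentD) IHx IHy.
rewrite (componentE _ _ xk); case: eqP => [k_i|ne_ki].
  rewrite (componentE _ _ (k := j)) ?eqxx //.
  by rewrite k_i in xk; apply: deg_modeE us xk e.
rewrite wmode_r0; have [lt0|ge0] := ltP (s%:Z + k%:Z - n - 1) 0.
  by rewrite (deg_mode_lt0 us xk lt0) component0.
rewrite (componentE _ _ (k := absz (s%:Z + k%:Z - n - 1)%R)); last first.
  by apply: deg_modeE us xk _; lia.
by case: eqP => // e'; case: ne_ki; lia.
Qed.

Lemma mode_span_component (T : M -> Prop) : (forall w, T w -> exists k, w \in deg k) ->
  forall x, x \in mode_span T -> forall j, comp j x \in mode_span T.
Proof.
move=> Thom; apply: span_ind => [|x y Wx Wy|a x Wx|_ [u [n [w [Tw ->]]]]] j.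
- by rewrite component0 rpred0.
- by rewrite componentD rpredD.
- by rewrite componentZ rpredZ.
have [k wk] := Thom w Tw.
elim/(homogeneous_ind (wt_grading V)): u => [|u u' IHu IHu'|s u us].
- by rewrite wmode0 component0 rpred0.
- by rewrite wmodeD componentD rpredD.
have [i0|i1] := ltP (j%:Z + n + 1 - s%:Z) 0.
  have [lt0|ge0] := ltP (s%:Z + k%:Z - n - 1) 0.
    by rewrite (deg_mode_lt0 us wk lt0) component0 rpred0.
  rewrite (componentE _ _ (k := absz (s%:Z + k%:Z - n - 1)%R)); last first.
    by apply: deg_modeE us wk _; lia.
  by case: eqP => [e|_]; [lia|apply: rpred0].
rewrite (component_mode (i := absz (j%:Z + n + 1 - s%:Z)%R) _ us); last by lia.
rewrite (componentE _ _ wk); case: eqP => _; last by rewrite wmode_r0 rpred0.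
exact: mode_span_gen.
Qed.

Lemma graded_submodule (N : submodClosed M) :
  (forall u n w, w \in N -> wmode u n w \in N) ->
  (forall w, w \in N -> forall j, comp j w \in N) -> admissible_submodule N.
Proof.
move=> Nm Nc; split=> // w Nw.
have [K wE] := component_sum (deg_grading M) w.
exists (K, fun i => comp i w); split=> // i; split; last exact: Nc.
exact: component_in.
Qed.

Lemma mode_span_admissible (T : M -> Prop) : (forall w, T w -> exists k, w \in deg k) ->
  admissible_submodule (mode_span T).
Proof.
move=> Thom; apply: graded_submodule; last exact: mode_span_component.
by move=> u n w; apply: mode_span_closed.
Qed.

Lemma zero_modeE p u w : u \in wts p -> zero_mode u w = wmode u (p%:Z - 1) w.
Proof.
move=> up; rewrite /zero_mode (homextE _ _ up) // => n x y; exact: wmodeD.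
Qed.

Lemma zero_mode_linl w : linear (fun u => zero_mode u w).
Proof. by apply: homext_linear => n a u u'; apply: wmode_linl. Qed.

Lemma zero_mode_Dl u u' w : zero_mode (u + u') w = zero_mode u w + zero_mode u' w.
Proof. by have := zero_mode_linl w 1 u u'; rewrite !scale1r. Qed.
Lemma zero_mode_0l w : zero_mode 0 w = 0.
Proof. by apply: (addrI (zero_mode 0 w)); rewrite -zero_mode_Dl !addr0. Qed.
Lemma zero_mode_Zl k u w : zero_mode (k *: u) w = k *: zero_mode u w.
Proof. by have := zero_mode_linl w k u 0; rewrite zero_mode_0l !addr0. Qed.

(* Any linear map commuting with the modes commutes with o(u), whatever the
   decomposition of u chosen by [homext]. *)
Lemma zero_mode_morph (f : M -> M) u w :
  (forall x y, f (x + y) = f x + f y) -> (forall u n w, f (wmode u n w) = wmode u n (f w)) ->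
  f (zero_mode u w) = zero_mode u (f w).
Proof.
move=> fD fm; rewrite /zero_mode /homext; set c := sval _.
rewrite (big_morph f fD (id1 := 0)); last first.
  by apply: (addrI (f 0)); rewrite -fD !addr0.
by apply: eq_bigr => i _.
Qed.

Lemma zero_mode_linr u : linear (zero_mode (M := M) u).
Proof.
move=> a w w'; elim/(homogeneous_ind (wt_grading V)): u => [|u u' IHu IHu'|p u up].
- by rewrite !zero_mode_0l scaler0 addr0.
- by rewrite !zero_mode_Dl IHu IHu' scalerDr addrACA.
by rewrite !(zero_modeE _ up) wmode_linr.
Qed.

Lemma zero_mode_0r u : zero_mode u (0 : M) = 0.
Proof. by have := zero_mode_linr u (-1) 0 0; rewrite addr0 scaler0 scaleN1r addNr. Qed.

(** With m = p and n = q + t - 1 the modes a_(m+i) and b_(n+i) lower the degree and kill M(0),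
    except b_n when t = 0. So t > 0 shows that O(V) acts by zero, and t = 0 that the action is
    multiplicative. *)
Lemma zero_mode_iterate p q (t : nat) a b w : a \in wts p -> b \in wts q -> w \in deg 0 ->
  zero_mode (res (M := adjoint V) a (gm F p) (- (t.+1)%:Z) b) w =
  if t is 0%N then zero_mode a (zero_mode b w) else 0.
Proof.
move=> ap bq w_top.
have [N0 /(_ (maxn N0 p.+1) (leq_maxl _ _))] := @wmode_jacobi _ V M a b w
  (- (t.+1)%:Z) p%:Z (q%:Z + t%:Z - 1).
have := leq_maxr N0 p.+1; move: (maxn _ _) => N lt_pN.
rewrite [X in _ - X]big1 => [|i _]; last first.
  by rewrite (deg_mode_lt0 ap w_top) ?wmode_r0 ?scaler0 //; lia.
rewrite subr0 => e.
transitivity (\sum_(i < N) 'C(p, i)%:R *: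
    zero_mode (vmode a (- (t.+1)%:Z + i%:Z) b) w).
  rewrite (@res_widen _ _ (adjoint V) N) ?gmE; last first.
    by apply: leq_trans (size_poly _ _) lt_pN.
  rewrite -gmE; transitivity (\sum_(i < N) zero_mode
      ((gm F p)`_i *: (vmode a (- (t.+1)%:Z + i%:Z) b)) w).
    exact: (big_morph (fun u => zero_mode u w) (fun u v => zero_mode_Dl u v w)
      (zero_mode_0l w)).
  by apply: eq_bigr => i _; rewrite zero_mode_Zl coef_gm.
transitivity (\sum_(i < N) bincoef F (i%:Z - p%:Z - 1) i *:
    wmode (vmode a (- (t.+1)%:Z + i%:Z) b) (p%:Z + (q%:Z + t%:Z - 1) - i%:Z) w).
  apply: eq_bigr => i _; rewrite bincoef_nat.
  have [le_ip|lt_pi] := leqP i p; last by rewrite bin_small ?scale0r.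
  rewrite (zero_modeE (p := (p + q + t - i)%N)); last by apply: wt_modeE ap bq _; lia.
  by congr (_ *: wmode _ _ _); lia.
rewrite -e; case: N lt_pN {e} => // N _; rewrite big_ord_recl big1 ?addr0.
  rewrite bincoef0 scale1r; case: t => [|t].
    rewrite (zero_modeE _ bq) (zero_modeE _ ap).
    by congr (wmode _ _ (wmode _ _ _)); rewrite /=; lia.
  by rewrite (deg_mode_lt0 bq w_top) ?wmode_r0 //=; lia.
move=> i _; rewrite (deg_mode_lt0 bq w_top) ?wmode_r0 ?scaler0 // lift0; lia.
Qed.

Lemma top_welldefP : top_welldef M.
Proof.
have ext (x y : top_space M) : subval x = subval y -> x = y by move=> e; apply: val_inj.
split.
- by move=> w a u u'; apply: ext; apply: zero_mode_linl.
- by move=> u a w w'; apply: ext; apply: zero_mode_linr.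
- move=> x w Ox; apply: ext => /=; move: x Ox; apply: zhuO_ind.
  + exact: zero_mode_0l.
  + by move=> x y ex ey; rewrite zero_mode_Dl ex ey addr0.
  + by move=> k x ex; rewrite zero_mode_Zl ex scaler0.
  + by move=> p q t a b ap bq; rewrite (zero_mode_iterate t.+1 ap bq (subvalP w)).
- move=> x y w; apply: ext => /=.
  elim/(homogeneous_ind (wt_grading V)): x => [|x x' IHx IHx'|p x xp].
  + by rewrite zhu_mul_0l !zero_mode_0l.
  + by rewrite zhu_mul_Dl !zero_mode_Dl IHx IHx'.
  elim/(homogeneous_ind (wt_grading V)): y => [|y y' IHy IHy'|q y yq].
  + by rewrite zhu_mul_0r !zero_mode_0l zero_mode_0r.
  + rewrite zhu_mul_Dr !zero_mode_Dl IHy IHy'.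
    by have := zero_mode_linr x 1 (zero_mode y (subval w)) (zero_mode y' (subval w));
       rewrite !scale1r.
  by rewrite (zhu_mulE _ xp) (zero_mode_iterate 0 xp yq (subvalP w)).
- by move=> w; apply: ext => /=; rewrite (zero_modeE _ (wt_vac V)) wmode_vac.
Qed.

Hypothesis irrM : irreducible M.
Variable w0 : M.
Hypotheses (w0M : w0 \in deg 0) (w0_neq0 : w0 != 0).

Lemma irreducible_mode_span (T : M -> Prop) (w : M) :
  (forall w, T w -> exists k, w \in deg k) -> T w -> w != 0 ->
  forall x, x \in mode_span T.
Proof.
move=> Thom Tw w_neq0; have [_ /(_ _ (mode_span_admissible Thom))] := irrM.
by case=> // T0; case/eqP: w_neq0; apply: T0; apply: mode_span_sub.
Qed.

(* A component of positive degree killed by all these modes would generate a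
   submodule without degree 0 part. *)
Lemma top_of_lowest y :
  (forall s u (n : int), u \in wts s -> s%:Z <= n -> wmode u n y = 0) -> y \in deg 0.
Proof.
move=> low; have [N yE] := component_sum (deg_grading M) y.
have y0 i : (0 < i)%N -> comp i y = 0.
  move=> i0; apply/eqP/negPn/negP => ci.
  have ci_in := component_in (deg_grading M) i y.
  have lowi s u (n : int) : u \in wts s -> s%:Z <= n -> wmode u n (comp i y) = 0.
    move=> us le_n; have [lt0|ge0] := ltP (s%:Z + i%:Z - n - 1) 0.
      exact: deg_mode_lt0 us ci_in lt0.
    rewrite -(component_mode (j := absz (s%:Z + i%:Z - n - 1)%R) _ us); last by lia.
    by rewrite (low s) // component0.
  have := @irreducible_mode_span (fun w => w = comp i y) (comp i y) _ erefl ci w0.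
  move=> /(_ _)W; have {W} : w0 \in mode_span (fun w => w = comp i y).
    by apply: W => w ->; exists i.
  suff c0 x : x \in mode_span (fun w => w = comp i y) -> comp 0 x = 0.
    by move/c0; rewrite (componentE _ _ w0M) eqxx; apply/eqP.
  move: x; apply: span_ind => [|x x' Wx Wx'|a x Wx|_ [u [n [w [-> ->]]]]].
  - exact: component0.
  - by rewrite componentD Wx Wx' addr0.
  - by rewrite componentZ Wx scaler0.
  elim/(homogeneous_ind (wt_grading V)): u => [|u u' IHu IHu'|s u us].
  - by rewrite wmode0 component0.
  - by rewrite wmodeD componentD IHu IHu' addr0.
  have [le_sn|lt_ns] := leP s%:Z n; first by rewrite (lowi s u n us le_sn) component0.
  rewrite (componentE _ _ (k := absz (s%:Z + i%:Z - n - 1)%R)).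
    by case: eqP => // e; lia.
  by apply: deg_modeE us ci_in _; lia.
rewrite yE; case: N {yE} => [|N]; first by rewrite big_ord0 rpred0.
rewrite big_ord_recl big1 ?addr0; first exact: component_in.
by move=> i _; apply: y0.
Qed.

End Admissible.

Section EndVFacts.
Variables (F : fieldType) (V : vertex_algebra F) (M : weak_module V).
Let op (p : V * int) : {linear M -> M} := mode_op p.

Definition EndVfun (f : EndV M) : M -> M := cfun (f : commutant op).

Lemma EndV_linear f : linear (EndVfun f).
Proof. exact: commutant_lin. Qed.

Lemma EndV_mode f u n w : EndVfun f (wmode u n w) = wmode u n (EndVfun f w).
Proof. by case/asboolP: (cfunP (f : commutant op)) => _ /(_ (u, n) w). Qed.

Lemma EndVD f x y : EndVfun f (x + y) = EndVfun f x + EndVfun f y.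
Proof. by have := EndV_linear f 1 x y; rewrite !scale1r. Qed.

Lemma EndV_of (f : M -> M) : linear f -> (forall u n w, f (wmode u n w) = wmode u n (f w)) ->
  exists e : EndV M, EndVfun e =1 f.
Proof.
move=> fl fm; have fP : f \in commutes_pred op.
  by apply/asboolP; split=> // -[u n] x; apply: fm.
by exists (Commutant fP : EndV M).
Qed.

Lemma EndV_ext (f g : EndV M) : EndVfun f =1 EndVfun g -> f = g.
Proof. exact: (@commutant_ext _ _ _ op). Qed.
End EndVFacts.

Section TopModule.
Variables (F : fieldType) (V : voa F) (M : admissible_module V).
Variables (H : zhu_welldef V) (HM : top_welldef M).
Local Notation S := (top_module H HM).
Local Notation A := (zhu_algebra H).
Let op (a : A) : {linear restr S -> restr S} := actA a.

(** The scalars acting through A(V) agree with those of the subspace M(0), as the vacuum acts by the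
    identity. *)
Lemma restr_scaleE (c : F) (x : top_space M) :
  c *: (x : restr S) = (c *: x : top_space M).
Proof.
rewrite -[LHS]/(quot_act (c *: proj (zhuO V) (vac V) : quotalg H) (x : quotmod H HM)).
have -> : c *: proj (zhuO V) (vac V) = proj (zhuO V) (c *: vac V) :> quotalg H.
  exact/esym/(proj_scale (zhuO V)).
rewrite proj_act.
have := adesc_linl HM x c (vac V) 0; rewrite addr0 => ->.
have -> : top_act 0 x = 0 by apply: val_inj; exact: zero_mode_0l.
by rewrite addr0 (adesc_unit HM).
Qed.

Lemma EndA_top_linear (g : EndA S) : linear (endfun g : top_space M -> top_space M).
Proof.
by move=> c x y; rewrite -!restr_scaleE; apply: (commutant_lin (g : commutant op)).
Qed.

Lemma EndA_top_act (g : EndA S) u (x : top_space M) :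
  endfun g (top_act u x) = top_act u (endfun g x).
Proof.
have := endfun_comm g (proj (zhuO V) u : A) (x : S).
rewrite -[_ *: (x : S)]/(quot_act _ (x : quotmod H HM)) proj_act => ->.
exact: proj_act.
Qed.

Lemma EndA_top_of (g : top_space M -> top_space M) : linear g ->
  (forall u x, g (top_act u x) = top_act u (g x)) -> exists e : EndA S, endfun e =1 g.
Proof.
move=> gl gact; have gP : (g : restr S -> restr S) \in commutes_pred op.
  apply/asboolP; split=> [c x y|a x]; last exact: gact.
  by rewrite !restr_scaleE; apply: gl.
by exists (Commutant gP : EndA S).
Qed.

End TopModule.

(** * Restriction of endomorphisms to M(0) and their extension to M *)

Section Restriction.
Variables (F : fieldType) (V : voa F) (M : admissible_module V).
Local Notation deg := (deg_space M).
Local Notation comp := (component (deg_grading M)).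
Hypothesis irrM : irreducible M.
Variable w0 : M.
Hypotheses (w0M : w0 \in deg 0) (w0_neq0 : w0 != 0).

Let topT (w : M) : Prop := w \in deg 0.
Let topT_hom w : topT w -> exists k, w \in deg k.
Proof. by exists 0%N. Qed.

Lemma top_generates x : x \in mode_span topT.
Proof. exact: (irreducible_mode_span irrM topT_hom w0M w0_neq0). Qed.

(** The modes that lower the degree kill w, hence also its image. *)
Lemma EndV_top (f : EndV M) w : w \in deg 0 -> EndVfun f w \in deg 0.
Proof.
move=> w_top; apply: (top_of_lowest irrM w0M w0_neq0) => s u n us le_n.
rewrite -EndV_mode (deg_mode_lt0 us w_top); last by lia.
by apply: (addrI (EndVfun f 0)); rewrite -EndVD !addr0.
Qed.

Definition restrict (f : EndV M) (w : top_space M) : top_space M :=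
  Submodule (EndV_top f (subvalP w)).

Lemma restrict_inj (f g : EndV M) : restrict f =1 restrict g -> f = g.
Proof.
move=> fg; apply: EndV_ext => x; move: (top_generates x).
have f0 (h : EndV M) : EndVfun h 0 = 0.
  by apply: (addrI (EndVfun h 0)); rewrite -EndVD !addr0.
move: x; apply: span_ind => [|x y ex ey|a x ex|_ [u [n [w [w_top ->]]]]].
- by rewrite !f0.
- by rewrite !EndVD ex ey.
- have := EndV_linear f a x 0; have := EndV_linear g a x 0.
  by rewrite !addr0 !f0 !addr0 ex => -> ->.
rewrite !EndV_mode; congr (wmode _ _ _).
by have := congr1 (fun z => subval z) (fg (Submodule w_top)).
Qed.

Lemma component_top_mode j s (n : int) u w : u \in wt_space V s -> w \in deg 0 ->
  comp j (wmode u n w) = if s%:Z - n - 1 == j%:Z then wmode u n w else 0.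
Proof.
move=> us w_top; case: eqP => [e|ne].
  by rewrite (component_mode (i := 0%N) _ us) ?(componentE _ _ w_top) ?addr0.
have [lt0|ge0] := ltP (s%:Z + 0%:Z - n - 1) 0.
  by rewrite (deg_mode_lt0 us w_top lt0) component0.
rewrite (componentE _ _ (k := absz (s%:Z + 0%:Z - n - 1)%R)); last first.
  by apply: deg_modeE us w_top _; lia.
by case: eqP => // e; case: ne; lia.
Qed.

Section Extension.
Variable g : top_space M -> top_space M.
Hypothesis g_linear : linear g.
Hypothesis g_act : forall u x, g (top_act u x) = top_act u (g x).

(* The submodule of M x M generated by the graph of g; it will turn out to be the
   graph of the extension of g. *)
Let graphT (z : M * M) : Prop := exists w : top_space M, z = (subval w, subval (g w)).
Let graph : submodClosed (pair_module M) := mode_span (M := pair_module M) graphT.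

Let graph_mode u n x y : (x, y) \in graph -> (wmode u n x, wmode u n y) \in graph.
Proof. exact: (@mode_span_closed _ _ (pair_module M) graphT u n (x, y)). Qed.

Let graph_ind (Q : M -> M -> Prop) : Q 0 0 ->
  (forall x y x' y', Q x y -> Q x' y' -> Q (x + x') (y + y')) ->
  (forall a x y, Q x y -> Q (a *: x) (a *: y)) ->
  (forall s u n (w : top_space M), u \in wt_space V s ->
     Q (wmode u n (subval w)) (wmode u n (subval (g w)))) ->
  forall x y, (x, y) \in graph -> Q x y.
Proof.
move=> Q0 QD QZ Qgen.
suff H z : z \in graph -> Q z.1 z.2 by move=> x y /H.
move: z; apply: span_ind => [|[x y] [x' y']|a [x y]|_ [u [n [_ [[w ->] ->]]]]] //=.
- exact: QD.
- exact: QZ.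
elim/(homogeneous_ind (wt_grading V)): u => [|u u' IHu IHu'|s u us].
- by rewrite !wmode0.
- by rewrite !wmodeD; apply: QD.
exact: Qgen us.
Qed.

Let graph_component j x y : (x, y) \in graph -> (comp j x, comp j y) \in graph.
Proof.
move=> gxy; move: x y gxy j; apply: graph_ind => [|x y x' y' gx gx'|a x y gx|s u n w us] j.
- by rewrite component0; apply: (rpred0 graph).
- by rewrite !componentD; apply: (rpredD (S := graph) (gx j) (gx' j)).
- by rewrite !componentZ; apply: (rpredZ (s := graph) a (gx j)).
rewrite !(component_top_mode _ _ us (subvalP _)); case: eqP => _; last exact: (rpred0 graph).
exact: (@mode_span_gen _ _ (pair_module M) graphT u n (subval w, subval (g w))
  (ex_intro _ w erefl)).
Qed.

(** The only modes keeping M(0) in degree 0 are the o(u), and g commutes with them: in degree 0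
    nothing is added to the graph of g. *)
Let graph_top x y : (x, y) \in graph ->
  exists w : top_space M, comp 0 x = subval w /\ comp 0 y = subval (g w).
Proof.
have gD w w' : g (w + w') = g w + g w'.
  by have := g_linear 1 w w'; rewrite !scale1r.
have g0 : g 0 = 0 by apply: (addrI (g 0)); rewrite -gD !addr0.
move: x y; apply: graph_ind => [|x y x' y' [w [wx wy]] [w' [wx' wy']]|a x y [w [wx wy]]|s u n w us].
- by exists 0; rewrite g0 !component0.
- by exists (w + w'); rewrite gD !componentD wx wy wx' wy'.
- exists (a *: w); rewrite !componentZ wx wy; split=> //.
  by have := g_linear a w 0; rewrite g0 !addr0 => ->.
rewrite !(component_top_mode _ _ us (subvalP _)); case: eqP => n_s; last by exists 0; rewrite g0.
exists (top_act u w); rewrite g_act /= !(zero_modeE _ us).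
by have -> : s%:Z - 1 = n by lia.
Qed.

Let vertical (y : M) : bool := ((0, y) : pair_module M) \in graph.
Let vertical_closed : subsemimod_closed (vertical : {pred M}).
Proof.
split; first split.
- exact: (rpred0 graph).
- move=> x y vx vy; rewrite unfold_in /vertical -[0]addr0.
  exact: (rpredD (S := graph) vx vy).
- move=> a x vx; rewrite unfold_in /vertical -[0](scaler0 _ a).
  exact: (rpredZ (s := graph) a vx).
Qed.

(** The vectors y with (0, y) in the graph form an admissible submodule. Were it all of M, it would
    contain [w0], and [graph_top] would give w0 = g 0 = 0. *)
Let vertical0 y : (0, y) \in graph -> y = 0.
Proof.
move=> gy; have [_ /(_ (closed_pred vertical_closed))] := irrM.
case=> [|V0|VT].
- apply: graded_submodule => [u n w vw|w vw j].
    by have := graph_mode u n vw; rewrite wmode_r0.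
  by have := graph_component j vw; rewrite component0.
- exact: V0.
have := VT w0; move/graph_top=> [w []]; rewrite component0 (componentE _ _ w0M) eqxx.
move=> w_0 w0_w; case/eqP: w0_neq0; rewrite w0_w.
have -> : w = 0 by apply: val_inj.
have := g_linear (-1) 0 0; rewrite addr0 scaler0 scaleN1r addNr => ->.
by [].
Qed.

Let graph_total x : exists y, (x, y) \in graph.
Proof.
move: (top_generates x); move: x; apply: span_ind.
- by exists 0; apply: (rpred0 graph).
- by move=> x x' [y gy] [y' gy']; exists (y + y'); apply: (rpredD (S := graph) gy gy').
- by move=> a x [y gy]; exists (a *: y); apply: (rpredZ (s := graph) a gy).
move=> _ [u [n [w [w_top ->]]]]; exists (wmode u n (subval (g (Submodule w_top)))).
exact: (@mode_span_gen _ _ (pair_module M) graphT u n _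
  (ex_intro _ (Submodule w_top) erefl)).
Qed.

Let graph_unique x y y' : (x, y) \in graph -> (x, y') \in graph -> y = y'.
Proof.
move=> gy gy'; apply/eqP; rewrite -subr_eq0; apply/eqP/vertical0.
rewrite -[0](subrr x).
exact: (rpredD (S := graph) gy (rpredN_submod (W := graph) gy')).
Qed.

Lemma extend_top : exists f : EndV M, restrict f =1 g.
Proof.
have [f fP] := choice graph_total.
have [|u n w|e ef] := @EndV_of _ _ M f.
- move=> a x y; apply: graph_unique (fP _) _.
  exact: (rpredD (S := graph) (rpredZ (s := graph) a (fP x)) (fP y)).
- by apply: graph_unique (fP _) _; apply: graph_mode.
exists e => w; apply: val_inj; rewrite /= ef; apply: graph_unique (fP _) _.
by apply: (@mode_span_sub _ _ (pair_module M)); exists w.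
Qed.
End Extension.

Variables (H : zhu_welldef V) (HM : top_welldef M).
Local Notation S := (top_module H HM).

Theorem EndV_EndA_iso : alg_isomorphic (EndV M) (EndA S).
Proof.
have restr_linear (f : EndV M) : linear (restrict f).
  by move=> a x y; apply: val_inj; apply: EndV_linear.
have restr_act (f : EndV M) u x : restrict f (top_act u x) = top_act u (restrict f x).
  by apply: val_inj; apply: zero_mode_morph => *; [apply: EndVD|apply: EndV_mode].
have [phi phiE] := choice (fun f => EndA_top_of H HM (restr_linear f) (restr_act f)).
exists phi; split.
- move=> a f f'; apply: endfun_ext => x.
  rewrite phiE -[RHS]/((a *: (endfun (phi f) x : restr S)) + endfun (phi f') x).
  by rewrite restr_scaleE !phiE; apply: val_inj.
- split; first by apply: endfun_ext => x; rewrite phiE; apply: val_inj.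
  move=> f f'; apply: endfun_ext => x; rewrite phiE.
  by rewrite -[RHS]/(endfun (phi f) (endfun (phi f') x)) !phiE; apply: val_inj.
have phi_inj : injective phi.
  by move=> f f' ff'; apply: restrict_inj => x; rewrite -!phiE ff'.
have /choice[psi psiK] : forall e : EndA S, exists f, phi f = e.
  move=> e; have [f fe] := extend_top (EndA_top_linear e) (EndA_top_act e).
  by exists f; apply: endfun_ext => x; rewrite phiE fe.
by exists psi => // f; apply: phi_inj; rewrite psiK.
Qed.

End Restriction.

Theorem theorem1p2 (F : fieldType) (charF : 2%N \notin [pchar F]) :
  [/\
    forall (V : voa F) (M : admissible_module V),
      irreducible M -> (exists2 w, w \in deg_space M 0 & w != 0) ->
      exists (H : zhu_welldef V) (HM : top_welldef M),
        alg_isomorphic (EndV M) (EndA (top_module H HM)),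
    forall V : voa F, strongly_fin_gen V ->
      exists (H : zhu_welldef V) (HF : is_filtered (level_filtration H)),
        commutative_alg (gr HF) /\ fin_gen_alg (gr HF)
  & forall (A : algebra F) (Fl : nat -> submodClosed A) (HF : is_filtered Fl),
      commutative_alg (gr HF) -> fin_gen_alg (gr HF) ->
      forall S : lmodType A, simple_module S ->
        (forall f : EndA S, algebraic_elt f) /\ findim (EndA S) ].
Proof.
split.
- move=> V M irrM [w0 w0M w0_neq0].
  exists (zhu_welldefP V), (top_welldefP M).
  exact: (EndV_EndA_iso irrM w0M w0_neq0).
- move=> V sfg; exists (zhu_welldefP V), (level_filtered (zhu_welldefP V)); split.
    by apply: gr_commutative => p q a b; apply: level_comm.
  exact: gr_zhu_fin_gen.
- move=> A Fl HF cA fgA S simpS; exact: (EndA_simple_findim cA fgA simpS).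
Qed.
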